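(* Let $(\mathbb P^{s,x})_{(s,x)\in[0,T]\times E}$ be a canonical Markov class associated to a transition kernel measurable in time, solving the martingale problem associated to $(\mathcal D(a),a,V)$. Let $\psi=(\psi_1,\dots,\psi_d)\in\mathcal D(a)^d$ be such that for every $i$: $\langle M[\psi_i]^{s,x}\rangle$ is absolutely continuous with respect to $V$ under every $\mathbb P^{s,x}$; $a(\psi_i)\in\mathcal L^2_X$; and $\mathfrak G^{\psi_i}(\psi_i)$ is bounded. Let $\zeta,\eta:E\to\mathbb R_+$ be Borel such that the class satisfies $H^{mom}(\zeta,\eta)$, and let $(f,g)$ satisfy $H^{growth}(\zeta,\eta)$. Then a classical solution of $Pseudo\text{-}PDE(f,g)$ is a decoupled mild solution. Conversely, a decoupled mild solution $u$ of $Pseudo\text{-}PDE(f,g)$ belonging to $\mathcal D(\Gamma^\psi)$ is a classical solution of $Pseudo\text{-}PDE(f,g)$ up to a zero potential set, meaning that $u(T,\cdot)=g$ and the equality $a(u)+f(\cdot,\cdot,u,\Gamma^\psi(u))=0$ holds up to a set of zero potential.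
   Context: **Canonical Markov class.** $E$ is a Polish space, $\Omega$ the space of càdlàg functions $[0,T]\to E$, $X$ the canonical process, $\mathcal F=\sigma(X_r:r\in[0,T])$, $\mathcal F_t=\bigcap_{u\in]t,T]}\sigma(X_r:r\le u)$ for $t<T$, $\mathcal F_T=\mathcal F$. A transition kernel $P=(P_{s,t})$ is a family of Markov kernels on $E$ with $P_{s,t}(x,A)=\mathbf 1_A(x)$ if $t\le s$ and $\int P_{s,t}(x,dy)P_{t,u}(y,A)=P_{s,u}(x,A)$ for $s<t<u$; it is measurable in time if $(s,x)\mapsto P_{s,t}(x,A)$ is Borel for all $t,A$. A canonical Markov class associated to $P$ is a family of probabilities $\mathbb P^{s,x}$ on $(\Omega,\mathcal F)$ with $\mathbb P^{s,x}(X_t\in A)=P_{s,t}(x,A)$ for all $t,A$, and $\mathbb P^{s,x}(X_u\in A\mid\mathcal F_t)=P_{t,u}(X_t,A)$ $\mathbb P^{s,x}$-a.s. for $s\le t\le u$. $(\mathcal F^{s,x},(\mathcal F^{s,x}_t))$ are the $\mathbb P^{s,x}$-completions; martingales under $\mathbb P^{s,x}$ refer to this basis. $P_{s,t}[\phi](x)=\int\phi(y)P_{s,t}(x,dy)$. **Martingale problem.** $V:[0,T]\to\mathbb R_+$ is non-decreasing, continuous, $V_0=0$; $\mathcal D(a)$ is a linear space of Borel functions $[0,T]\times E\to\mathbb R$ and $a$ a linear operator from $\mathcal D(a)$ to the Borel functions. The class solves the martingale problem for $(\mathcal D(a),a,V)$ if for all $(s,x)$: $\mathbb P^{s,x}(X_t=x\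 \forall t\in[0,s])=1$, and for every $\phi\in\mathcal D(a)$, $\phi(\cdot,X_\cdot)-\int_s^\cdot a(\phi)(r,X_r)dV_r$ on $[s,T]$ is a càdlàg square integrable $\mathbb P^{s,x}$-martingale. $M[\phi]^{s,x}:=\mathbf 1_{[s,T]}(\phi(\cdot,X_\cdot)-\phi(s,x)-\int_s^\cdot a(\phi)(r,X_r)dV_r)$. $\langle\cdot,\cdot\rangle$: predictable angle bracket. **Spaces and operators.** A Borel set $A\subset[0,T]\times E$ is of zero potential if $\mathbb E^{s,x}[\int_s^T\mathbf 1_{\{(t,X_t)\in A\}}dV_t]=0$ for all $(s,x)$. For $p>0$, $\mathcal L^p_X$ is the set of Borel $\phi:[0,T]\times E\to\mathbb R$ with $\mathbb E^{s,x}[\int_s^T|\phi|^p(r,X_r)dV_r]<\infty$ for all $(s,x)$. Under the absolute continuity assumption, $\mathfrak G^{\psi_i}(\psi_i)$ is the Borel function, unique up to zero potential sets, with $\langle M[\psi_i]^{s,x}\rangle=\int_s^{\cdot\vee s}\mathfrak G^{\psi_i}(\psi_i)(r,X_r)dV_r$ under every $\mathbb P^{s,x}$. $\mathcal D(\Gamma^\psi)=\{\phi\in\mathcal D(a):\phi\psi_i\in\mathcal D(a)\ \forall i\}$ and $\Gamma^\psi(\phi)=(a(\phi\psi_i)-\phi a(\psi_i)-\psi_ia(\phi))_{i\le d}$ for $\phi\in\mathcal D(\Gamma^\psi)$. **Hypotheses.** $H^{mom}(\zeta,\eta)$: $\mathbb E^{s,x}[\zeta^2(X_T)]<\infty$ and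 $\mathbb E^{s,x}[\int_0^T\eta^2(X_r)dV_r]<\infty$ for all $(s,x)$. $H^{growth}(\zeta,\eta)$: $f:[0,T]\times E\times\mathbb R\times\mathbb R^d\to\mathbb R$, $g:E\to\mathbb R$ are Borel and for some positive constants, $|g(x)|\le C(1+\zeta(x))$ and $|f(t,x,y,z)|\le C'(1+\eta(x)+|y|+\|z\|)$. **Notions of solution.** $Pseudo\text{-}PDE(f,g)$ is the equation $a(u)+f(\cdot,\cdot,u,\Gamma^\psi(u))=0$ on $[0,T]\times E$, $u(T,\cdot)=g$. A classical solution is a $u\in\mathcal D(\Gamma^\psi)$ satisfying these equalities everywhere. A Borel $u:[0,T]\times E\to\mathbb R$ is a decoupled mild solution if there is a Borel $v=(v_1,\dots,v_d):[0,T]\times E\to\mathbb R^d$ such that $u,v_1,\dots,v_d\in\mathcal L^2_X$ and for every $(s,x)$ and every $i\in\{1,\dots,d\}$, $$u(s,x)=P_{s,T}[g](x)+\int_s^TP_{s,r}[f(\cdot,\cdot,u,v)(r,\cdot)](x)dV_r,$$ $$u\psi_i(s,x)=P_{s,T}[g\psi_i(T,\cdot)](x)-\int_s^TP_{s,r}[(v_i+ua(\psi_i)-\psi_if(\cdot,\cdot,u,v))(r,\cdot)](x)dV_r,$$ where $f(\cdot,\cdot,u,v)(t,x)=f(t,x,u(t,x),v(t,x))$. *)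

(* Defs.v *)
From HB Require Import structures.
From mathcomp Require Import all_boot all_order all_algebra.
From mathcomp Require Import all_classical all_reals all_analysis.
From mathcomp Require Import measurable_realfun.

Set Implicit Arguments.
Unset Strict Implicit.
Unset Printing Implicit Defensive.

Import Order.TTheory GRing.Theory Num.Theory.
Import numFieldNormedType.Exports.

Local Open Scope classical_set_scope.
Local Open Scope ring_scope.

Record time (R : realType) (T : {nonneg R}) := Time {
  tval :> R;
  tvalP : 0 <= tval <= T%:num }.

Section time_theory.
Context {R : realType} {T : {nonneg R}}.

HB.instance Definition _ := [isSub for (@tval R T)].
HB.instance Definition _ := [Choice of time T by <:].

Lemma clamp_subproof (r : R) : 0 <= Num.max 0 (Num.min r T%:num) <= T%:num.
Proof. by rewrite le_max lexx /= ge_max ge_min lexx orbT andbT. Qed.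

(* Nearest-point projection R -> [0, T]. A function w on [0, T] is extended to
   R, constantly on each side of [0, T], by w \o clamp. *)
Definition clamp (r : R) : time T := Time (clamp_subproof r).

Definition t0 : time T := clamp 0.
Definition tT : time T := clamp T%:num.

HB.instance Definition _ := isPointed.Build (time T) t0.

HB.instance Definition _ :=
  Measurable.copy (time T) (g_sigma_algebra_preimageType (@tval R T)).

(* All the integrals from s to t are taken over it: as V
   is continuous, dV does not charge points. *)
Definition oc (s t : time T) : set (time T) :=
  [set r | s < r :> R /\ r <= t :> R].

Lemma clampK (t : time T) : clamp t = t.
Proof.
by apply/val_inj => /=; have /andP[t_ge0 t_leT] := tvalP t;
   rewrite min_l ?max_r.
Qed.

Lemma clamp_nd (r s : R) : r <= s -> (clamp r : R) <= (clamp s : R).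
Proof.
move=> rs /=.
rewrite ge_max le_max lexx /= le_max; apply/orP; right.
by rewrite le_min !ge_min rs lexx orbT.
Qed.

Lemma continuous_tval_clamp : continuous (fun r : R => clamp r : R).
Proof.
move=> r /=; apply: (@continuous_max _ _ (fun=> 0) (fun x => Num.min x T%:num)).
  exact: cvg_cst.
by apply: (@continuous_min _ _ (fun x => x) (fun=> T%:num));
  [exact: cvg_id|exact: cvg_cst].
Qed.

Lemma measurable_clamp :
  measurable_fun [set: measurableTypeR R] (clamp : measurableTypeR R -> time T).
Proof.
move=> _ _ [B mB <-]; rewrite !setTI -comp_preimage.
rewrite -[X in measurable X]setTI.
exact: (continuous_measurable_fun continuous_tval_clamp).
Qed.

(* Right-continuity and existence of left limits on [s, T]. Extending by
   w \o clamp makes the right-continuity condition void at T. *)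
Definition cadlag_from (U : topologicalType) (s : time T) (w : time T -> U) :=
  forall t : time T, s <= t :> R ->
    (w \o clamp) @ (t : R)^'+ --> w t /\
    (s < t :> R -> exists l : U, (w \o clamp) @ (t : R)^'- --> l).

(* The Stieltjes measure on [0, T] of the restriction of F to [0, T], for F
   constant on each side of [0, T]. *)
Definition time_measure (F : cumulative R R) : set (time T) -> \bar R :=
  pushforward (lebesgue_stieltjes_measure F : set (measurableTypeR R) -> \bar R)
    clamp.

HB.instance Definition _ (F : cumulative R R) :=
  Measure.copy (time_measure F)
    (measure_function_pushforward__canonical__measure_function_Measure
       (lebesgue_stieltjes_measure F) measurable_clamp).

End time_theory.

Record clock (R : realType) (T : {nonneg R}) := Clock {
  clock_fun :> time T -> R;
  clock_ge0 : forall t, 0 <= clock_fun t;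
  clock_nd : forall s t : time T, s <= t :> R -> clock_fun s <= clock_fun t;
  clock_continuous : continuous (clock_fun \o clamp : R -> R);
  clock0 : clock_fun t0 = 0 }.

Section clock_measure.
Context {R : realType} {T : {nonneg R}} (V : clock T).

Definition clock_ext : R -> R := V \o clamp.

Lemma clock_ext_nd : nondecreasing clock_ext.
Proof. by move=> r s rs; apply/clock_nd/clamp_nd. Qed.

Lemma clock_ext_rc : right_continuous clock_ext.
Proof. exact/right_continuousW/clock_continuous. Qed.

HB.instance Definition _ :=
  isCumulative.Build R _ R clock_ext clock_ext_nd clock_ext_rc.

Definition dV : {measure set (time T) -> \bar R} := time_measure clock_ext.

End clock_measure.

(* A Polish space, presented with a complete pseudometric structure inducing its
   topology. Since such a space is second countable, the product sigma-algebras
   on time T * borel E and on its products with R and d.-tuple R are the Borel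
   ones. *)
Definition polish (R : realType) (E : completePseudoMetricType R) :=
  hausdorff_space E /\ exists2 D : set E, countable D & dense D.

Definition borel (E : ptopologicalType) : Type :=
  g_sigma_algebraType (@open E).
HB.instance Definition _ (E : ptopologicalType) :=
  Measurable.copy (borel E) (g_sigma_algebraType (@open E)).

Record cadlag_path (R : realType) (T : {nonneg R}) (E : ptopologicalType) :=
  CadlagPath {
    path_fun :> time T -> E;
    path_cadlag : cadlag_from t0 path_fun }.

Section canonical_space.
Context {R : realType} (T : {nonneg R}) (E : ptopologicalType).

HB.instance Definition _ := gen_eqMixin (cadlag_path T E).
HB.instance Definition _ := gen_choiceMixin (cadlag_path T E).

Lemma cst_cadlag : cadlag_from t0 (cst point : time T -> E).
Proof. by move=> t _; split=> [|_]; [|exists point]; exact: cvg_cst. Qed.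

HB.instance Definition _ :=
  isPointed.Build (cadlag_path T E) (CadlagPath cst_cadlag).

(* They generate sigma(X_r : r \in J). *)
Definition cylinders (J : set (time T)) : set (set (cadlag_path T E)) :=
  [set A | exists2 r, J r &
    exists2 B : set (borel E), measurable B & A = [set w : cadlag_path T E | B (w r)]].

Definition Omega : Type := g_sigma_algebraType (cylinders setT).
HB.instance Definition _ :=
  Measurable.copy Omega (g_sigma_algebraType (cylinders setT)).

(* The right-continuous filtration F_t = \bigcap_(u > t) sigma(X_r : r <= u),
   with F_T = sigma(X_r : r <= T). For t < T the first condition is implied by
   the second one; for t = T the second one is void. *)
Definition filt (t : time T) : set (set Omega) :=
  [set A | <<s cylinders setT>> A /\
    forall u : time T, t < u :> R -> <<s cylinders [set r | r <= u :> R]>> A].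

End canonical_space.

(* g is a version of E[f | G], for a sub-sigma-algebra G of measurable. *)
Definition is_cond_exp (R : realType) d (W : measurableType d)
    (mu : {measure set W -> \bar R}) (G : set (set W)) (f g : W -> R) :=
  [/\ mu.-integrable setT (EFin \o f),
      mu.-integrable setT (EFin \o g),
      forall B : set R, measurable B -> G (g @^-1` B) &
      forall A, G A ->
        (\int[mu]_(w in A) (g w)%:E = \int[mu]_(w in A) (f w)%:E)%E].

Section stochastic_basis.
Context {R : realType} {T : {nonneg R}} {E : ptopologicalType}.
Variable P : probability (Omega T E) R.

(* Its domain, the Caratheodory sigma-algebra of the outer measure P^*, is the
   P-completion of the sigma-algebra of Omega. *)
Definition completion := @completed_measure_extension _ _ _ P.

Definition cfilt (t : time T) : set (set (Omega T E)) :=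
  <<s filt t `|` [set N | P.-negligible N]>>.

(* The case u = t gives integrability and adaptedness. *)
Definition martingale_from (s : time T) (M : time T -> Omega T E -> R) :=
  forall u t : time T, s <= u :> R -> u <= t :> R ->
    is_cond_exp completion (cfilt u) (M t) (M u).

Definition cadlag_L2_martingale_from (s : time T)
    (M : time T -> Omega T E -> R) :=
  [/\ martingale_from s M,
      forall t : time T, s <= t :> R ->
        (\int[completion]_w ((M t w) ^+ 2)%:E < +oo)%E &
      {ae P, forall w, cadlag_from s (M ^~ w)}].

Definition predictable_rect : set (set (time T * Omega T E)) :=
  [set Q | (exists2 A, cfilt t0 A & Q = [set t0] `*` A) \/
           (exists (u t : time T) A, cfilt u A /\
              Q = oc u t `*` A)].

Definition predictable (A : time T -> Omega T E -> R) :=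
  forall B : set R, measurable B ->
    <<s predictable_rect>> [set p | B (A p.1 p.2)].

(* A is a version of <M>, for M a square integrable martingale null at t0; this
   determines A up to indistinguishability. *)
Definition is_angle_bracket (M A : time T -> Omega T E -> R) :=
  [/\ predictable A,
      {ae P, forall w, [/\ A t0 w = 0, cadlag_from t0 (A ^~ w) &
         forall r t : time T, r <= t :> R -> A r w <= A t w]} &
      martingale_from t0 (fun t w => M t w ^+ 2 - A t w)].

Definition abs_continuous_wrt (V : clock T) (A : time T -> Omega T E -> R) :=
  {ae P, forall w, exists2 F : cumulative R R,
     (forall r : R, F r = A (clamp r) w) & time_measure F `<< dV V}.

End stochastic_basis.

Section setting.
Context {R : realType} {T : {nonneg R}} {E : completePseudoMetricType R}.
Local Notation bE := (borel E).
Local Notation Omega := (Omega T E).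
Local Notation space_time := (time T * bE)%type.
Variable (P : time T -> time T -> R.-pker bE ~> bE).
Variable (PP : time T -> E -> probability Omega R).
Variables (D : set (space_time -> R)) (a : (space_time -> R) -> space_time -> R).
Variable V : clock T.

Definition transition_kernel :=
  (forall (s t : time T) (x : bE) (A : set bE), measurable A ->
     t <= s :> R -> P s t x A = (\1_A x)%:E) /\
  (forall (s t u : time T) (x : bE) (A : set bE), measurable A ->
     s < t :> R -> t < u :> R ->
     (\int[P s t x]_y P t u y A = P s u x A)%E).

Definition measurable_in_time :=
  forall (t : time T) (A : set bE), measurable A ->
    measurable_fun setT (fun p : space_time => P p.1 t p.2 A).

Definition canonical_Markov_class :=
  (forall (s : time T) (x : E) (t : time T) (A : set bE), measurable A ->
     PP s x [set w | A (w t)] = P s t x A) /\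
  (forall (s : time T) (x : E) (t u : time T) (A : set bE), measurable A ->
     s <= t :> R -> t <= u :> R ->
     is_cond_exp (PP s x) (filt t)
       (fun w => \1_A (w u : bE)) (fun w => fine (P t u (w t) A))).

(* a is a total function, of which only the restriction to D is used. *)
Definition linear_operator :=
  [/\ forall phi, D phi -> measurable_fun setT phi /\ measurable_fun setT (a phi),
      D (fun=> 0) &
      forall (k : R) phi chi, D phi -> D chi ->
        D (fun p => k * phi p + chi p) /\
        a (fun p => k * phi p + chi p) = fun p => k * a phi p + a chi p].

Definition mp_process (phi : space_time -> R) (s t : time T) (w : Omega) : R :=
  phi (t, w t) -
  \int[dV V]_(r in oc s t) a phi (r, w r).

(* The almost sure integrability is what makes mp_process meaningful: an
   integral that does not exist is given a default value by Rintegral. *)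
Definition solves_martingale_problem :=
  forall (s : time T) (x : E),
    PP s x [set w : Omega | forall t : time T, t <= s :> R -> w t = x] = 1%E /\
    forall phi, D phi ->
      {ae PP s x, forall w : Omega,
         (dV V).-integrable (oc s tT)
           (fun r => (a phi (r, w r))%:E)} /\
      cadlag_L2_martingale_from (PP s x) s (mp_process phi s).

Definition mart (phi : space_time -> R) (s : time T) (x : E)
    (t : time T) (w : Omega) : R :=
  if s <= t :> R then mp_process phi s t w - phi (s, x) else 0.

Definition zero_potential (A : set space_time) :=
  measurable A /\
  forall (s : time T) (x : E), (\int[PP s x]_w \int[dV V]_(t in oc s tT)
                 (\1_A (t, w t))%:E = 0)%E.

Definition LX (p : R) (phi : space_time -> R) :=
  measurable_fun setT phi /\
  forall (s : time T) (x : E), (\int[PP s x]_w \int[dV V]_(r in oc s tT)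
                 (`|phi (r, w r)| `^ p)%:E < +oo)%E.

Definition bracket_abs_continuous (phi : space_time -> R) :=
  forall (s : time T) (x : E), exists2 A, is_angle_bracket (PP s x) (mart phi s x) A &
    abs_continuous_wrt (PP s x) V A.

(* G is a version of the density of <M[phi]^{s,x}> with respect to dV, unique up
   to sets of zero potential. For t < s the integral is over the empty set. *)
Definition is_bracket_density (phi G : space_time -> R) :=
  measurable_fun setT G /\
  forall (s : time T) (x : E) A, is_angle_bracket (PP s x) (mart phi s x) A ->
    {ae PP s x, forall w : Omega, forall t : time T,
      ((A t w)%:E = \int[dV V]_(r in oc s t)
                      (G (r, w r))%:E)%E}.

Definition bounded_function (G : space_time -> R) :=
  exists C : R, forall p, `|G p| <= C.

Variables (d : nat) (psi : 'I_d -> space_time -> R).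

Definition dom_Gamma : set (space_time -> R) :=
  [set phi | D phi /\ forall i, D (fun p => phi p * psi i p)].

Definition Gamma (phi : space_time -> R) (p : space_time) : d.-tuple R :=
  [tuple a (fun q => phi q * psi i q) p - phi p * a (psi i) p
         - psi i p * a phi p | i < d].

Definition H_mom (zeta eta : bE -> R) :=
  forall (s : time T) (x : E),
    (\int[PP s x]_w (zeta (w tT) ^+ 2)%:E < +oo)%E /\
    (\int[PP s x]_w \int[dV V]_(r in oc t0 tT) (eta (w r) ^+ 2)%:E < +oo)%E.

Definition enorm (z : d.-tuple R) : R := Num.sqrt (\sum_(i < d) tnth z i ^+ 2).

Definition H_growth (zeta eta : bE -> R)
    (f : space_time * R * d.-tuple R -> R) (g : bE -> R) :=
  [/\ measurable_fun setT f, measurable_fun setT g,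
      exists2 C : R, 0 < C & forall x, `|g x| <= C * (1 + zeta x) &
      exists2 C' : R, 0 < C' & forall t x y z,
        `|f (t, x, y, z)| <= C' * (1 + eta x + `|y| + enorm z)].

Variables (f : space_time * R * d.-tuple R -> R) (g : bE -> R).

Definition classical_solution (u : space_time -> R) :=
  [/\ dom_Gamma u,
      forall p, a u p + f (p, u p, Gamma u p) = 0 &
      forall x, u (tT, x) = g x].

Definition decoupled_mild_solution (u : space_time -> R) :=
  measurable_fun setT u /\
  exists v : space_time -> d.-tuple R,
    [/\ measurable_fun setT v, LX 2 u, forall i, LX 2 (fun p => tnth (v p) i) &
    forall (s : time T) (x : bE),
      ((u (s, x))%:E = \int[P s tT x]_y (g y)%:E +
         \int[dV V]_(r in oc s tT) \int[P s r x]_y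
           (f (r, y, u (r, y), v (r, y)))%:E)%E /\
      forall i,
      ((u (s, x) * psi i (s, x))%:E =
         \int[P s tT x]_y (g y * psi i (tT, y))%:E -
         \int[dV V]_(r in oc s tT) \int[P s r x]_y
           (tnth (v (r, y)) i + u (r, y) * a (psi i) (r, y)
            - psi i (r, y) * f (r, y, u (r, y), v (r, y)))%:E)%E].

End setting.

(* Main.v *)
(* Forward direction. Along the path, a classical solution u turns u and u psi_i
   into martingales up to an integral in dV, and taking expectations gives the two
   mild equations, provided that u and v = Gamma(u) are in L^2_X. Let M and N be
   the martingale parts of u and psi_i, chi a continuous decreasing weight
   localizing the integrals, and h bounded and known at time r. Jensen's inequality
   for (M - h N)^2 on ]r, t] bounds
   2 E int h chi Gamma dV - E int h^2 chi G dV by the increment of E[chi M^2] minus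
   an integral against d chi; these bounds telescope to E[M_T^2]. Step processes
   being dense among the functions of (r, X_r), one may take h = Gamma / C,
   truncated, where C bounds G; this gives E int Gamma^2 dV <= C E[M_T^2]. The
   growth of f and Gronwall's lemma then give u in L^2_X.
   Converse. By the Markov property, the mild equations say that
   u(t, X_t) + int f dV and (u psi_i)(t, X_t) - int (v_i + u a(psi_i) - psi_i f) dV
   are martingales. So are the processes of the martingale problem, and the
   differences are continuous with finite variation, hence have no drift:
   a(u) = - f and a(u psi_i) = v_i + u a(psi_i) - psi_i f up to zero potential,
   whence Gamma(u) = v. *)
From HB Require Import structures.
Require Import Defs.
From mathcomp Require Import all_boot all_order all_algebra.
From mathcomp Require Import all_classical all_reals all_analysis.
From mathcomp Require Import measurable_realfun ring lra.
Set Implicit Arguments.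
Unset Strict Implicit.
Unset Printing Implicit Defensive.
Import Order.TTheory GRing.Theory Num.Theory.
Import numFieldNormedType.Exports.
Local Open Scope classical_set_scope.
Local Open Scope ring_scope.

(** * Time, paths and joint measurability *)

(** The obstacle is that only the brackets of the martingales of the psi_i are given: neither a
    density for the bracket of M nor any integrability of Gamma is available beforehand. A
    variational inequality takes the place of Kunita-Watanabe: formally, 2 h Gamma - h^2 G is the
    density of the bracket of M minus that of M - h N, hence is at most that of M, for every h.
    Optimizing would give Gamma^2 / G; a bound of G is enough, and C + 1 is taken instead of C so
    that the division is safe. As Gamma is not known to be integrable, it is truncated and the
    truncation is removed by Fatou. The weight chi replaces stopping times: it is absolutely
    continuous in dV, so products are handled by integration by parts for an atomless measure.
    Adaptedness is tested on paths: a measurable set unchanged when paths are stopped at t lies in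
    F_t, so the martingales of the completed basis may be tested on such sets. Steps must take their
    values at left endpoints to be adapted; they converge off the jump times, which are countable.
    Gronwall is applied path by path with one constant, because finiteness in expectation is the
    conclusion sought. *)

Section time_facts.
Context {R : realType} {T : {nonneg R}}.
Local Notation tm := (time T).
Implicit Types q r s t : tm.

Lemma measurable_time_val : measurable_fun setT (fun t : tm => t : R).
Proof. by move=> _ B mB; rewrite setTI; exists B => //; rewrite setTI. Qed.

Lemma measurable_to_time d (X : measurableType d) (f : X -> tm) :
  measurable_fun setT (fun x => f x : R) -> measurable_fun setT f.
Proof.
move=> mf _ A [B mB <-]; rewrite !setTI -comp_preimage.
by rewrite -[X in measurable X]setTI; exact: mf.
Qed.

Lemma time_ge0 t : 0 <= t :> R. Proof. by case/andP: (tvalP t). Qed.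

Lemma time_leT t : t <= T%:num :> R. Proof. by case/andP: (tvalP t). Qed.

Lemma time_inj s t : s = t :> R -> s = t. Proof. exact: val_inj. Qed.

Lemma t0E : (t0 : tm) = 0 :> R.
Proof. by rewrite /t0 /= min_l ?maxxx. Qed.

Lemma tTE : (tT : tm) = T%:num :> R.
Proof. by rewrite /tT /= minxx max_r. Qed.

Lemma clamp_id (r : R) : 0 <= r <= T%:num -> (clamp r : tm) = r :> R.
Proof. by move=> /andP[r0 rT] /=; rewrite min_l // max_r. Qed.

Lemma le_tT t : t <= (tT : tm) :> R. Proof. by rewrite tTE time_leT. Qed.

Lemma t0_le t : (t0 : tm) <= t :> R. Proof. by rewrite t0E time_ge0. Qed.

Lemma measurable_time_le d (X : measurableType d) (f g : X -> tm) :
  measurable_fun setT f -> measurable_fun setT g ->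
  measurable [set x | f x <= g x :> R].
Proof.
move=> mf mg.
rewrite -[X in measurable X]setTI; apply: measurable_fun_le => //;
  exact: (measurableT_comp measurable_time_val).
Qed.

Lemma measurable_time_lt d (X : measurableType d) (f g : X -> tm) :
  measurable_fun setT f -> measurable_fun setT g ->
  measurable [set x | f x < g x :> R].
Proof.
move=> mf mg.
rewrite (_ : mkset _ = ~` [set x | g x <= f x :> R]).
  exact/measurableC/measurable_time_le.
by apply/seteqP; split=> x /=; rewrite ltNge => /negP.
Qed.

Lemma measurable_oc s t : measurable (oc s t).
Proof.
have -> : oc s t = [set r : tm | s < r :> R] `&` [set r : tm | r <= t :> R] by [].
by apply: measurableI; [apply: measurable_time_lt|apply: measurable_time_le].
Qed.
#[local] Hint Resolve measurable_oc : core.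

Lemma measurable_time1 t : measurable [set t].
Proof.
have -> : [set t] = [set r : tm | r <= t :> R] `&` [set r : tm | t <= r :> R].
  apply/seteqP; split=> [r -> /=|r /= [rt tr]]; first by rewrite lexx.
  by apply: time_inj; apply/eqP; rewrite eq_le rt tr.
by apply: measurableI; apply: measurable_time_le.
Qed.

Lemma oc0 t : oc t t = set0.
Proof.
by apply/seteqP; split=> // r [/= tr rt]; move: (lt_le_trans tr rt); rewrite ltxx.
Qed.

Lemma ocU s r t : s <= r :> R -> r <= t :> R -> oc s t = oc s r `|` oc r t.
Proof.
move=> sr rt; apply/seteqP; split=> q /=.
  by move=> [sq qt]; case: (leP (q : R) (r : R)) => qr; [left|right].
move=> [[sq qr]|[rq qt]]; split => //; first exact: le_trans rt.
exact: le_lt_trans rq.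
Qed.

Lemma oc_disj s r t : [disjoint oc s r & oc r t].
Proof.
apply/disj_setPS => q [[/= sq qr] [/= rq qt]].
by move: (lt_le_trans rq qr); rewrite ltxx.
Qed.

Lemma sub_oc s s' t' t : s <= s' :> R -> t' <= t :> R -> oc s' t' `<=` oc s t.
Proof.
by move=> ss tt q [/= sq qt]; split; [exact: le_lt_trans sq|exact: le_trans tt].
Qed.

Lemma setT_oc : [set: tm] = [set t0] `|` oc t0 tT.
Proof.
apply/seteqP; split=> // t _; have := (t0_le t); rewrite le_eqVlt => /orP[/eqP e|lt].
  by left; apply: time_inj.
by right; split => //=; exact: le_tT.
Qed.

Variable V : clock T.

Local Notation F := (clock_ext V).
Local Notation ls := (lebesgue_stieltjes_measure (clock_ext V)).

Lemma lt_bound (x : R) : - (Num.bound x)%:R < x < (Num.bound x)%:R.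
Proof.
rewrite -ltr_norml; have := archi_boundP (normr_ge0 x).
by rewrite /Num.bound normr_id.
Qed.

Lemma ls_itv (x y : R) : x <= y -> ls `]x, y]%classic = (F y - F x)%:E.
Proof.
move=> xy; rewrite /lebesgue_stieltjes_measure /measure_extension/=.
rewrite measurable_mu_extE /=; last by exists (x, y).
by rewrite wlength_itv_bnd.
Qed.

Lemma ls_flat (x y : R) : F x = F y -> ls.-negligible `]x, y]%classic.
Proof.
move=> e; case: (leP x y) => xy; last first.
  by rewrite set_itv_ge ?bnd_simp -?leNgt ?ltW//; exact: negligible_set0.
apply/negligibleP => //.
by rewrite [X in X = _]ls_itv// e subrr.
Qed.

(** Continuity of the clock at x makes the mass of a short interval to the left of x, which contains
    x, as small as wanted. *)
Lemma ls_point (x : R) : ls.-negligible [set x].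
Proof.
apply/negligibleP => //.
apply/eqP; rewrite eq_le measure_ge0 andbT; apply/lee_addgt0Pr => e e0.
rewrite add0e.
have /cvgrPdist_le/(_ _ e0)[d /= d0 H] := @clock_continuous _ _ V x.
have xd : x - d / 2 <= x by rewrite lerBlDr lerDl divr_ge0// ltW.
apply: (@le_trans _ _ (ls `]x - d / 2, x]%classic)).
  apply: le_measure; rewrite ?inE// => y ->.
  by rewrite /= in_itv/= lexx andbT ltrBlDr ltrDl divr_gt0.
rewrite [X in (X <= _)%E]ls_itv// lee_fin.
apply: le_trans (H (x - d / 2) _); first exact: ler_norm.
rewrite /ball_/= opprB addrC subrK gtr0_norm ?divr_gt0//.
by rewrite ltr_pdivrMr// ltr_pMr// ltr1n.
Qed.

Lemma dV_negl (A : set tm) : measurable A -> ls.-negligible (clamp @^-1` A) ->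
  dV V A = 0%E.
Proof.
move=> mA nA; rewrite /dV /= /time_measure /pushforward.
apply/negligibleP => //.
by rewrite -[X in measurable X]setTI; exact: measurable_clamp.
Qed.

Lemma clock_ext0 (x : R) : x <= 0 -> F x = 0.
Proof.
move=> x0; rewrite /clock_ext /=; rewrite -(clock0 V); congr (V _).
by apply: val_inj; rewrite /= max_l ?ge_min ?x0// min_l// maxxx.
Qed.

Lemma clock_extT (x : R) : T%:num <= x -> F x = V tT.
Proof.
move=> x0; rewrite /clock_ext /=; congr (V _).
by apply: val_inj; rewrite /= minxx min_r.
Qed.

(** The preimage of a time under [clamp] is a point or, at both ends of [0, T], a half-line. The
    extended clock is constant on these half-lines, so they add countably many flat, hence null,
    intervals. *)
Lemma dV_atom t : dV V [set t] = 0%E.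
Proof.
apply: dV_negl; first exact: measurable_time1.
apply: (@negligibleS _ _ _ ls ([set (t : R)] `|` (\bigcup_n `]- n%:R, 0]%classic
   `|` \bigcup_n `]T%:num, T%:num + n%:R]%classic))).
  move=> r /= e; case: (leP r 0) => r0.
    right; left; exists (Num.bound r) => //=.
    by rewrite in_itv/= r0 andbT; have /andP[] := lt_bound r.
  case: (ltP T%:num r) => rT.
    right; right; exists (Num.bound (r - T%:num)) => //=.
    by rewrite in_itv/= rT/= -lerBlDl; have /andP[_ /ltW] := lt_bound (r - T%:num).
  by left; rewrite -e clamp_id// (ltW r0).
apply: negligibleU; first exact: ls_point.
apply: negligibleU; apply: negligible_bigcup => n.
  by apply: ls_flat; rewrite !clock_ext0// oppr_le0.
by apply: ls_flat; rewrite !clock_extT// lerDl.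
Qed.

Lemma dV_fin : (dV V setT < +oo)%E.
Proof.
rewrite /dV /= /time_measure /pushforward preimage_setT.
have -> : [set: measurableTypeR R] = \bigcup_n `]- n%:R, n%:R]%classic.
  apply/esym; rewrite -subTset => /= x _ /=.
  exists (Num.bound x) => //=; rewrite in_itv/=.
  by have /andP[-> /ltW] := lt_bound x.
apply: (@le_lt_trans _ _ (V tT)%:E); last by rewrite ltry.
have mu_cvg : ls `](- n%:R), n%:R]%classic @[n --> \oo] -->
    ls (\bigcup_n `](- n%:R), n%:R]%classic).
  apply: nondecreasing_cvg_mu => //; first exact: bigcup_measurable.
  move=> m n mn; apply/subsetPset => x /=; rewrite !in_itv/= => /andP[a b].
  by rewrite (le_lt_trans _ a) ?lerN2 ?ler_nat// (le_trans b) ?ler_nat.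
rewrite -(cvg_lim _ mu_cvg)//; apply: lime_le; first by apply/cvg_ex; eexists; exact: mu_cvg.
apply: nearW => n.
rewrite [X in (X <= _)%E]ls_itv; last by rewrite (@le_trans _ _ 0)// oppr_le0.
rewrite lee_fin (@clock_ext0 (- n%:R)) ?oppr_le0// subr0; apply: clock_nd.
exact: le_tT.
Qed.

End time_facts.

Section urysohn_approx.
Context {R : realType} {E : pseudoMetricType R}.
Variable O : set E.
Hypothesis oO : open O.
Local Notation Dc := (edist_inf (~` O)).

(** The distance to the complement of [O], cut at 1: it stays real when the complement is empty,
    where the distance is infinite. *)
Definition trunc_dist (x : E) : R := fine (mine 1%E (Dc x)).

Lemma trunc_distE x : (trunc_dist x)%:E = mine 1%E (Dc x).
Proof.
rewrite fineK// ge0_fin_numE; last by rewrite le_min lee01 edist_inf_ge0.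
by rewrite gt_min ltry.
Qed.

Lemma trunc_dist_ge0 x : 0 <= trunc_dist x.
Proof. by rewrite -lee_fin trunc_distE le_min lee01 edist_inf_ge0. Qed.

Lemma trunc_dist_lip x y e : 0 < e -> ball x e y -> trunc_dist x <= e + trunc_dist y.
Proof.
move=> e0 xy; rewrite -lee_fin EFinD !trunc_distE.
have H : (Dc x <= e%:E + Dc y)%E.
  apply: le_trans (edist_inf_triangle _ _ y) _; apply: leeD2r.
  exact: edist_fin.
case: (leP 1%E (Dc y)) => h.
  apply: (@le_trans _ _ 1%E); first by rewrite ge_min lexx.
  by rewrite leeDr// lee_fin ltW.
by rewrite ge_min H orbT.
Qed.

Lemma trunc_dist_continuous : continuous trunc_dist.
Proof.
move=> z; apply/cvgrPdist_le => e e0.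
apply: (@filterS _ _ _ (ball z e)); last exact: nbhsx_ballx.
move=> t zt; rewrite ler_norml lerBrDr addrC !lerBlDr.
by rewrite [trunc_dist z + e]addrC !trunc_dist_lip//; exact: ball_sym.
Qed.

Lemma trunc_dist_gt0 x : O x -> 0 < trunc_dist x.
Proof.
move=> Ox; have /nbhs_ballP[e /= e0 He] : nbhs x O by exact: open_nbhs_nbhs.
rewrite -lte_fin trunc_distE lt_min lte01 /=.
apply: (@lt_le_trans _ _ e%:E); first by rewrite lte_fin.
apply: le_ereal_inf_tmp => _ [a nOa <-]; rewrite leNgt; apply/negP => /edist_lt_ball.
by move=> /He.
Qed.

Lemma trunc_dist_eq0 x : ~ O x -> trunc_dist x = 0.
Proof.
move=> Ox; apply: EFin_inj; rewrite trunc_distE edist_inf0//.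
by rewrite min_r// lee01.
Qed.

(** Continuous functions with values in [0, 1] which tend to the indicator of the open set [O]. They
    carry path regularity over to Borel sets. *)
Definition uapprox (m : nat) (x : E) : R := Num.min 1 (m%:R * trunc_dist x).

Lemma uapprox_continuous m : continuous (uapprox m).
Proof.
move=> z; apply: (@continuous_min _ _ (fun=> 1) (fun x => m%:R * trunc_dist x)).
  exact: cvg_cst.
by apply: cvgZr; exact: trunc_dist_continuous.
Qed.

Lemma uapprox_bd m x : 0 <= uapprox m x <= 1.
Proof.
by rewrite /uapprox le_min ler01 ge_min lexx /= mulr_ge0 ?trunc_dist_ge0.
Qed.

Lemma uapprox_cvg x : uapprox m x @[m --> \oo] --> (\1_O x : R).
Proof.
rewrite indicE; case: (asboolP (O x)) => Ox; last first.
  rewrite memNset//=; apply: cvg_near_cst; apply: nearW => m.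
  by rewrite /uapprox trunc_dist_eq0// mulr0 min_r.
rewrite mem_set//=; apply: cvg_near_cst.
near=> m; rewrite /uapprox min_l// -ler_pdivrMr ?trunc_dist_gt0// div1r.
near: m; exact: nbhs_infty_ger.
Unshelve. all: by end_near. Qed.
End urysohn_approx.

Section borel_facts.
Context {R : realType} {E : ptopologicalType}.

Lemma continuous_borel (phi : E -> R) : continuous phi ->
  measurable_fun [set: borel E] (phi : borel E -> R).
Proof.
move=> /continuousP cphi.
apply: (measurability _ (RGenOpens.measurableE R)) => _ [_ [a [b ->] <-]].
rewrite setTI; apply: sub_sigma_algebra; apply: cphi; exact: interval_open.
Qed.

End borel_facts.

Section paths.
Context {R : realType} {T : {nonneg R}} {E : ptopologicalType}.
Local Notation tm := (time T).
Local Notation Om := (Omega T E).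
Implicit Types (q r s t : tm) (w : Om).

Definition tmin q t : tm := if q <= t :> R then q else t.

Lemma tmin_l q t : q <= t :> R -> tmin q t = q.
Proof. by rewrite /tmin => ->. Qed.

Lemma tmin_r q t : t <= q :> R -> tmin q t = t.
Proof.
rewrite /tmin => tq; case: ifPn => // qt; apply: time_inj.
by apply/eqP; rewrite eq_le qt tq.
Qed.

Lemma tmin_le q t : tmin q t <= t :> R.
Proof. by rewrite /tmin; case: ifPn => //; rewrite -ltNge => /ltW. Qed.

Lemma stop_cadlag t w : cadlag_from t0 (fun q => w (tmin q t) : E).
Proof.
move=> r r0; have [cr cl] := path_cadlag w r0.
have near_eqP (F : set_system R) (FF : Filter F) (l : E) (v : tm -> E) :
    v \o clamp @ F --> l ->
    (\forall x \near F, w (tmin (clamp x) t) = v (clamp x)) ->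
    (fun q => w (tmin q t) : E) \o clamp @ F --> l.
  move=> vl H; apply: cvg_trans vl; apply: near_eq_cvg.
  by apply: filterS H => x /= ->.
split=> [|sr].
- case: (ltP (r : R) (t : R)) => rt.
    rewrite tmin_l ?ltW//; apply: near_eqP cr _.
    near=> x; rewrite tmin_l//.
    rewrite -(clampK t); apply: clamp_nd.
    by near: x; exact: nbhs_right_le.
  rewrite tmin_r//; apply: (@near_eqP _ _ _ (fun=> w t)); first exact: cvg_cst.
  near=> x; rewrite tmin_r//; apply: le_trans rt _.
  rewrite -[X in X <= _](congr1 (@Defs.tval _ _) (clampK r)); apply: clamp_nd.
  by near: x; exact: nbhs_right_ge.
- case: (leP (r : R) (t : R)) => rt.
    have [l hl] := cl sr; exists l; apply: near_eqP hl _.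
    near=> x; rewrite tmin_l//; apply: le_trans rt.
    rewrite -[X in _ <= X](congr1 (@Defs.tval _ _) (clampK r)); apply: clamp_nd.
    by near: x; exact: nbhs_left_le.
  exists (w t); apply: (@near_eqP _ _ _ (fun=> w t)); first exact: cvg_cst.
  near=> x; rewrite tmin_r//.
  rewrite -[X in X <= _](congr1 (@Defs.tval _ _) (clampK t)); apply: clamp_nd.
  by near: x; exact: nbhs_left_ge.
Unshelve. all: by end_near. Qed.

Definition stop t w : Om := CadlagPath (stop_cadlag t w).

Lemma path_ext (w w' : Om) : (forall q, w q = w' q) -> w = w'.
Proof.
case: w => w hw; case: w' => w' hw' /= h.
have e : w = w' by apply/funext.
by move: hw hw'; rewrite e => hw hw'; rewrite (Prop_irrelevance hw hw').
Qed.

Lemma stop_stop q t w : q <= t :> R -> stop q (stop t w) = stop q w.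
Proof.
by move=> qt; apply: path_ext => r /=; rewrite [tmin (tmin r q) t]tmin_l// (le_trans (tmin_le _ _)).
Qed.

Lemma stopE q t w : q <= t :> R -> stop t w q = w q.
Proof. by move=> qt /=; rewrite tmin_l. Qed.

Lemma measurable_eval r : measurable_fun setT (fun w : Om => w r : borel E).
Proof.
move=> _ B mB; rewrite setTI; apply: sub_sigma_algebra.
by exists r => //; exists B.
Qed.

(* Adaptedness without sigma-algebras: xi depends on the path up to t only. *)
Definition na (U : Type) t (xi : Om -> U) := forall w, xi (stop t w) = xi w.

Lemma na_le (U : Type) s t (xi : Om -> U) : s <= t :> R -> na s xi -> na t xi.
Proof. by move=> st nxi w; rewrite -nxi stop_stop// nxi. Qed.

(** Composing with [stop t] turns the coordinate at r into the coordinate at min(r, t), so preimages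
    of cylinders involve times up to t only. *)
Lemma stop_preimage t (A : set Om) : measurable A ->
  <<s cylinders [set r : tm | r <= t :> R]>> (stop t @^-1` A).
Proof.
move=> mA; pose J := g_sigma_algebraType (cylinders [set r : tm | r <= t :> R] : set (set
    (cadlag_path T E))).
have H : measurable_fun [set: J] (stop t : J -> Om).
  apply: (@measurability _ _ J Om setT (stop t) (cylinders setT)); first by [].
  move=> _ [_ [r _ [B mB ->]] <-].
  rewrite setTI; apply: sub_sigma_algebra.
  by exists (tmin r t); [exact: tmin_le|exists B].
by rewrite -[stop t @^-1` A]setTI; exact: (H measurableT A mA).
Qed.

(** One half of Galmarini's test: a set unchanged by stopping at t is its own preimage under
    [stop t]. *)
Lemma filt_na t (A : set Om) : measurable A -> na t A -> filt t A.
Proof.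
move=> mA nA; have e : stop t @^-1` A = A.
  by apply/seteqP; split=> w /=; rewrite nA.
split=> // u tu; rewrite -e; move: (@stop_preimage t _ mA).
apply: sub_smallest2r; first exact: smallest_sigma_algebra.
by move=> A' [r rt HB]; exists r => //=; apply: le_trans rt (ltW tu).
Qed.

End paths.

Section grid.
Context {R : realType} {T : {nonneg R}}.
Local Notation tm := (time T).
Implicit Types (q r s t : tm) (n k j : nat).

Definition grid s n k : tm := clamp ((s : R) + k%:R / n.+1%:R).
Definition gridN n : nat := (Num.bound T%:num * n.+1)%N.

Lemma grid0 s n : grid s n 0 = s.
Proof. by rewrite /grid mul0r addr0 clampK. Qed.

Lemma grid_le s n k j : (k <= j)%N -> grid s n k <= grid s n j :> R.
Proof.
move=> kj; apply: clamp_nd; rewrite lerD2l ler_pM2r ?invr_gt0// ler_nat//.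
Qed.

Lemma gridN_tT s n : grid s n (gridN n) = tT.
Proof.
apply: time_inj; apply/eqP; rewrite eq_le le_tT /= /grid /gridN natrM mulfK//.
rewrite /= minxx [X in X <= _]max_r// le_max; apply/orP; right.
rewrite le_min lexx andbT; have /andP[_ /ltW] := lt_bound T%:num => h.
by apply: le_trans h _; rewrite lerDr time_ge0.
Qed.

Lemma clamp_lip (x y : R) : x <= y -> (clamp y : tm) <= ((clamp x : tm) : R) + (y - x) :> R.
Proof.
move=> xy /=; rewrite ge_max; apply/andP; split.
  by rewrite addr_ge0 ?subr_ge0// le_max lexx.
rewrite -lerBlDr le_max; apply/orP.
case: (leP y T%:num) => yT; last first.
  case: (leP x T%:num) => xT; last by right; rewrite lerBlDr lerDl subr_ge0.
  right; rewrite lerBlDr; apply: le_trans (ltW yT) _; by rewrite addrC subrK.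
right; rewrite min_l; last exact: le_trans yT.
by rewrite opprB addrC subrK.
Qed.

Lemma grid_step s n k : grid s n k.+1 <= (grid s n k : R) + n.+1%:R^-1 :> R.
Proof.
have h : (s : R) + k%:R / n.+1%:R <= (s : R) + k.+1%:R / n.+1%:R.
  by rewrite lerD2l ler_pM2r ?invr_gt0// ler_nat.
apply: le_trans (clamp_lip h) _.
rewrite lerD2l opprD addrACA subrr add0r -mulrBl -natrB// subSnn mul1r//.
Qed.

Lemma cell_exists s n q : oc s tT q ->
  exists2 k, (k < gridN n)%N & oc (grid s n k) (grid s n k.+1) q.
Proof.
rewrite -(gridN_tT s n); elim: (gridN n) => [|k IH].
  by rewrite grid0 oc0.
rewrite (@ocU _ _ s (grid s n k)); last 2 first.
- by rewrite -[X in X <= _](congr1 (@Defs.tval _ _) (grid0 s n)); exact: grid_le.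
- exact: grid_le.
move=> [/IH[j jk qj]|qk]; last by exists k.
by exists j => //; exact: ltn_trans jk _.
Qed.

Lemma cell_inj s n k j q : oc (grid s n k) (grid s n k.+1) q ->
  oc (grid s n j) (grid s n j.+1) q -> k = j.
Proof.
move=> [/= a b] [/= c d]; apply/eqP; rewrite eqn_leq; apply/andP; split.
  rewrite leqNgt; apply/negP => jk.
  by move: (lt_le_trans (le_lt_trans (grid_le s n jk) a) d); rewrite ltxx.
rewrite leqNgt; apply/negP => jk.
by move: (lt_le_trans (le_lt_trans (grid_le s n jk) c) b); rewrite ltxx.
Qed.

Lemma cell_lt s n k q : oc (grid s n k) (grid s n k.+1) q -> (k < gridN n)%N.
Proof.
move=> [/= a _]; rewrite ltnNge; apply/negP => Nk.
have := lt_le_trans (le_lt_trans (grid_le s n Nk) a) (le_tT q).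
by rewrite gridN_tT ltxx.
Qed.

(** The cells are open on the left: when h k is known at the left endpoint of cell k, the step
    process is predictable. *)
Definition stepf (X : Type) s n (h : nat -> X -> R) (p : tm * X) : R :=
  \sum_(k < gridN n) \1_(oc (grid s n k) (grid s n k.+1)) p.1 * h k p.2.

Lemma stepfE (X : Type) s n (h : nat -> X -> R) k q x :
  oc (grid s n k) (grid s n k.+1) q -> stepf s n h (q, x) = h k x.
Proof.
move=> kq; rewrite /stepf (bigD1 (Ordinal (cell_lt kq)))//= big1 ?addr0.
  by rewrite indicE mem_set// mul1r.
move=> i ik; rewrite indicE memNset ?mul0r// => iq.
by move: ik; rewrite -val_eqE/= (cell_inj kq iq) eqxx.
Qed.

Lemma stepf_out (X : Type) s n (h : nat -> X -> R) q x :
  ~ oc s tT q -> stepf s n h (q, x) = 0.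
Proof.
move=> sq; rewrite /stepf big1// => i _; rewrite indicE memNset ?mul0r// => iq.
apply: sq; apply: sub_oc iq; last exact: le_tT.
by rewrite -[X in X <= _](congr1 (@Defs.tval _ _) (grid0 s n)); exact: grid_le.
Qed.

Lemma measurable_stepf d (X : measurableType d) s n (h : nat -> X -> R) :
  (forall k, measurable_fun setT (h k)) -> measurable_fun setT (stepf s n h).
Proof.
move=> mh; apply: measurable_sum => k; apply: measurable_funM.
  by apply: measurableT_comp => //; apply: measurable_indic; exact: measurable_oc.
exact: measurableT_comp.
Qed.

End grid.

Section path_limits.
Context {R : realType} {T : {nonneg R}} {E : ptopologicalType}.
Local Notation tm := (time T).
Local Notation Om := (Omega T E).
Implicit Types (q r s t : tm) (w : Om).

Lemma near_inv_lt (d : R) : 0 < d -> \forall n \near \oo, n.+1%:R^-1 < d.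
Proof.
by move=> d0; exact: (near_infty_natSinv_lt (PosNum d0)).
Qed.

(** Sampling at right endpoints converges at every time, by right-continuity alone, but looks into
    the future: it serves joint measurability only. *)
Lemma right_step_cvg w (phi : E -> R) s q : continuous phi -> oc s tT q ->
  stepf s n (fun k w => phi (w (grid s n k.+1))) (q, w) @[n --> \oo] --> phi (w q).
Proof.
move=> cphi sq.
have [cr _] := path_cadlag w (t0_le q).
have /cvgrPdist_lt h : (phi \o (w \o clamp)) @ (q : R)^'+ --> phi (w q).
  by apply: cvg_comp cr _; exact: cphi.
apply/cvgrPdist_lt => e e0.
have /nbhs_ballP[d /= d0 hd] := h e e0.
apply: filterS (near_inv_lt d0) => n nd.
have [k kN kq] := cell_exists n sq; rewrite (stepfE _ _ kq).
(* The right-limit filter says nothing of q itself, so the case where q is a grid point is settled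
   apart. *)
have := kq.2; rewrite le_eqVlt => /orP[/eqP/time_inj <-|qk]; first by rewrite subrr normr0.
have := hd (grid s n k.+1 : R) _ qk; rewrite clampK; apply.
suff : `|(q : R) - (grid s n k.+1 : R)| < d by rewrite -ball_normE.
rewrite distrC ger0_norm ?subr_ge0 ?ltW//.
apply: le_lt_trans nd; rewrite lerBlDr addrC; apply: le_trans (grid_step _ _ _) _.
by rewrite lerD2r; exact: (ltW kq.1).
Qed.

(** Sampling at left endpoints is adapted, at the price of assuming that the path does not jump at
    q. *)
Lemma left_step_cvg w (phi : E -> R) s q : continuous phi -> oc s tT q ->
  (w \o clamp) @ (q : R)^'- --> w q ->
  stepf s n (fun k w => phi (w (grid s n k))) (q, w) @[n --> \oo] --> phi (w q).
Proof.
move=> cphi sq cl.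
have /cvgrPdist_lt h : (phi \o (w \o clamp)) @ (q : R)^'- --> phi (w q).
  by apply: cvg_comp cl _; exact: cphi.
apply/cvgrPdist_lt => e e0.
have /nbhs_ballP[d /= d0 hd] := h e e0.
apply: filterS (near_inv_lt d0) => n nd.
have [k kN kq] := cell_exists n sq; rewrite (stepfE _ _ kq).
have := hd (grid s n k : R) _ kq.1; rewrite clampK; apply.
suff : `|(q : R) - (grid s n k : R)| < d by rewrite -ball_normE.
rewrite ger0_norm ?subr_ge0 ?(ltW kq.1)//.
apply: le_lt_trans nd; rewrite lerBlDr addrC; apply: le_trans kq.2 _.
exact: grid_step.
Qed.

End path_limits.

Section jumps.
Context {R : realType} {T : {nonneg R}} {E : completePseudoMetricType R}.
Local Notation tm := (time T).
Local Notation Om := (Omega T E).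
Implicit Types (q r s t : tm) (w : Om).

Let bad w (e : R) : set tm := [set q : tm | (t0 : tm) < q :> R /\
  ~ \forall p \near (q : R)^'-, ball (w q) e (w (clamp p))].

(** Just after r the path is within e/2 of its value at r, and just before r within e/2 of its left
    limit there. Two times on the same side of r thus have values within e of each other, so only r
    can be a jump of size e. *)
Lemma bad_isolated w (e : R) r : 0 < e ->
  exists2 d : R, 0 < d & forall q, `|(r : R) - (q : R)| < d -> bad w e q -> q = r.
Proof.
move=> e0; have e20 : 0 < e / 2 by rewrite divr_gt0.
have [cr cl] := path_cadlag w (t0_le r).
have H1 : nbhs (r : R) (fun p => (r : R) < p ->
  ball (w r) (e / 2) (w (clamp p))).
  by have := cvg_ball cr e20; apply.
have [d1 /= d10 h1] := iffLR (nbhs_ballP _ _) H1.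
have right (q : tm) (p : R) : (r : R) < p -> p < (q : R) -> `|(r : R) - (q : R)| < d1 ->
    ball (w q) e (w (clamp p)).
  move=> rp pq rq; rewrite [e]splitr; apply: (@ball_triangle _ _ (w r)).
    apply: ball_sym; have := h1 (q : R) _ (lt_trans rp pq).
    by rewrite /= clampK; apply; rewrite -ball_normE.
  apply: h1 => //; rewrite -ball_normE /ball_ /=.
  apply: le_lt_trans rq; rewrite distrC [leRHS]distrC !ger0_norm ?subr_ge0 ?ltW//.
    by rewrite ltrD2r.
  exact: lt_trans pq.
have nr (q : tm) : (r : R) < (q : R) -> `|(r : R) - (q : R)| < d1 -> ~ bad w e q.
  move=> rq dq [_]; apply; near=> p.
  have rp : (r : R) < p by near: p; exact: nbhs_left_gt.
  by apply: right => //; near: p; exact: nbhs_left_lt.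
have [d2 d20 nl] : exists2 d2 : R, 0 < d2 & forall q : tm,
    (q : R) < (r : R) -> `|(r : R) - (q : R)| < d2 -> ~ bad w e q.
  case: (ltP ((t0 : tm) : R) (r : R)) => r0; last first.
    by exists 1 => // q qr _ [q0 _]; move: (lt_trans (le_lt_trans r0 q0) qr); rewrite ltxx.
  have [l hl] := cl r0; have H2 : nbhs (r : R) (fun p => p < r :> R ->
    ball l (e / 2) (w (clamp p))).
    by have := cvg_ball hl e20; apply.
  have [d2 /= d20 h2] := iffLR (nbhs_ballP _ _) H2.
  exists d2 => // q qr rq [_]; apply; near=> p.
  have pq : p < (q : R) by near: p; exact: nbhs_left_lt.
  rewrite [e]splitr; apply: (@ball_triangle _ _ l).
    apply: ball_sym; have := h2 (q : R) _ qr.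
    by rewrite /= clampK; apply; rewrite -ball_normE.
  apply: h2; last exact: lt_trans qr.
  rewrite -ball_normE /ball_ /= ger0_norm; last by rewrite subr_ge0 ltW// (lt_trans pq).
  rewrite ltrBlDr -ltrBlDl; near: p; apply: nbhs_left_gt.
  by rewrite ltrBlDl -ltrBlDr (le_lt_trans (ler_norm _)).
exists (Num.min d1 d2); first by rewrite lt_min d10.
move=> q; rewrite lt_min => /andP[q1 q2] bq.
by case: (ltgtP (q : R) (r : R)) => [/nl/(_ q2)|/nr/(_ q1)|/time_inj].
Unshelve. all: by end_near. Qed.

(** By compactness of [0, T], finitely many of the neighbourhoods provided by [bad_isolated] cover
    it, and each contains at most its centre as a large jump. *)
Lemma bad_finite w (e : R) : 0 < e -> finite_set (bad w e).
Proof.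
move=> e0.
have /choice[d hd] : forall r : tm, exists d : R, 0 < d /\
    forall q, `|(r : R) - (q : R)| < d -> bad w e q -> q = r.
  by move=> r; have [d d0 h] := bad_isolated w r e0; exists d.
have := @segment_compact R 0 T%:num; rewrite compact_cover.
move=> /(_ tm setT (fun r => ball (r : R) (d r))) [||D' _ hD'].
- by move=> r _; exact: ball_open.
- move=> x /= xT; exists (clamp x) => //.
  by rewrite clamp_id ?(itvP xT)//; apply: ballxx; exact: (hd _).1.
apply: (sub_finite_set _ (finite_fset D')).
move=> q bq.
have /hD'[r rD' rq] : `[0, T%:num]%classic (q : R).
  by rewrite /= in_itv/= time_ge0 time_leT.
suff -> : q = r by [].
by apply: (hd r).2 => //; move: rq; rewrite -ball_normE.
Qed.

(** The jump times are the union over n of the finite sets of jumps of size 1 / (n + 1), and a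
    measure without atoms does not charge a countable set. *)
Lemma jump_negl (mu : {measure set tm -> \bar R}) (hmu : forall t, mu [set t] = 0%E) w :
  mu.-negligible [set q : tm | (t0 : tm) < q :> R /\ ~ ((w \o clamp) @ (q : R)^'- --> w q)].
Proof.
apply: (@negligibleS _ _ _ mu (\bigcup_n bad w n.+1%:R^-1)).
  move=> q [q0 hq]; apply: contrapT => H; apply: hq; apply/cvg_ballP => e e0.
  have [N _ /(_ N (leqnn N)) hN] := near_inv_lt e0.
  have : ~ bad w N.+1%:R^-1 q by move=> b; apply: H; exists N.
  move=> /not_andP[//|/contrapT]; apply: filterS => p; apply: le_ball; exact: ltW.
apply: negligible_bigcup => n.
have fb : finite_set (bad w n.+1%:R^-1) by apply: bad_finite; rewrite invr_gt0.
apply: (@negligibleS _ _ _ mu (\bigcup_(t in bad w n.+1%:R^-1) [set t])); first by move=> t bt; exists t.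
rewrite -bigsetU_fset_set//.
elim/big_ind : _ => [|A B|t _]; [exact: negligible_set0|exact: negligibleU|].
by apply/negligibleP; [exact: measurable_time1|exact: hmu].
Qed.

End jumps.

Section X_measurable.
Context {R : realType} {T : {nonneg R}} {E : completePseudoMetricType R}.
Local Notation tm := (time T).
Local Notation Om := (Omega T E).

(** The cells cover ]0, T] only, which is why time 0 has its own hypothesis and its own term in the
    approximating sequence. *)
Lemma eq_step_cvg_measurable d (X : measurableType d) (F : tm * X -> R)
    (h : nat -> nat -> X -> R) :
  (forall n k, measurable_fun setT (h n k)) ->
  measurable_fun setT (fun x => F (t0, x)) ->
  (forall q x, oc t0 tT q -> stepf t0 n (h n) (q, x) @[n --> \oo] --> F (q, x)) ->
  measurable_fun setT F.
Proof.
move=> mh mF0 hF.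
pose F_ n (p : tm * X) := stepf t0 n (h n) p + \1_[set t0] p.1 * F (t0, p.2).
apply: (@measurable_fun_cvg _ _ _ _ F_) => [n|[q x] _].
  apply: measurable_funD; first exact: measurable_stepf.
  apply: measurable_funM; last exact: (measurableT_comp mF0).
  by apply: measurableT_comp => //; apply: measurable_indic; exact: measurable_time1.
rewrite /F_ /=; have : [set: tm] q by [].
rewrite setT_oc => -[->|q0].
  rewrite (_ : (fun n => _) = cst (F (t0, x))); first exact: cvg_cst.
  apply/funext => n; rewrite stepf_out; last by move=> [/=]; rewrite ltxx.
  by rewrite add0r indicE mem_set// mul1r.
rewrite indicE memNset/=; last by move=> qe; move: q0.1; rewrite qe ltxx.
rewrite mul0r (_ : (fun n => _) = (fun n => stepf t0 n (h n) (q, x))); first exact: hF.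
by apply/funext => n; rewrite addr0.
Qed.

Lemma measurable_cont_eval (phi : E -> R) r : continuous phi ->
  measurable_fun setT (fun w : Om => phi (w r)).
Proof.
by move=> cphi; exact: (measurableT_comp (continuous_borel cphi) (measurable_eval r)).
Qed.

(** Two limits: right step functions for a continuous function of the state, then [uapprox] for the
    indicator of an open set. *)
Lemma measurable_X : measurable_fun setT (fun p : tm * Om => p.2 p.1 : borel E).
Proof.
apply: (@measurability _ _ _ (borel E) _ _ open) => //.
move=> _ [U oU <-]; rewrite setTI.
apply/(measurable_indicP R).
apply: (@measurable_fun_cvg _ _ _ _ (fun (m : nat) (p : tm * Om) => uapprox U m (p.2 p.1))) => [m|p
    _]; last first.
  by have := @uapprox_cvg R E U oU (p.2 p.1); rewrite !indicE.
refine (@eq_step_cvg_measurable _ Om (fun p => uapprox U m (p.2 p.1))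
  (fun (n k : nat) (w : Om) => uapprox U m (w (grid t0 n k.+1))) _ _ _).
- by move=> n k; apply: measurable_cont_eval; exact: uapprox_continuous.
- by apply: measurable_cont_eval; exact: uapprox_continuous.
- by move=> q w q0; apply: right_step_cvg => //; exact: uapprox_continuous.
Qed.

End X_measurable.

(** * Raw martingales and processes of finite variation *)

Section layer_cake.
Context {R : realType} {T : {nonneg R}} {E : completePseudoMetricType R}.
Local Notation tm := (time T).
Local Notation Om := (Omega T E).
Variable Pr : probability Om R.
Local Open Scope ereal_scope.

(** Tonelli on the region below the graph of xi, since xi(w) is the length of [0, xi(w)[. *)
Lemma integral_layer_cake (f xi : Om -> R) :
  measurable_fun setT f -> measurable_fun setT xi ->
  (forall w, 0 <= f w)%R -> (forall w, 0 <= xi w)%R ->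
  \int[Pr]_w (xi w * f w)%:E =
  \int[lebesgue_measure]_(y in `[0%R, +oo[) \int[Pr]_(w in [set w | (y < xi w)%R]) (f w)%:E.
Proof.
move=> mf mxi f0 xi0.
pose S : set (Om * measurableTypeR R) := [set p | (0 <= p.2)%R] `&` [set p | (p.2 < xi p.1)%R].
have mS : measurable S.
  apply: measurableI.
    rewrite -[X in measurable X]setTI;
        exact: (measurable_fun_le measurableT (measurable_cst _) measurable_snd).
  rewrite (_ : mkset _ = ~` [set p : Om * measurableTypeR R | (xi p.1 <= p.2)%R]); last first.
    by apply/seteqP; split=> x /=; rewrite ltNge => /negP.
  apply: measurableC; rewrite -[X in measurable X]setTI.
  exact: (measurable_fun_le measurableT (measurableT_comp mxi measurable_fst) measurable_snd).
pose F (p : Om * measurableTypeR R) : \bar R := (f p.1 * \1_S p)%:E.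
have mF : measurable_fun setT F.
  apply/measurable_EFinP; apply: measurable_funM; first exact: (measurableT_comp mf measurable_fst).
  exact: measurable_indic.
have F0 p : 0 <= F p by rewrite lee_fin mulr_ge0.
transitivity (\int[Pr]_w \int[lebesgue_measure]_y F (w, y)).
  apply: eq_integral => w _.
  under eq_integral do rewrite /F/= EFinM.
  rewrite ge0_integralZl_EFin//; last first.
    apply/measurable_EFinP; apply: measurableT_comp; [exact: measurable_indic|exact: measurable_pair1].
  have -> : (fun y => (\1_S (w, y))%:E) = (fun y : measurableTypeR R => (\1_(`[0%R,
      xi w[%classic) y)%:E : \bar R).
    apply/funext => y; congr EFin; rewrite !indicE; congr (_%:R); congr nat_of_bool.
    have e : S (w, y) <-> (`[0%R, xi w[%classic : set R) y.
      by rewrite /S /= in_itv/=; split=> [[-> ->]|/andP[]].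
    by apply/idP/idP => /set_mem/e/mem_set.
  have -> : \int[lebesgue_measure]_(y in setT) (\1_(`[0%R, xi w[%classic) (y : measurableTypeR R))%:E
      = lebesgue_measure (`[0%R, xi w[%classic : set R) by rewrite integral_indic// setIT.
  rewrite lebesgue_measure_itv/= lte_fin.
  rewrite EFinM muleC; congr (_ * _).
  by case: ltP => h; [rewrite -EFinB subr0|congr EFin; apply/le_anti; rewrite h xi0].
rewrite (fubini_tonelli F mF F0).
rewrite [RHS]integral_mkcond/=; apply: eq_integral => y _; rewrite patchE.
case: ifPn => y0.
  rewrite [RHS]integral_mkcond/=; apply: eq_integral => w _; rewrite patchE /F /= indicE.
  move: y0; rewrite inE/= in_itv/= andbT => y0.
  case: (ltP y (xi w)) => h; first by rewrite !mem_set//= mulr1.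
  rewrite memNset ?mulr0//=; last by rewrite /S/= => -[_]; rewrite ltNge h.
  by rewrite memNset//= ltNge h.
rewrite integral0_eq// => w _; rewrite /F /= indicE memNset ?mulr0//.
by move=> [/= h _]; move: y0; rewrite notin_setE/= in_itv/= h.
Qed.

Lemma measurable_gt_set (xi : Om -> R) (y : R) : measurable_fun setT xi ->
  measurable [set w | (y < xi w)%R].
Proof.
move=> mxi; rewrite (_ : mkset _ = ~` [set w | (xi w <= y)%R]); last first.
  by apply/seteqP; split=> x /=; rewrite ltNge => /negP.
apply: measurableC; rewrite -[X in measurable X]setTI.
by apply: measurable_fun_le.
Qed.

(** Extends an inequality from events known at t to nonnegative weights known at t: the sets where
    xi exceeds y are such events, and the layer-cake formula integrates over y. *)
Lemma na_le_integral t (f g xi : Om -> R) :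
  measurable_fun setT f -> measurable_fun setT g -> measurable_fun setT xi ->
  (forall w, 0 <= f w)%R -> (forall w, 0 <= g w)%R -> (forall w, 0 <= xi w)%R ->
  na t xi ->
  (forall A : set Om, measurable A -> na t A ->
     \int[Pr]_(w in A) (f w)%:E <= \int[Pr]_(w in A) (g w)%:E) ->
  \int[Pr]_w (xi w * f w)%:E <= \int[Pr]_w (xi w * g w)%:E.
Proof.
move=> mf mg mxi f0 g0 xi0 nxi fg.
rewrite !integral_layer_cake//.
pose F (h : Om -> R) (y : measurableTypeR R) := \int[Pr]_(w in [set w | (y < xi w)%R]) (h w)%:E.
have mF (h : Om -> R) : measurable_fun setT h -> (forall w, 0 <= h w)%R -> measurable_fun setT (F h).
  move=> mh h0.
  pose G (p : measurableTypeR R * Om) : \bar R := (h p.2 * \1_[set p : measurableTypeR R * Om |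
      (p.1 < xi p.2)%R] p)%:E.
  have -> : F h = fubini_F Pr G.
    apply/funext => y; rewrite /F /fubini_F [LHS]integral_mkcond/=; apply: eq_integral => w _.
    rewrite patchE /G/= indicE; case: (boolP (y < xi w)%R) => h1.
      by rewrite !mem_set//= mulr1.
    by rewrite !memNset//= ?mulr0//; apply/negP.
  apply: measurable_fun_fubini_tonelli_F; last by move=> p; rewrite lee_fin mulr_ge0.
  apply/measurable_EFinP; apply: measurable_funM; first exact: (measurableT_comp mh measurable_snd).
  apply: measurable_indic.
  rewrite (_ : mkset _ = ~` [set p : measurableTypeR R * Om | (xi p.2 <= p.1)%R]); last first.
    by apply/seteqP; split=> x /=; rewrite ltNge => /negP.
  apply: measurableC; rewrite -[X in measurable X]setTI.
  exact: (measurable_fun_le measurableT (measurableT_comp mxi measurable_snd) measurable_fst).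
apply: ge0_le_integral => //.
- by move=> y _; apply: integral_ge0 => w _; rewrite lee_fin.
- apply: (measurable_funS measurableT) => //; exact: mF.
- apply: (measurable_funS measurableT) => //; exact: mF.
- move=> y _; apply: fg; first exact: measurable_gt_set.
  by move=> w /=; rewrite nxi.
Qed.

End layer_cake.

Section swap.
Context d (X : measurableType d) (R : realType) (nu : {measure set X -> \bar R}).
Implicit Types (A : set X) (f g D : X -> R).

Lemma integrable_dom A f g : measurable A -> measurable_fun A f ->
  nu.-integrable A (EFin \o g) -> (forall x, A x -> `|f x| <= `|g x|) ->
  nu.-integrable A (EFin \o f).
Proof.
move=> mA mf ig fg; apply: (le_integrable mA _ _ ig); first exact/measurable_EFinP.
by move=> x Ax; rewrite /= lee_fin fg.
Qed.

Lemma integrable_domD A f g h : measurable A -> measurable_fun A f ->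
  nu.-integrable A (EFin \o g) -> nu.-integrable A (EFin \o h) ->
  (forall x, A x -> `|f x| <= `|g x| + `|h x|) ->
  nu.-integrable A (EFin \o f).
Proof.
move=> mA mf ig ih fg; apply: (@integrable_dom _ _ (fun x => `|g x| + `|h x|)) => //.
  rewrite (_ : EFin \o _ = (abse \o (EFin \o g)) \+ (abse \o (EFin \o h)))%E; last first.
    by apply/funext => x /=.
  by apply: integrableD => //; exact: integrable_abse.
by move=> x Ax; rewrite [leRHS]ger0_norm ?addr_ge0// fg.
Qed.

Lemma ae_integrable_R A f g : measurable A -> measurable_fun A g ->
  nu.-integrable A (EFin \o f) -> (\forall x \ae nu, A x -> f x = g x) ->
  nu.-integrable A (EFin \o g).
Proof.
move=> mA mg /integrableP[mf lf] fg; have meg : measurable_fun A (EFin \o g) by exact/measurable_EFinP.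
apply/integrableP; split => //; apply: le_lt_trans lf; rewrite le_eqVlt; apply/orP; left; apply/eqP.
apply: ae_eq_integral => //; [exact: measurableT_comp|exact: measurableT_comp|].
by apply: filterS fg => x H Ax /=; rewrite H.
Qed.

Lemma integrableD_R A f g : measurable A -> nu.-integrable A (EFin \o f) ->
  nu.-integrable A (EFin \o g) -> nu.-integrable A (EFin \o (fun x => f x + g x)).
Proof. by move=> mA iff ig; exact: (integrableD mA iff ig). Qed.

Lemma integrableB_R A f g : measurable A -> nu.-integrable A (EFin \o f) ->
  nu.-integrable A (EFin \o g) -> nu.-integrable A (EFin \o (fun x => f x - g x)).
Proof. by move=> mA iff ig; exact: (integrableB mA iff ig). Qed.

Lemma Rint_eq_integral A f g : (\int[nu]_(x in A) (f x)%:E = \int[nu]_(x in A) (g x)%:E)%E ->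
  \int[nu]_(x in A) f x = \int[nu]_(x in A) g x.
Proof. by rewrite /Rintegral => ->. Qed.

Definition pos (x : R) := Num.max x 0.

Lemma pos_ge0 x : 0 <= pos x. Proof. by rewrite /pos le_max lexx orbT. Qed.

Lemma pos_le x : pos x <= `|x|.
Proof. by rewrite /pos ge_max normr_ge0 ler_norm. Qed.

Lemma posN x : pos x - pos (- x) = x.
Proof.
rewrite /pos; case: (leP 0 x) => x0.
  by rewrite max_r ?oppr_le0// subr0.
by rewrite max_l ?oppr_ge0 ?(ltW x0)// sub0r opprK.
Qed.

Lemma measurable_pos : measurable_fun setT pos.
Proof. exact: measurable_maxr. Qed.

(* Writing D a - D b as a combination of terms of constant sign reduces an
   equality of integrals to equalities between integrals in [0, +oo]. *)
Lemma swap_integral A (D a b : X -> R) : measurable A ->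
  measurable_fun A D -> measurable_fun A a -> measurable_fun A b ->
  nu.-integrable A (fun x => (D x * a x)%:E) ->
  (\int[nu]_(x in A) (`|D x| * `|b x|)%:E <= \int[nu]_(x in A) (`|D x| * `|a x|)%:E)%E ->
  (\int[nu]_(x in A) (pos (D x) * (pos (a x) + pos (- b x)))%:E =
   \int[nu]_(x in A) (pos (D x) * (pos (- a x) + pos (b x)))%:E)%E ->
  (\int[nu]_(x in A) (pos (- D x) * (pos (a x) + pos (- b x)))%:E =
   \int[nu]_(x in A) (pos (- D x) * (pos (- a x) + pos (b x)))%:E)%E ->
  nu.-integrable A (fun x => (D x * b x)%:E) /\
  \int[nu]_(x in A) (D x * a x) = \int[nu]_(x in A) (D x * b x).
Proof.
move=> mA mD ma mb iDa le_ab e1 e2.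
have iDb : nu.-integrable A (fun x => (D x * b x)%:E).
  apply/integrableP; split; first by apply/measurable_EFinP; exact: measurable_funM.
  move/integrableP : iDa => [_]; under eq_integral do rewrite abse_EFin normrM.
  move=> h; under eq_integral do rewrite abse_EFin normrM; exact: le_lt_trans h.
split => //.
have mp (h : X -> R) : measurable_fun A h -> measurable_fun A (fun x => pos (h x)).
  by move=> mh; exact: (measurableT_comp measurable_pos mh).
have mN (h : X -> R) : measurable_fun A h -> measurable_fun A (fun x => - h x).
  by move=> mh; exact: measurable_funN.
have I (u v : X -> R) : measurable_fun A u -> measurable_fun A v ->
   (forall x, `|u x| <= `|D x|) -> (forall x, `|v x| <= `|a x| + `|b x|) ->
   nu.-integrable A (EFin \o (fun x => u x * v x)).
  move=> mu mv uD vab.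
  apply: (@integrable_domD _ _ (fun x => D x * a x) (fun x => D x * b x)) => //.
    exact: measurable_funM.
  by move=> x _; rewrite !normrM -mulrDr ler_pM.
have pn x : `|pos x| <= `|x| by rewrite ger0_norm ?pos_ge0 ?pos_le.
have pnN x : `|pos (- x)| <= `|x| by rewrite -[leRHS]normrN pn.
have s1 x : `|pos (a x) + pos (- b x)| <= `|a x| + `|b x|.
  by apply: le_trans (ler_normD _ _) _; rewrite lerD.
have s2 x : `|pos (- a x) + pos (b x)| <= `|a x| + `|b x|.
  by apply: le_trans (ler_normD _ _) _; rewrite lerD.
pose f x := pos (a x) + pos (- b x). pose g x := pos (- a x) + pos (b x).
have mf : measurable_fun A f by apply: measurable_funD; apply: mp => //; exact: mN.
have mg : measurable_fun A g by apply: measurable_funD; apply: mp => //; exact: mN.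
have I1 : nu.-integrable A (EFin \o (fun x => pos (D x) * f x)) by apply: I => //; exact: mp.
have I2 : nu.-integrable A (EFin \o (fun x => pos (D x) * g x)) by apply: I => //; exact: mp.
have I3 : nu.-integrable A (EFin \o (fun x => pos (- D x) * f x)) by apply: I => //; apply: mp;
    exact: mN.
have I4 : nu.-integrable A (EFin \o (fun x => pos (- D x) * g x)) by apply: I => //; apply: mp;
    exact: mN.
apply/eqP; rewrite -subr_eq0 -RintegralB//; apply/eqP.
have -> : \int[nu]_(x in A) (D x * a x - D x * b x) =
   \int[nu]_(x in A) ((pos (D x) * f x - pos (D x) * g x) - (pos (- D x) * f x - pos (- D x) * g x)).
  apply: eq_Rintegral => x _; rewrite /f /g -!mulrBr -mulrBl posN; congr (_ * _).
  by rewrite -[in LHS](posN (a x)) -[in LHS](posN (b x)); ring.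
rewrite RintegralB//; first last.
- exact: (integrableB mA I3 I4).
- exact: (integrableB mA I1 I2).
by rewrite !RintegralB// (Rint_eq_integral e1) (Rint_eq_integral e2) !subrr.
Qed.

End swap.

Section cylinder_integrals.
Context {R : realType} {T : {nonneg R}} {E : completePseudoMetricType R}.
Local Notation tm := (time T).
Local Notation Om := (Omega T E).
Variables (Pr : probability Om R) (mu : {finite_measure set tm -> \bar R}).
Implicit Types (q r s t : tm) (F G : tm * Om -> R).

Definition cyl s t : set (tm * Om) := oc s t `*` setT.

Lemma measurable_cyl s t : measurable (cyl s t).
Proof. by apply: measurableX => //; exact: measurable_oc. Qed.

Lemma cylU s r t : s <= r :> R -> r <= t :> R -> cyl s t = cyl s r `|` cyl r t.
Proof.
move=> sr rt; apply/seteqP; split => -[q w]; rewrite /cyl/= (ocU sr rt).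
  by move=> [[h|h] _]; [left|right].
by move=> [[h _]|[h _]]; split => //; [left|right].
Qed.

Lemma tonelli_cyl s t (G : tm * Om -> \bar R) : measurable_fun setT G ->
  (forall p, (0 <= G p)%E) ->
  (\int[mu \x Pr]_(p in cyl s t) G p = \int[mu]_(q in oc s t) \int[Pr]_w G (q, w))%E.
Proof.
move=> mG G0; rewrite integral_mkcond fubini_tonelli1; first last.
- by move=> p; apply: erestrict_ge0 => /= *; exact: G0.
- apply/(measurable_restrictT _ _).1; first exact: measurable_cyl.
  exact: measurable_funTS.
rewrite [RHS]integral_mkcond; apply: eq_integral => q _.
rewrite /fubini_F patchE; case: ifPn => qs.
  apply: eq_integral => w _; rewrite patchE mem_set// /cyl/=; split => //; exact: set_mem.
rewrite integral0_eq// => w _; rewrite patchE memNset// => -[/= h _].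
by move: qs; rewrite mem_set.
Qed.

Lemma tonelli_cyl2 s t (G : tm * Om -> \bar R) : measurable_fun setT G ->
  (forall p, (0 <= G p)%E) ->
  (\int[mu \x Pr]_(p in cyl s t) G p = \int[Pr]_w \int[mu]_(q in oc s t) G (q, w))%E.
Proof.
move=> mG G0; rewrite integral_mkcond fubini_tonelli2; first last.
- by move=> p; apply: erestrict_ge0 => /= *; exact: G0.
- apply/(measurable_restrictT _ _).1; first exact: measurable_cyl.
  exact: measurable_funTS.
apply: eq_integral => w _; rewrite /fubini_G [RHS]integral_mkcond.
apply: eq_integral => q _; rewrite !patchE.
by case: (boolP (q \in oc s t)) => qs; [rewrite mem_set//; split => //; exact: set_mem|
  rewrite memNset// => -[/= h _]; move: qs; rewrite mem_set].
Qed.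

End cylinder_integrals.

Section martingales.
Context {R : realType} {T : {nonneg R}} {E : completePseudoMetricType R}.
Local Notation tm := (time T).
Local Notation Om := (Omega T E).
Variables (Pr : probability Om R) (mu : {finite_measure set tm -> \bar R}).
Implicit Types (q r s t : tm) (F G M D : tm * Om -> R) (X Y xi : Om -> R) (A : set Om).

Definition igP X := Pr.-integrable setT (EFin \o X).
Definition EE X := \int[Pr]_w X w.
Definition ig s t F := (mu \x Pr)%E.-integrable (cyl s t) (EFin \o F).
Definition iint s t F := \int[(mu \x Pr)%E]_(p in cyl s t) F p.
Definition nap s t F := forall q, oc s t q -> na q (fun w => F (q, w)).

Lemma measurable_sec F t : measurable_fun setT F -> measurable_fun setT (fun w => F (t, w)).
Proof. by move=> mF; exact: (measurableT_comp mF (measurable_pair1 t)). Qed.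

Lemma measurable_sect F t : measurable_fun setT F ->
  measurable_fun setT (fun p : tm * Om => F (t, p.2)).
Proof. by move=> mF; exact: (measurableT_comp (measurable_sec t mF) measurable_snd). Qed.

(** The weight D at time q is known at q, so the comparison holds at each fixed q; Tonelli then
    integrates it in time. *)
Lemma na_le_iint r t F X D : measurable_fun setT F -> measurable_fun setT X ->
  measurable_fun setT D -> nap r t D ->
  (forall q A, oc r t q -> measurable A -> na q A ->
    (\int[Pr]_(w in A) (`|F (q, w)|)%:E <= \int[Pr]_(w in A) (`|X w|)%:E)%E) ->
  (\int[mu \x Pr]_(p in cyl r t) (`|D p| * `|F p|)%:E <=
   \int[mu \x Pr]_(p in cyl r t) (`|D p| * `|X p.2|)%:E)%E.
Proof.
move=> mF mX mD nD FX.
have mX2 : measurable_fun setT (fun p : tm * Om => X p.2) by exact: (measurableT_comp mX measurable_snd).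
have m1 : measurable_fun setT (fun p => (`|D p| * `|F p|)%:E).
  by apply/measurable_EFinP; apply: measurable_funM; exact: measurableT_comp.
have m2 : measurable_fun setT (fun p => (`|D p| * `|X p.2|)%:E).
  by apply/measurable_EFinP; apply: measurable_funM; exact: measurableT_comp.
rewrite (@tonelli_cyl _ _ _ Pr mu r t _ m1); last by move=> p; rewrite lee_fin mulr_ge0.
rewrite (@tonelli_cyl _ _ _ Pr mu r t _ m2); last by move=> p; rewrite lee_fin mulr_ge0.
apply: ge0_le_integral.
- exact: measurable_oc.
- by move=> q _; exact: integral_ge0.
- by apply: measurable_funTS; exact: (measurable_fun_fubini_tonelli_F _ m1).
- by apply: measurable_funTS; exact: (measurable_fun_fubini_tonelli_F _ m2).
- move=> q oq; apply: (@na_le_integral _ _ _ Pr q) => //.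
  + by apply: measurableT_comp => //; exact: measurable_sec.
  + exact: measurableT_comp.
  + by apply: measurableT_comp => //; exact: measurable_sec.
  + by move=> w /=; rewrite nD.
  + by move=> A mA nA; exact: FX.
Qed.

(* A martingale for the raw filtration, with no condition on the paths. *)
Record amart s M : Prop := Mart {
  mart_meas : measurable_fun setT M;
  mart_na : forall q, s <= q :> R -> na q (fun w => M (q, w));
  mart_ig : forall t, s <= t :> R -> igP (fun w => M (t, w));
  mart_eq : forall q t A, s <= q :> R -> q <= t :> R -> measurable A -> na q A ->
    (\int[Pr]_(w in A) (M (t, w))%:E = \int[Pr]_(w in A) (M (q, w))%:E)%E }.

Section mart_facts.
Variables (s : tm) (M : tm * Om -> R).
Hypothesis mM : amart s M.

Lemma mart_igS t A : s <= t :> R -> measurable A ->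
  Pr.-integrable A (fun w => (M (t, w))%:E).
Proof. by move=> st mA; apply: (integrableS measurableT) => //; exact: (mart_ig mM st). Qed.

(** The submartingale property of |M|. The event A is cut according to the sign of M at time q; on
    each piece |M| at q is plus or minus M, to which the martingale equality applies. *)
Lemma mart_abs q t A : s <= q :> R -> q <= t :> R -> measurable A -> na q A ->
  (\int[Pr]_(w in A) (`|M (q, w)|)%:E <= \int[Pr]_(w in A) (`|M (t, w)|)%:E)%E.
Proof.
move=> sq qt mA nA; have st := le_trans sq qt.
have mMq := measurable_sec q (mart_meas mM).
have mMt := measurable_sec t (mart_meas mM).
have key B (c : R) : measurable B -> na q B -> `|c| = 1 ->
    (forall w, B w -> `|M (q, w)| = c * M (q, w)) ->
    (\int[Pr]_(w in B) (`|M (q, w)|)%:E <= \int[Pr]_(w in B) (`|M (t, w)|)%:E)%E.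
  move=> mB nB c1 cB.
  rewrite (eq_integral (fun w => c%:E * (M (q, w))%:E)%E); last first.
    by move=> w /set_mem Bw; rewrite cB// EFinM.
  rewrite integralZl//; last exact: mart_igS.
  rewrite -(mart_eq mM sq qt mB nB).
  apply: le_trans (lee_abs _) _; rewrite abseM abse_EFin c1 mul1e.
  apply: le_trans (le_abse_integral _ _ _) _ => //.
  by apply/measurable_EFinP; exact: measurable_funTS.
pose P := [set w | 0 <= M (q, w)].
have mP : measurable P.
  by rewrite -[X in measurable X]setTI; exact: (measurable_fun_le measurableT).
have nP : na q P by move=> w; rewrite /P/= (mart_na mM sq).
have -> : A = (A `&` P) `|` (A `&` ~` P) by rewrite -setIUr setUv setIT.
have mAP : measurable (A `&` P) by exact: measurableI.
have mAnP : measurable (A `&` ~` P) by apply: measurableI => //; exact: measurableC.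
rewrite !ge0_integral_setU//; first last.
- by apply/disj_setPS => w [[_ h] [_ /(_ h)]].
- by apply/measurable_EFinP; apply: measurable_funTS; exact: measurableT_comp.
- by apply/disj_setPS => w [[_ h] [_ /(_ h)]].
- by apply/measurable_EFinP; apply: measurable_funTS; exact: measurableT_comp.
apply: leeD.
  apply: (key _ 1) => //; first by move=> w; rewrite /setI/= nA nP.
    by rewrite normr1.
  by move=> w [_ h]; rewrite mul1r ger0_norm.
apply: (key _ (-1)) => //; first by move=> w; rewrite /setI/setC/= nA nP.
  by rewrite normrN1.
move=> w [_ /negP]; rewrite -ltNge => h; by rewrite mulN1r ltr0_norm.
Qed.

Lemma mart_le_fun q t xi : s <= q :> R -> q <= t :> R ->
  measurable_fun setT xi -> (forall w, 0 <= xi w) -> na q xi ->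
  (\int[Pr]_w (xi w * `|M (q, w)|)%:E <= \int[Pr]_w (xi w * `|M (t, w)|)%:E)%E.
Proof.
move=> sq qt mxi xi0 nxi.
have mMq := measurable_sec q (mart_meas mM).
have mMt := measurable_sec t (mart_meas mM).
apply: (@na_le_integral _ _ _ _ q) => //.
- exact: measurableT_comp.
- exact: measurableT_comp.
- by move=> A mA nA; exact: mart_abs.
Qed.

(** The martingale equality with its terms moved so that both sides are nonnegative. It then makes
    sense in [0, +oo] for weights that are not bounded. *)
Lemma mart_pm q t xi : s <= q :> R -> q <= t :> R ->
  measurable_fun setT xi -> (forall w, 0 <= xi w) -> na q xi ->
  (\int[Pr]_w (xi w * (pos (M (t, w)) + pos (- M (q, w))))%:E =
   \int[Pr]_w (xi w * (pos (- M (t, w)) + pos (M (q, w))))%:E)%E.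
Proof.
move=> sq qt mxi xi0 nxi; have st := le_trans sq qt.
have mMq := measurable_sec q (mart_meas mM).
have mMt := measurable_sec t (mart_meas mM).
have mp X : measurable_fun setT X -> measurable_fun setT (fun w => pos (X w)).
  by move=> mX; exact: (measurableT_comp (@measurable_pos R) mX).
have mN X : measurable_fun setT X -> measurable_fun setT (fun w => - X w).
  by move=> mX; exact: measurable_funN.
pose f w := pos (M (t, w)) + pos (- M (q, w)).
pose g w := pos (- M (t, w)) + pos (M (q, w)).
have mf : measurable_fun setT f by apply: measurable_funD; apply: mp => //; exact: mN.
have mg : measurable_fun setT g by apply: measurable_funD; apply: mp => //; exact: mN.
have f0 w : 0 <= f w by rewrite addr_ge0 ?pos_ge0.
have g0 w : 0 <= g w by rewrite addr_ge0 ?pos_ge0.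
have ifA A : measurable A -> Pr.-integrable A (EFin \o f).
  move=> mA; apply: (@integrable_domD _ _ _ _ _ _ (fun w => M (t, w)) (fun w => M (q, w))) => //.
  - exact: measurable_funTS.
  - exact: mart_igS.
  - exact: mart_igS.
  - by move=> w _; rewrite ger0_norm// lerD ?pos_le// -[leRHS]normrN pos_le.
have igA A : measurable A -> Pr.-integrable A (EFin \o g).
  move=> mA; apply: (@integrable_domD _ _ _ _ _ _ (fun w => M (t, w)) (fun w => M (q, w))) => //.
  - exact: measurable_funTS.
  - exact: mart_igS.
  - exact: mart_igS.
  - by move=> w _; rewrite ger0_norm// lerD ?pos_le// -[leRHS]normrN pos_le.
have fgA A : measurable A -> na q A ->
    (\int[Pr]_(w in A) (f w)%:E = \int[Pr]_(w in A) (g w)%:E)%E.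
  move=> mA nA.
  have h1 := RintegralB mA (ifA A mA) (igA A mA).
  have h2 := RintegralB mA (mart_igS st mA) (mart_igS sq mA).
  have h3 := Rint_eq_integral (mart_eq mM sq qt mA nA).
  rewrite -(fineK (integrable_fin_num mA (ifA A mA))).
  rewrite -(fineK (integrable_fin_num mA (igA A mA))); congr EFin.
  apply/eqP; rewrite -subr_eq0; apply/eqP; rewrite -[LHS]h1.
  have h4 : \int[Pr]_(x in A) M (t, x) - \int[Pr]_(x in A) M (q, x) = 0 by rewrite h3 subrr.
  rewrite -[RHS]h4 -h2.
  apply: eq_Rintegral => w _; rewrite /f /g.
  by rewrite -[in RHS](posN (M (t, w))) -[in RHS](posN (M (q, w))); ring.
apply/eqP; rewrite eq_le; apply/andP; split.
  by apply: (@na_le_integral _ _ _ Pr q f g xi) => // A mA nA; rewrite fgA.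
by apply: (@na_le_integral _ _ _ Pr q g f xi) => // A mA nA; rewrite fgA.
Qed.

(** The weight may be unbounded provided that its product with the later value is integrable;
    integrability at the earlier time is a conclusion, drawn from the submartingale inequality. *)
Lemma mart_fun q t xi : s <= q :> R -> q <= t :> R ->
  measurable_fun setT xi -> na q xi -> igP (fun w => xi w * M (t, w)) ->
  igP (fun w => xi w * M (q, w)) /\
  EE (fun w => xi w * M (t, w)) = EE (fun w => xi w * M (q, w)).
Proof.
move=> sq qt mxi nxi i.
have mMq := measurable_sec q (mart_meas mM).
have mMt := measurable_sec t (mart_meas mM).
apply: swap_integral => //.
- apply: mart_le_fun => //; first exact: measurableT_comp.
  by move=> w /=; rewrite nxi.
- apply: mart_pm => //; first exact: (measurableT_comp (@measurable_pos R)).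
    by move=> w; rewrite pos_ge0.
  by move=> w /=; rewrite nxi.
- apply: mart_pm => //.
  + by apply: (measurableT_comp (@measurable_pos R)); exact: measurable_funN.
  + by move=> w; rewrite pos_ge0.
  + by move=> w /=; rewrite nxi.
Qed.

Lemma mart_le_iint r t D : s <= r :> R -> r <= t :> R ->
  measurable_fun setT D -> nap r t D ->
  (\int[mu \x Pr]_(p in cyl r t) (`|D p| * `|M p|)%:E <=
   \int[mu \x Pr]_(p in cyl r t) (`|D p| * `|M (t, p.2)|)%:E)%E.
Proof.
move=> sr rt mD nD; apply: (@na_le_iint r t M (fun w => M (t, w))) => //.
- exact: (mart_meas mM).
- by apply: measurable_sec; exact: (mart_meas mM).
- by move=> q A [/= rq qt]; apply: mart_abs => //; exact: le_trans sr (ltW rq).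
Qed.

Lemma mart_pm_iint r t D : s <= r :> R -> r <= t :> R ->
  measurable_fun setT D -> nap r t D -> (forall p, 0 <= D p) ->
  (\int[mu \x Pr]_(p in cyl r t) (D p * (pos (M (t, p.2)) + pos (- M p)))%:E =
   \int[mu \x Pr]_(p in cyl r t) (D p * (pos (- M (t, p.2)) + pos (M p)))%:E)%E.
Proof.
move=> sr rt mD nD D0.
have mMt := measurable_sect t (mart_meas mM).
have mp F : measurable_fun setT F -> measurable_fun setT (fun w => pos (F w)).
  by move=> mX; exact: (measurableT_comp (@measurable_pos R) mX).
have mN F : measurable_fun setT F -> measurable_fun setT (fun w => - F w).
  by move=> mX; exact: measurable_funN.
have key (F F' : tm * Om -> R) : measurable_fun setT F -> measurable_fun setT F' ->
    (\int[mu \x Pr]_(p in cyl r t) (D p * (pos (F p) + pos (F' p)))%:E =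
     \int[mu]_(q in oc r t) \int[Pr]_w (D (q, w) * (pos (F (q, w)) + pos (F' (q, w))))%:E)%E.
  move=> mF mF'; rewrite (@tonelli_cyl _ _ _ Pr mu r t (fun p => (D p * (pos (F p) + pos (F' p)))%:E))//.
    by apply/measurable_EFinP; apply: (measurable_funM mD (measurable_funD (mp _ mF) (mp _ mF'))).
  by move=> p; rewrite lee_fin mulr_ge0// addr_ge0 ?pos_ge0.
rewrite (key _ _ mMt (mN _ (mart_meas mM))) (key _ _ (mN _ mMt) (mart_meas mM)).
apply: eq_integral => q /set_mem[/= rq qt]; apply: mart_pm => //.
- exact: le_trans sr (ltW rq).
- exact: measurable_sec.
- exact: nD.
Qed.

(* Fubini, with the martingale property at each intermediate time. *)
Lemma mart_iint r t D : s <= r :> R -> r <= t :> R ->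
  measurable_fun setT D -> nap r t D -> ig r t (fun p => D p * M (t, p.2)) ->
  ig r t (fun p => D p * M p) /\
  iint r t (fun p => D p * M (t, p.2)) = iint r t (fun p => D p * M p).
Proof.
move=> sr rt mD nD i.
have mMt := measurable_sect t (mart_meas mM).
apply: swap_integral => //.
- exact: measurable_cyl.
- exact: measurable_funTS.
- exact: measurable_funTS.
- by apply: measurable_funTS; exact: (mart_meas mM).
- exact: mart_le_iint.
- apply: mart_pm_iint => //.
  + exact: (measurableT_comp (@measurable_pos R)).
  + by move=> q h w /=; rewrite nD.
  + by move=> p; rewrite pos_ge0.
- apply: mart_pm_iint => //.
  + by apply: (measurableT_comp (@measurable_pos R)); exact: measurable_funN.
  + by move=> q h w /=; rewrite nD.
  + by move=> p; rewrite pos_ge0.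
Qed.

End mart_facts.
End martingales.

Section real_fubini.
Context d1 d2 (X1 : measurableType d1) (X2 : measurableType d2) (R : realType).
Variables (m1 : {finite_measure set X1 -> \bar R}) (m2 : {finite_measure set X2 -> \bar R}).
Variable F : X1 * X2 -> R.
Hypothesis iF : (m1 \x m2)%E.-integrable setT (EFin \o F).

Lemma Rfubini1 :
  \int[(m1 \x m2)%E]_p F p = \int[m1]_x \int[m2]_y F (x, y).
Proof.
rewrite /Rintegral -(integral12_prod_meas1 iF); congr fine.
have iG := integrable_fubini_F iF.
apply: ae_eq_integral => //; first exact: (measurable_int _ iG).
  by apply/measurable_EFinP; apply: measurableT_comp => //; exact: (measurable_int _ iG).
have := integrable_ae measurableT iG; apply: filterS => x /(_ Logic.I) h _.
by rewrite fineK.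
Qed.

Lemma Rfubini2 :
  \int[(m1 \x m2)%E]_p F p = \int[m2]_y \int[m1]_x F (x, y).
Proof.
have iG : m2.-integrable setT (fubini_G m1 (EFin \o F)).
  apply/integrableP; split; first exact: (measurable_fubini_G iF).
  have /integrableP[mF lF] := iF.
  apply: le_lt_trans lF; rewrite fubini_tonelli2//; last exact: measurableT_comp.
  apply: ge0_le_integral => //.
  - by apply: measurableT_comp => //; exact: (measurable_fubini_G iF).
  - by apply: measurable_fun_fubini_tonelli_G => //; exact: measurableT_comp.
  - move=> y _; rewrite /fubini_G; apply: le_abse_integral => //.
    exact: (measurableT_comp mF (measurable_pair2 y)).
rewrite /Rintegral -(integral21_prod_meas1 iF); congr fine.
apply: ae_eq_integral => //; first exact: (measurable_int _ iG).
  by apply/measurable_EFinP; apply: measurableT_comp => //; exact: (measurable_int _ iG).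
have := integrable_ae measurableT iG; apply: filterS => x /(_ Logic.I) h _.
by rewrite fineK.
Qed.

End real_fubini.

Lemma integrable_bnd d (X : measurableType d) (R : realType) (nu : {measure set X -> \bar R})
    (A : set X) (b f : X -> R) (c : R) : measurable A -> measurable_fun A b ->
  nu.-integrable A (EFin \o f) -> (forall x, A x -> `|b x| <= c) ->
  nu.-integrable A (EFin \o (fun x => b x * f x)).
Proof.
move=> mA mb i bc; apply: (@integrable_dom _ _ _ _ _ _ (fun x => c * f x)) => //.
- apply: measurable_funM => //; apply/measurable_EFinP; exact: (measurable_int _ i).
- rewrite (_ : EFin \o _ = (fun x => c%:E * (EFin \o f) x))%E; last by apply/funext => x /=.
  exact: integrableZl.
- move=> x Ax; rewrite !normrM ler_wpM2r//; apply: le_trans (bc x Ax) _; exact: ler_norm.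
Qed.

(** * Integration by parts and drifts *)

Section product_rule.
Context {R : realType} {T : {nonneg R}}.
Local Notation tm := (time T).
Variable mu : {finite_measure set tm -> \bar R}.
Hypothesis mu_atom : forall t, mu [set t] = 0%E.
Implicit Types (f g : tm -> R) (s t q : tm).

Definition dn q : set tm := [set p : tm | p <= q :> R].

Lemma measurable_dn q : measurable (dn q).
Proof. by apply: measurable_time_le => //; exact: measurable_cst. Qed.

Lemma dn_strict q f : measurable_fun setT f ->
  \int[mu]_(p in [set p : tm | p < q :> R]) f p = \int[mu]_(p in dn q) f p.
Proof.
move=> mf; rewrite /Rintegral; congr fine.
have e : dn q = [set p : tm | p < q :> R] `|` [set q].
  apply/seteqP; split => p /=; rewrite /dn/= le_eqVlt.
    by move=> /orP[/eqP/time_inj ->|]; [right|left].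
  by move=> [->|->]; rewrite ?orbT// eqxx.
have m1 : measurable [set p : tm | p < q :> R].
  by apply: measurable_time_lt => //; exact: measurable_cst.
rewrite e integral_setU//; [|exact: measurable_time1| |].
- rewrite [X in (_ = _ + X)%E](_ : _ = 0%E) ?adde0//.
  apply: null_set_integral; [exact: measurable_time1| |exact: mu_atom].
  by apply/measurable_EFinP; exact: measurable_funTS.
- by apply/measurable_EFinP; exact: measurable_funTS.
- by apply/disj_setPS => p /= [h pq]; move: h; rewrite pq ltxx.
Qed.

(** The square is cut along its diagonal into p <= q and q < p. Since points are null, [dn_strict]
    turns the strict inequality back into a large one. *)
Lemma product_rule_dn f g : mu.-integrable setT (EFin \o f) ->
  mu.-integrable setT (EFin \o g) ->
  (\int[mu]_p f p) * (\int[mu]_q g q) =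
  \int[mu]_q (g q * \int[mu]_(p in dn q) f p) +
  \int[mu]_p (f p * \int[mu]_(q in dn p) g q).
Proof.
move=> iff ig.
have mf : measurable_fun setT f by apply/measurable_EFinP; exact: (measurable_int _ iff).
have mg : measurable_fun setT g by apply/measurable_EFinP; exact: (measurable_int _ ig).
pose F (p : tm * tm) : R := f p.1 * g p.2.
have mF : measurable_fun setT F.
  by apply: measurable_funM;
      [exact: (measurableT_comp mf measurable_fst)|exact: (measurableT_comp mg measurable_snd)].
have iF : (mu \x mu)%E.-integrable setT (EFin \o F).
  apply/integrableP; split; first exact/measurable_EFinP.
  rewrite fubini_tonelli1//; last by apply: measurableT_comp => //; exact/measurable_EFinP.
  rewrite /fubini_F.
  under eq_integral => x _.
    under eq_integral => y _ do rewrite /F/= normrM EFinM.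
    rewrite ge0_integralZl_EFin//; last by apply/measurable_EFinP; exact: measurableT_comp.
    over.
  have /integrableP[_ lf] := iff; have /integrableP[_ lg] := ig.
  rewrite ge0_integralZr//; last first.
  - by apply: integral_ge0.
  - by apply/measurable_EFinP; exact: measurableT_comp.
  apply: lte_mul_pinfty => //; first exact: integral_ge0.
  by rewrite ge0_fin_numE//; exact: integral_ge0.
pose S := [set p : tm * tm | p.1 <= p.2 :> R].
have mS : measurable S by apply: measurable_time_le.
have mI (A : set (tm * tm)) : measurable A -> measurable_fun setT (\1_A : tm * tm -> R).
  by move=> mA; exact: measurable_indic.
have bI (A : set (tm * tm)) x : `|\1_A x| <= 1 :> R.
  by rewrite indicE ger0_norm// lern1 leq_b1.
have i1 := integrable_bnd measurableT (mI _ mS) iF (fun x _ => bI S x).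
have i2 := integrable_bnd measurableT (mI _ (measurableC mS)) iF (fun x _ => bI (~` S) x).
have e0 : \int[(mu \x mu)%E]_p F p = (\int[mu]_p f p) * (\int[mu]_q g q).
  rewrite Rfubini1//= -[RHS]RintegralZr//; apply: eq_Rintegral => p _.
  by rewrite /F/= RintegralZl.
have e1 : \int[(mu \x mu)%E]_p F p = \int[(mu \x mu)%E]_p (\1_S p * F p) + \int[(mu \x mu)%E]_p
    (\1_(~` S) p * F p).
  rewrite -RintegralD//; apply: eq_Rintegral => p _; rewrite -mulrDl !indicE in_setC.
  by case: (p \in S) => /=; rewrite ?addr0 ?add0r mul1r.
rewrite -e0 e1; congr (_ + _).
  rewrite Rfubini2//; apply: eq_Rintegral => q _.
  rewrite [in RHS]Rintegral_mkcond -RintegralZl//; last first.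
    rewrite (_ : EFin \o _ = ((EFin \o f) \_ (dn q))); last by rewrite restrict_EFin.
    by apply/(integrable_mkcond _ (measurable_dn q)).1; apply: (integrableS measurableT) => //;
        exact: measurable_dn.
  apply: eq_Rintegral => p _; rewrite /F/= patchE indicE.
  by case: (boolP (p \in dn q)) => h; rewrite (_ : (_ \in S) = (p \in dn q))// ?h ?(negbTE h) /=;
      rewrite ?mul1r ?mul0r ?mulr0 ?[g _ * _]mulrC.
rewrite Rfubini1//; apply: eq_Rintegral => p _; rewrite -dn_strict//.
have mlt : measurable [set q : tm | q < p :> R].
  by apply: measurable_time_lt => //; exact: measurable_cst.
rewrite [in RHS]Rintegral_mkcond -RintegralZl//; last first.
  rewrite (_ : EFin \o _ = ((EFin \o g) \_ [set q : tm | q < p :> R])); last by rewrite restrict_EFin.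
  by apply/(integrable_mkcond _ mlt).1; exact: (integrableS measurableT).
apply: eq_Rintegral => q _; rewrite /F/= patchE indicE.
have -> : ((p, q) \in ~` S) = (q \in [set q : tm | q < p :> R]).
  have e : (~` S) (p, q) <-> q < p :> R by rewrite /S/setC/= ltNge; split => /negP.
  by apply/idP/idP => /set_mem/e h; apply/mem_set.
by case: ifPn => h /=; rewrite ?mul1r ?mul0r ?mulr0.
Qed.

Lemma oc_dn s t q : oc s t q -> oc s t `&` dn q = oc s q.
Proof.
move=> [/= sq qt]; apply/seteqP; split => p /=; rewrite /dn/=.
  by move=> [[sp _] pq].
by move=> [sp pq]; split => //; split => //; exact: le_trans qt.
Qed.

(* Integration by parts; no correction term appears because mu has no atom. *)
Lemma product_rule s t f g : measurable_fun setT f -> measurable_fun setT g ->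
  mu.-integrable (oc s t) (EFin \o f) -> mu.-integrable (oc s t) (EFin \o g) ->
  (\int[mu]_(p in oc s t) f p) * (\int[mu]_(q in oc s t) g q) =
  \int[mu]_(q in oc s t) (g q * \int[mu]_(p in oc s q) f p) +
  \int[mu]_(p in oc s t) (f p * \int[mu]_(q in oc s p) g q).
Proof.
move=> mf mg iff ig.
have r h : mu.-integrable (oc s t) (EFin \o h) -> mu.-integrable setT (EFin \o (h \_ (oc s t))).
  by move=> ih; rewrite -restrict_EFin; apply/(integrable_mkcond _ (measurable_oc s t)).1.
have ef := Rintegral_mkcond mu (oc s t) f; have eg := Rintegral_mkcond mu (oc s t) g.
rewrite [X in X * _]ef [X in _ * X]eg; apply: (etrans (product_rule_dn (r _ iff) (r _ ig))).
apply: (congr2 (fun y z : R => y + z)).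
  rewrite [RHS]Rintegral_mkcond; apply: eq_Rintegral => q _; rewrite !patchE.
  case: ifPn => [/set_mem qs|_]; last by rewrite mul0r.
  by congr (_ * _); rewrite -(oc_dn qs) Rintegral_mkcondl.
rewrite [RHS]Rintegral_mkcond; apply: eq_Rintegral => q _; rewrite !patchE.
case: ifPn => [/set_mem qs|_]; last by rewrite mul0r.
by congr (_ * _); rewrite -(oc_dn qs) Rintegral_mkcondl.
Qed.

End product_rule.

Section cyl_fubini.
Context {R : realType} {T : {nonneg R}} {E : completePseudoMetricType R}.
Local Notation tm := (time T).
Local Notation Om := (Omega T E).
Variables (Pr : probability Om R) (mu : {finite_measure set tm -> \bar R}).
Implicit Types (q r s t : tm) (F G : tm * Om -> R) (X Y xi : Om -> R).
Local Notation EE := (EE Pr).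
Local Notation iint := (iint Pr mu).
Local Notation ig := (ig Pr mu).

Lemma igS r t r' t' F : r <= r' :> R -> t' <= t :> R -> ig r t F -> ig r' t' F.
Proof.
move=> rr tt; apply: integrableS; [exact: measurable_cyl|exact: measurable_cyl|].
by move=> [q w] [/= h _]; split => //; exact: (sub_oc rr tt).
Qed.

Let restr r t F : ig r t F -> (mu \x Pr)%E.-integrable setT (EFin \o (F \_ (cyl r t))).
Proof. by rewrite -restrict_EFin; move/(integrable_mkcond _ (measurable_cyl r t)). Qed.

Let patch_cyl r t F q w : (F \_ (cyl r t)) (q, w) = ((fun q => F (q, w)) \_ (oc r t)) q.
Proof.
rewrite !patchE (_ : (_ \in cyl r t) = (q \in oc r t))//.
by apply/idP/idP => /set_mem h; apply/mem_set => //; case: h.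
Qed.

Lemma iint_EE r t F : ig r t F ->
  iint r t F = EE (fun w => \int[mu]_(q in oc r t) F (q, w)).
Proof.
move=> i; rewrite /iint Rintegral_mkcond Rfubini2; last exact: restr.
apply: eq_Rintegral => w _; rewrite [RHS]Rintegral_mkcond.
by apply: eq_Rintegral => q _; rewrite patch_cyl.
Qed.

Lemma igP_int r t F : ig r t F -> igP Pr (fun w => \int[mu]_(q in oc r t) F (q, w)).
Proof.
move=> i; have j := restr i.
have iG : Pr.-integrable setT (fubini_G mu (EFin \o (F \_ (cyl r t)))).
  apply/integrableP; split; first exact: (measurable_fubini_G j).
  have /integrableP[mF lF] := j.
  apply: le_lt_trans lF; rewrite fubini_tonelli2//; last exact: measurableT_comp.
  apply: ge0_le_integral => //.
  - by apply: measurableT_comp => //; exact: (measurable_fubini_G j).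
  - by apply: measurable_fun_fubini_tonelli_G => //; exact: measurableT_comp.
  - move=> y _; rewrite /fubini_G; apply: le_abse_integral => //.
    exact: (measurableT_comp mF (measurable_pair2 y)).
have mG : measurable_fun setT (fun w => \int[mu]_(q in oc r t) F (q, w)).
  rewrite (_ : (fun w => _) = fine \o fubini_G mu (EFin \o (F \_ (cyl r t)))).
    by apply: measurableT_comp => //; exact: (measurable_int _ iG).
  apply/funext => w; rewrite Rintegral_mkcond /Rintegral /fubini_G /=; congr fine.
  by apply: eq_integral => q _; rewrite patch_cyl.
apply: (le_integrable measurableT _ _ iG); first exact/measurable_EFinP.
move=> w _; rewrite /= Rintegral_mkcond /Rintegral.
have -> : fubini_G mu (EFin \o (F \_ (cyl r t))) w =
   (\int[mu]_q (((fun q => F (q, w)) \_ (oc r t)) q)%:E)%E.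
  by apply: eq_integral => q _; rewrite /= patch_cyl.
by case: (\int[mu]_q _)%E => [x| |] //=; rewrite normr0 leey.
Qed.

Lemma iintU r (u : tm) t F : r <= u :> R -> (u : R) <= (t : R) -> ig r t F ->
  iint r t F = iint r u F + iint u t F.
Proof.
move=> ru ut i; rewrite /iint (cylU ru ut) Rintegral_setU//.
- exact: measurable_cyl.
- exact: measurable_cyl.
- by rewrite -cylU.
- apply/disj_setPS => -[q w] [[/= h1 _] [/= h2 _]].
  by have /disj_setPS/(_ q) := oc_disj r u t; apply.
Qed.

Lemma ae_cyl (Q : tm * Om -> Prop) : (\forall w \ae Pr, forall q, Q (q, w)) ->
  \forall p \ae (mu \x Pr)%E, Q p.
Proof.
move=> [B [mB B0 hB]]; exists (setT `*` B); split.
- by apply: measurableX.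
- by rewrite product_measure1E// [X in (_ * X)%E]B0 mule0.
- by move=> [q w] /= h; split => //; apply: hB => /= h'; exact: h.
Qed.

End cyl_fubini.

Section int_process.
Context {R : realType} {T : {nonneg R}} {E : completePseudoMetricType R}.
Local Notation tm := (time T).
Local Notation Om := (Omega T E).
Variables (mu : {finite_measure set tm -> \bar R}).
Implicit Types (q r s t : tm).

Lemma measurable_int_e s (G : tm * Om -> \bar R) : measurable_fun setT G ->
  (forall p, (0 <= G p)%E) ->
  measurable_fun setT (fun p : tm * Om => \int[mu]_(q in oc s p.1) G (q, p.2))%E.
Proof.
move=> mG G0.
pose S := [set z : (tm * Om) * tm | oc s z.1.1 z.2].
have mS : measurable S.
  have -> : S = [set z : (tm * Om) * tm | s < z.2 :> R] `&` [set z : (tm * Om) * tm | z.2 <= z.1.1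
      :> R] by [].
  apply: measurableI; first exact: measurable_time_lt.
  by apply: measurable_time_le => //; exact: measurableT_comp.
pose H (z : (tm * Om) * tm) : \bar R := ((\1_S z)%:E * G (z.2, z.1.2))%E.
rewrite (_ : (fun p => _) = fubini_F mu H).
  apply: measurable_fun_fubini_tonelli_F; last by move=> z; rewrite mule_ge0// lee_fin.
  apply: emeasurable_funM; first by apply/measurable_EFinP; exact: measurable_indic.
  apply: (measurableT_comp mG); apply: measurable_fun_pair => //.
  exact: measurableT_comp.
apply/funext => -[t w]; rewrite /fubini_F [LHS]integral_mkcond; apply: eq_integral => q _.
rewrite patchE /H/= indicE (_ : (_ \in S) = (q \in oc s t)).
  by case: ifPn => h; rewrite ?mul1e ?mul0e.
by apply/idP/idP => /set_mem h; apply/mem_set.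
Qed.

Lemma measurable_int_r s (F : tm * Om -> R) : measurable_fun setT F ->
  measurable_fun setT (fun p : tm * Om => \int[mu]_(q in oc s p.1) F (q, p.2)).
Proof.
move=> mF; rewrite /Rintegral; apply: measurableT_comp => //.
under eq_fun do rewrite integralE.
have mFe : measurable_fun setT (EFin \o F) by exact/measurable_EFinP.
have mp := @measurable_int_e s _ (measurable_funepos mFe) (fun p => funepos_ge0 _ p).
have mn := @measurable_int_e s _ (measurable_funeneg mFe) (fun p => funeneg_ge0 _ p).
apply: (eq_measurable_fun _ _ (emeasurable_funB mp mn)) => p _.
by congr (_ - _)%E; apply: eq_integral => q _; rewrite ?funeposE ?funenegE.
Qed.

Lemma na_int s t (F : tm * Om -> R) : (forall q, s <= q :> R -> na q (fun w => F (q, w))) ->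
  na t (fun w => \int[mu]_(q in oc s t) F (q, w)).
Proof.
move=> nF w; apply: eq_Rintegral => q /set_mem[/= sq qt].
exact: (na_le qt (nF q (ltW sq))).
Qed.

End int_process.

Section eq_int.
Context {R : realType} {T : {nonneg R}} {E : completePseudoMetricType R}.
Local Notation tm := (time T).
Local Notation Om := (Omega T E).
Variables (Pr : probability Om R) (mu : {finite_measure set tm -> \bar R}).
Implicit Types (F G : tm * Om -> R) (X Y : Om -> R) (r t : tm).

Lemma eq_igP X Y : (forall w, X w = Y w) -> igP Pr X -> igP Pr Y.
Proof. by move=> /funext ->. Qed.

Lemma eq_EE X Y : (forall w, X w = Y w) -> EE Pr X = EE Pr Y.
Proof. by move=> /funext ->. Qed.

Lemma eq_ig r t F G : (forall p, F p = G p) -> ig Pr mu r t F -> ig Pr mu r t G.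
Proof. by move=> /funext ->. Qed.

Lemma eq_iint r t F G : (forall p, F p = G p) -> iint Pr mu r t F = iint Pr mu r t G.
Proof. by move=> /funext ->. Qed.

Lemma na_mul t X Y : na t X -> na t Y -> na t (fun w => X w * Y w).
Proof. by move=> nX nY w; rewrite nX nY. Qed.

End eq_int.

Section drift.
Context {R : realType} {T : {nonneg R}} {E : completePseudoMetricType R}.
Local Notation tm := (time T).
Local Notation Om := (Omega T E).
Variables (Pr : probability Om R) (mu : {finite_measure set tm -> \bar R}).
Variable s : tm.
Implicit Types (q r t : tm) (F G D S M N d e : tm * Om -> R) (X Y xi : Om -> R).
Local Notation EE := (EE Pr).
Local Notation iint := (iint Pr mu).
Local Notation ig := (ig Pr mu).
Local Notation igP := (igP Pr).
Local Notation amart := (amart Pr s).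

(* D = D_s + int d dmu, an adapted process of bounded variation. *)
Record fv (c : R) D d : Prop := Fv {
  fv_mD : measurable_fun setT D;
  fv_md : measurable_fun setT d;
  fv_nD : forall q, s <= q :> R -> na q (fun w => D (q, w));
  fv_nd : forall q, s <= q :> R -> na q (fun w => d (q, w));
  fv_bd : forall t w, s <= t :> R -> `|D (t, w)| <= c;
  fv_var : forall w, (\int[mu]_(q in oc s tT) (`|d (q, w)|)%:E <= c%:E)%E;
  fv_eq : forall t w, s <= t :> R ->
    D (t, w) = D (s, w) + \int[mu]_(q in oc s t) d (q, w) }.

Lemma measurable_time_sec F w : measurable_fun setT F -> measurable_fun setT (fun q => F (q, w)).
Proof. by move=> mF; exact: (measurableT_comp mF (measurable_pair2 w)). Qed.

Section fv_facts.
Variables (c : R) (D d : tm * Om -> R).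
Hypothesis h : fv c D d.

Lemma fv_c0 : 0 <= c.
Proof. by apply: le_trans (fv_bd h point (lexx (s : R))). Qed.

Lemma fv_ipath r t w : s <= r :> R -> mu.-integrable (oc r t) (EFin \o (fun q => d (q, w))).
Proof.
move=> sr; apply: (integrableS (measurable_oc s tT)); first exact: measurable_oc.
  by apply: sub_oc => //; exact: le_tT.
apply/integrableP; split.
  by apply/measurable_EFinP/measurable_funTS/measurable_time_sec; exact: (fv_md h).
by apply: le_lt_trans (fv_var h w) _; rewrite ltry.
Qed.

Lemma fv_incr r t w : s <= r :> R -> r <= t :> R ->
  D (t, w) = D (r, w) + \int[mu]_(q in oc r t) d (q, w).
Proof.
move=> sr rt; rewrite (fv_eq h _ (le_trans sr rt)) (fv_eq h _ sr) -addrA; congr (_ + _).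
rewrite (ocU sr rt) Rintegral_setU//.
- exact: measurable_oc.
- exact: measurable_oc.
- by rewrite -ocU//; exact: fv_ipath.
- exact: oc_disj.
Qed.

(** Along each path d has total mass at most c, so the integral of |X d| is at most c times that of
    |X|. *)
Lemma ig_fv r t X : s <= r :> R -> measurable_fun setT X -> igP X ->
  ig r t (fun p => X p.2 * d p).
Proof.
move=> sr mX iX.
have mF : measurable_fun setT (fun p => X p.2 * d p).
  by apply: measurable_funM; [exact: (measurableT_comp mX measurable_snd)|exact: (fv_md h)].
apply: (igS (r := s) (t := tT)) => //; first exact: le_tT.
apply/integrableP; split; first exact/measurable_EFinP/measurable_funTS.
rewrite (@tonelli_cyl2 _ _ _ Pr mu _ _ (fun p => `|(X p.2 * d p)%:E|%E))//; last first.
  by apply: measurableT_comp => //; exact/measurable_EFinP.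
apply: (@le_lt_trans _ _ (\int[Pr]_w (c%:E * `|(X w)%:E|))%E); last first.
  rewrite ge0_integralZl_EFin ?fv_c0//; last by apply: measurableT_comp => //; exact/measurable_EFinP.
  have /integrableP[_ l] := iX.
  by apply: lte_mul_pinfty => //; rewrite ?lee_fin ?fv_c0.
apply: ge0_le_integral => //.
- by move=> w _; apply: integral_ge0.
- have := @measurable_int_e _ _ _ mu s (fun p => `|(X p.2 * d p)%:E|%E).
  move=> /(_ _ (fun p => abse_ge0 _)) H; apply: (measurableT_comp (H _) (measurable_pair1 tT)).
  by apply: measurableT_comp => //; exact/measurable_EFinP.
- by apply: emeasurable_funM => //; apply: measurableT_comp => //; exact/measurable_EFinP.
- move=> w _; under eq_integral do rewrite /= normrM EFinM.
  rewrite ge0_integralZl_EFin//; last 2 first.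
  + exact: measurable_oc.
  + apply/measurable_EFinP/measurable_funTS; apply: measurableT_comp => //.
    by apply: measurable_time_sec; exact: (fv_md h).
  by rewrite muleC lee_wpmul2r ?lee_fin// (fv_var h).
Qed.

Lemma igP_bnd X (b : Om -> R) (k : R) : igP X -> measurable_fun setT b -> (forall w, `|b w| <= k) ->
  igP (fun w => b w * X w).
Proof. by move=> iX mb bk; apply: (integrable_bnd measurableT mb iX (fun w _ => bk w)). Qed.

(* The terms D_r N_t and N_t (D_t - D_r) are conditioned separately, the second
   one under the integral sign. *)
Lemma mart_fv N r t xi : amart N -> s <= r :> R -> r <= t :> R ->
  measurable_fun setT xi -> na r xi -> igP (fun w => xi w * N (t, w)) ->
  [/\ igP (fun w => xi w * (D (t, w) * N (t, w))),
      igP (fun w => xi w * (D (r, w) * N (r, w))),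
      ig r t (fun p => xi p.2 * (d p * N p)) &
      EE (fun w => xi w * (D (t, w) * N (t, w))) - EE (fun w => xi w * (D (r, w) * N (r, w)))
        = iint r t (fun p => xi p.2 * (d p * N p))].
Proof.
move=> mN sr rt mxi nxi i; have st := le_trans sr rt.
have mDt := measurable_sec t (fv_mD h); have mDr := measurable_sec r (fv_mD h).
have mNt := measurable_sec t (mart_meas mN); have mNr := measurable_sec r (mart_meas mN).
have it : igP (fun w => D (t, w) * (xi w * N (t, w))).
  by apply: (igP_bnd i mDt (k := c)) => w; exact: (fv_bd h).
have irt : igP (fun w => D (r, w) * (xi w * N (t, w))).
  by apply: (igP_bnd i mDr (k := c)) => w; exact: (fv_bd h).
have irt' : igP (fun w => (xi w * D (r, w)) * N (t, w)).
  by apply: eq_igP irt => w; rewrite mulrCA mulrA.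
have [ir er] := mart_fun mN sr rt (measurable_funM mxi mDr) (na_mul nxi (fv_nD h sr)) irt'.
have mxN : measurable_fun setT (fun w => xi w * N (t, w)) by exact: measurable_funM.
have idt := ig_fv t sr mxN i.
have idt' : ig r t (fun p => (xi p.2 * d p) * N (t, p.2)).
  by apply: eq_ig idt => p; rewrite mulrAC.
have md' : measurable_fun setT (fun p => xi p.2 * d p).
  by apply: measurable_funM; [exact: (measurableT_comp mxi measurable_snd)|exact: (fv_md h)].
have nd' : nap r t (fun p => xi p.2 * d p).
  move=> q [/= rq qt] w /=; rewrite (na_le (ltW rq) nxi) (fv_nd h)//.
  exact: le_trans sr (ltW rq).
have [idq eq] := mart_iint (mu := mu) mN sr rt md' nd' idt'.
split.
- by apply: eq_igP it => w; rewrite mulrCA.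
- by apply: eq_igP ir => w; rewrite mulrA.
- by apply: eq_ig idq => p; rewrite mulrA.
have -> : iint r t (fun p => xi p.2 * (d p * N p)) = iint r t (fun p => (xi p.2 * N (t, p.2)) * d p).
  transitivity (iint r t (fun p => xi p.2 * d p * N p)).
    by apply: eq_iint => p; rewrite mulrA.
  by rewrite -eq; apply: eq_iint => p; rewrite mulrAC.
rewrite iint_EE//.
have -> : EE (fun w => xi w * (D (r, w) * N (r, w))) = EE (fun w => xi w * D (r, w) * N (t, w)).
  by rewrite er; apply: eq_EE => w; rewrite mulrA.
rewrite /EE -RintegralB//; last by apply: eq_igP it => w; rewrite mulrCA.
apply: eq_EE => w.
have -> : \int[mu]_(q in oc r t) (xi (q, w).2 * N (t, (q, w).2) * d (q, w)) =
    xi w * N (t, w) * \int[mu]_(q in oc r t) d (q, w).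
  exact: (RintegralZl (xi w * N (t, w)) (measurable_oc r t) (fv_ipath t w sr)).
by rewrite (fv_incr w sr rt); ring.
Qed.

End fv_facts.

(** Leibniz' rule along each path. The product is bounded by c1 c2 and its variation by c1 c2 + c2
    c1; the sum serves as a common constant. *)
Lemma fv_mul (mu_atom : forall t, mu [set t] = 0%E) c1 c2 D1 d1 D2 d2 : fv c1 D1 d1 -> fv c2 D2 d2 ->
  fv (c1 * c2 + c1 * c2) (fun p => D1 p * D2 p) (fun p => D1 p * d2 p + d1 p * D2 p).
Proof.
move=> h1 h2; have c10 := fv_c0 h1; have c20 := fv_c0 h2.
have m1 := fv_mD h1; have m2 := fv_mD h2; have md1 := fv_md h1; have md2 := fv_md h2.
have n1 := fv_nD h1; have n2 := fv_nD h2; have nd1 := fv_nd h1; have nd2 := fv_nd h2.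
have mDd : measurable_fun setT (fun p => D1 p * d2 p + d1 p * D2 p).
  by apply: measurable_funD; exact: measurable_funM.
split => //.
- exact: measurable_funM.
- by move=> q sq w; rewrite n1// n2.
- by move=> q sq w; rewrite n1// n2// nd1// nd2.
- move=> t w st; rewrite normrM; apply: (@le_trans _ _ (c1 * c2)); last by rewrite lerDl mulr_ge0.
  by rewrite ler_pM// (fv_bd h1, fv_bd h2).
- move=> w.
  have mw F : measurable_fun setT F -> measurable_fun (oc s tT) (fun q => (`|F (q, w)|)%:E).
    move=> mF; apply/measurable_EFinP/measurable_funTS/measurableT_comp => //.
    exact: measurable_time_sec.
  apply: (@le_trans _ _ (\int[mu]_(q in oc s tT) (c1%:E * `|d2 (q, w)|%:E + c2%:E * `|d1 (q, w)|%:E))%E).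
    apply: ge0_le_integral.
    + exact: measurable_oc.
    + by move=> q _; rewrite lee_fin.
    + exact: (mw _ mDd).
    + apply: emeasurable_funD; apply: emeasurable_funM => //; exact: mw.
    + move=> q [/= sq _]; rewrite -!EFinM -EFinD lee_fin.
      apply: le_trans (ler_normD _ _) _; rewrite !normrM; apply: lerD.
        by apply: ler_wpM2r => //; apply: (fv_bd h1); exact: ltW.
      by rewrite mulrC; apply: ler_wpM2r => //; apply: (fv_bd h2); exact: ltW.
  rewrite ge0_integralD//; first last.
  + by apply: emeasurable_funM => //; exact: mw.
  + by move=> q _; rewrite mule_ge0// lee_fin.
  + by apply: emeasurable_funM => //; exact: mw.
  + by move=> q _; rewrite mule_ge0// lee_fin.
  + exact: measurable_oc.
  rewrite !ge0_integralZl_EFin//; first last.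
  + exact: mw.
  + exact: measurable_oc.
  + exact: mw.
  + exact: measurable_oc.
  rewrite EFinD; apply: leeD; first by rewrite EFinM lee_wpmul2l ?lee_fin// (fv_var h2).
  by rewrite mulrC EFinM lee_wpmul2l ?lee_fin// (fv_var h1).
- move=> t w st.
  have i1 := fv_ipath h1 t w (lexx (s : R)); have i2 := fv_ipath h2 t w (lexx (s : R)).
  have mo := measurable_oc s t.
  have mt1 := measurable_time_sec w md1; have mt2 := measurable_time_sec w md2.
  have j1 : mu.-integrable (oc s t) (EFin \o (fun q => D1 (q, w) * d2 (q, w))).
    apply: (integrable_bnd mo _ i2 (c := c1)).
      by apply/measurable_funTS/measurable_time_sec.
    by move=> q [/= sq _]; apply: (fv_bd h1); exact: ltW.
  have j2 : mu.-integrable (oc s t) (EFin \o (fun q => D2 (q, w) * d1 (q, w))).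
    apply: (integrable_bnd mo _ i1 (c := c2)).
      by apply/measurable_funTS/measurable_time_sec.
    by move=> q [/= sq _]; apply: (fv_bd h2); exact: ltW.
  (* The inner integral is the increment of D1 since s; this yields both its measurability and its
     boundedness. *)
  have j3 : mu.-integrable (oc s t) (EFin \o (fun q => d2 (q, w) * \int[mu]_(p in oc s q) d1 (p, w))).
    apply: (@eq_integrable _ _ _ _ _ mo (EFin \o (fun q => D1 (q, w) * d2 (q, w) - D1 (s,
        w) * d2 (q, w)))).
      move=> q /set_mem[/= sq _]; congr EFin.
      by rewrite (fv_eq h1 w (ltW sq)); ring.
    apply: integrableB_R => //.
    by apply: (integrable_bnd mo (measurable_cst _) i2 (c := c1)) => q _; apply: (fv_bd h1).
  have j4 : mu.-integrable (oc s t) (EFin \o (fun q => d1 (q, w) * \int[mu]_(p in oc s q) d2 (p, w))).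
    apply: (@eq_integrable _ _ _ _ _ mo (EFin \o (fun q => D2 (q, w) * d1 (q, w) - D2 (s,
        w) * d1 (q, w)))).
      move=> q /set_mem[/= sq _]; congr EFin.
      by rewrite (fv_eq h2 w (ltW sq)); ring.
    apply: integrableB_R => //.
    by apply: (integrable_bnd mo (measurable_cst _) i1 (c := c2)) => q _; apply: (fv_bd h2).
  have PR := product_rule mu_atom mt1 mt2 i1 i2.
  have -> : \int[mu]_(q in oc s t) (D1 (q, w) * d2 (q, w) + d1 (q, w) * D2 (q, w)) =
     (D1 (s, w) * \int[mu]_(q in oc s t) d2 (q, w) + D2 (s, w) * \int[mu]_(q in oc s t) d1 (q, w)) +
     (\int[mu]_(q in oc s t) (d2 (q, w) * \int[mu]_(p in oc s q) d1 (p, w)) +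
      \int[mu]_(q in oc s t) (d1 (q, w) * \int[mu]_(p in oc s q) d2 (p, w))).
    rewrite -!RintegralZl// -!RintegralD//; first last.
    + by apply: (integrable_bnd mo (measurable_cst _) i1 (c := c2)) => q _; apply: (fv_bd h2).
    + by apply: (integrable_bnd mo (measurable_cst _) i2 (c := c1)) => q _; apply: (fv_bd h1).
    + exact: integrableD_R.
    + apply: integrableD_R => //.
        by apply: (integrable_bnd mo (measurable_cst _) i2 (c := c1)) => q _; apply: (fv_bd h1).
      by apply: (integrable_bnd mo (measurable_cst _) i1 (c := c2)) => q _; apply: (fv_bd h2).
    apply: eq_Rintegral => q /set_mem[/= sq _].
    by rewrite (fv_eq h1 w (ltW sq)) (fv_eq h2 w (ltW sq)); ring.
  rewrite -PR (fv_eq h1 w st) (fv_eq h2 w st); ring.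
Qed.

Lemma fv_int (a c : R) d : measurable_fun setT d ->
  (forall q, s <= q :> R -> na q (fun w => d (q, w))) ->
  (forall w, (\int[mu]_(q in oc s tT) (`|d (q, w)|)%:E <= c%:E)%E) ->
  fv (`|a| + c) (fun p => a + \int[mu]_(q in oc s p.1) d (q, p.2)) d.
Proof.
move=> md nd vd.
have i w t : mu.-integrable (oc s t) (EFin \o (fun q => d (q, w))).
  apply: (integrableS (measurable_oc s tT)); first exact: measurable_oc.
    by apply: sub_oc => //; exact: le_tT.
  apply/integrableP; split.
    by apply/measurable_EFinP/measurable_funTS/measurable_time_sec.
  by apply: le_lt_trans (vd w) _; rewrite ltry.
split => //=.
- by apply: measurable_funD => //; exact: measurable_int_r.
- by move=> q sq w; rewrite (na_int mu _ nd).
- move=> t w st; apply: le_trans (ler_normD _ _) _; rewrite lerD2l.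
  rewrite -lee_fin; apply: le_trans (vd w).
  apply: (@le_trans _ _ (\int[mu]_(q in oc s t) (`|d (q, w)|)%:E)%E).
    rewrite EFin_normr_Rintegral; [|exact: measurable_oc|exact: i].
    apply: le_abse_integral; first exact: measurable_oc.
    exact: (measurable_int _ (i w t)).
  apply: ge0_subset_integral => //; [exact: measurable_oc|exact: measurable_oc| |].
    apply/measurable_EFinP/measurable_funTS/measurableT_comp => //.
    exact: measurable_time_sec.
  by apply: sub_oc => //; exact: le_tT.
- move=> w; apply: le_trans (vd w) _; rewrite lee_fin lerDr//.
- by move=> t w st; rewrite oc0 Rintegral_set0 addr0.
Qed.

End drift.

Section drift2.
Context {R : realType} {T : {nonneg R}} {E : completePseudoMetricType R}.
Local Notation tm := (time T).
Local Notation Om := (Omega T E).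
Variables (Pr : probability Om R) (mu : {finite_measure set tm -> \bar R}).
Variable s : tm.
Implicit Types (q r t : tm) (F G D S M N d e : tm * Om -> R) (X Y xi : Om -> R).
Local Notation EE := (EE Pr).
Local Notation iint := (iint Pr mu).
Local Notation ig := (ig Pr mu).
Local Notation igP := (igP Pr).
Local Notation amart := (amart Pr s).
Local Notation fv := (fv mu s).

(* S - int e dmu is a martingale in the weak sense of its increments. *)
Record drift S e : Prop := Drift {
  drift_ig : forall t, s <= t :> R -> igP (fun w => S (t, w));
  drift_ige : ig s tT e;
  drift_eq : forall r t xi, s <= r :> R -> r <= t :> R ->
    measurable_fun setT xi -> na r xi -> (exists k, forall w, `|xi w| <= k) ->
    EE (fun w => xi w * S (t, w)) - EE (fun w => xi w * S (r, w)) =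
    iint r t (fun p => xi p.2 * e p) }.

Lemma eq_drift S e S' e' : (forall p, S p = S' p) -> (forall p, e p = e' p) ->
  drift S e -> drift S' e'.
Proof. by move=> /funext -> /funext ->. Qed.

Lemma igPM xi k X : measurable_fun setT xi -> (forall w, `|xi w| <= k) -> igP X ->
  igP (fun w => xi w * X w).
Proof. by move=> mxi xik iX; exact: (integrable_bnd measurableT mxi iX (fun w _ => xik w)). Qed.

Lemma igM xi k F r t : measurable_fun setT xi -> (forall w, `|xi w| <= k) -> ig r t F ->
  ig r t (fun p => xi p.2 * F p).
Proof.
move=> mxi xik iF; apply: (integrable_bnd (measurable_cyl r t) _ iF (fun w _ => xik w.2)).
by apply: measurable_funTS; exact: (measurableT_comp mxi measurable_snd).
Qed.

Lemma igPD X Y : igP X -> igP Y -> igP (fun w => X w + Y w).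
Proof. by move=> iX iY; exact: (integrableD measurableT iX iY). Qed.

Lemma igPB X Y : igP X -> igP Y -> igP (fun w => X w - Y w).
Proof. by move=> iX iY; exact: (integrableB measurableT iX iY). Qed.

Lemma igD r t F G : ig r t F -> ig r t G -> ig r t (fun w => F w + G w).
Proof. by move=> iX iY; exact: (integrableD (measurable_cyl r t) iX iY). Qed.

Lemma igB r t F G : ig r t F -> ig r t G -> ig r t (fun w => F w - G w).
Proof. by move=> iX iY; exact: (integrableB (measurable_cyl r t) iX iY). Qed.

Lemma igZ r t F (k : R) : ig r t F -> ig r t (fun w => k * F w).
Proof. by move=> iX; apply: (@integrable_bnd _ _ _ _ _ (cst k) _ `|k| (measurable_cyl r t) _ iX). Qed.

Lemma EED X Y : igP X -> igP Y -> EE (fun w => X w + Y w) = EE X + EE Y.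
Proof. by move=> iX iY; exact: (RintegralD measurableT iX iY). Qed.

Lemma EEB X Y : igP X -> igP Y -> EE (fun w => X w - Y w) = EE X - EE Y.
Proof. by move=> iX iY; exact: (RintegralB measurableT iX iY). Qed.

Lemma iintD r t F G : ig r t F -> ig r t G -> iint r t (fun w => F w + G w) = iint r t F + iint r t G.
Proof. by move=> iX iY; exact: (RintegralD (measurable_cyl r t) iX iY). Qed.

Lemma iintB r t F G : ig r t F -> ig r t G -> iint r t (fun w => F w - G w) = iint r t F - iint r t G.
Proof. by move=> iX iY; exact: (RintegralB (measurable_cyl r t) iX iY). Qed.

Lemma iintZ r t F (k : R) : ig r t F -> iint r t (fun w => k * F w) = k * iint r t F.
Proof. by move=> iX; exact: (RintegralZl (k) (measurable_cyl r t) iX). Qed.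

Lemma driftD S e S' e' : drift S e -> drift S' e' ->
  drift (fun p => S p + S' p) (fun p => e p + e' p).
Proof.
move=> h h'; split.
- by move=> t st; apply: igPD; [exact: (drift_ig h)|exact: (drift_ig h')].
- by apply: igD; [exact: (drift_ige h)|exact: (drift_ige h')].
- move=> r t xi sr rt mxi nxi [k hk]; have st := le_trans sr rt.
  have i1 u := igPM mxi hk (drift_ig h u).
  have i2 u := igPM mxi hk (drift_ig h' u).
  transitivity ((EE (fun w => xi w * S (t, w)) + EE (fun w => xi w * S' (t, w))) -
     (EE (fun w => xi w * S (r, w)) + EE (fun w => xi w * S' (r, w)))).
    by rewrite -!EED ?i1 ?i2//; congr (_ - _); apply: eq_EE => w; rewrite mulrDr.
  rewrite opprD addrACA (drift_eq h)//; last by exists k.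
  rewrite (drift_eq h')//; last by exists k.
  rewrite -iintD; first by apply: eq_iint => p; rewrite mulrDr.
  + by apply: (igM mxi hk); apply: igS (drift_ige h) => //; exact: le_tT.
  + by apply: (igM mxi hk); apply: igS (drift_ige h') => //; exact: le_tT.
Qed.

Lemma driftN S e : drift S e -> drift (fun p => - S p) (fun p => - e p).
Proof.
move=> h; split.
- move=> t st; apply: (eq_igP _ (@igPM (cst (-1)) `|-1| _ (measurable_cst _) (fun=> lexx _)
    (drift_ig h st))).
  by move=> w /=; rewrite mulN1r.
- by apply: (eq_ig _ (igZ (-1) (drift_ige h))) => p; rewrite mulN1r.
- move=> r t xi sr rt mxi nxi [k hk]; have st := le_trans sr rt.
  have := drift_eq h sr rt (measurable_funN mxi) (fun w => congr1 -%R (nxi w)).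
  move=> /(_ (ex_intro _ k (fun w => _))) => H.
  have {}H := H (fun w => eq_ind_r (fun x => x <= k) (hk w) (normrN _)).
  have e1 u : EE (fun w => xi w * - S (u, w)) = EE (fun w => (\- xi) w * S (u, w)).
    by apply: eq_EE => w /=; rewrite mulrN mulNr.
  by rewrite !e1 H; apply: eq_iint => p /=; rewrite mulrN mulNr.
Qed.

Lemma driftB S e S' e' : drift S e -> drift S' e' ->
  drift (fun p => S p - S' p) (fun p => e p - e' p).
Proof. by move=> h /driftN; exact: driftD. Qed.

Lemma drift_mart_fv c N D d : amart N -> fv c D d ->
  drift (fun p => D p * N p) (fun p => d p * N p).
Proof.
move=> mN hD; split.
- move=> t st.
  have i1 : igP (fun w => cst 1 w * N (t, w)).
    by apply: eq_igP (mart_ig mN st) => w /=; rewrite mul1r.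
  have [H _ _ _] := mart_fv hD mN st (lexx _) (measurable_cst (1 : R)) (fun w => erefl) i1.
  by apply: eq_igP H => w /=; rewrite mul1r.
- have i1 : igP (fun w => cst 1 w * N (tT, w)).
    by apply: eq_igP (mart_ig mN (le_tT s)) => w /=; rewrite mul1r.
  have [_ _ H _] := mart_fv hD mN (lexx _) (le_tT s) (measurable_cst (1 : R)) (fun w => erefl) i1.
  by apply: eq_ig H => w /=; rewrite mul1r.
- move=> r t xi sr rt mxi nxi [k hk]; have st := le_trans sr rt.
  by have [] := mart_fv hD mN sr rt mxi nxi (igPM mxi hk (mart_ig mN st)).
Qed.

Lemma mart_cst (k : R) : amart (fun=> k).
Proof.
split => //; first by move=> t st; exact: finite_measure_integrable_cst.
Qed.

(** D is the product of D with the constant martingale 1. *)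
Lemma drift_fv c D d : fv c D d -> drift D d.
Proof.
move=> h; apply: eq_drift (drift_mart_fv (mart_cst 1) h) => p; exact: mulr1.
Qed.

(** Lets an identity that holds only along almost every path, for all times at once, be substituted
    in a drift decomposition. *)
Lemma drift_ae S e S' e' : measurable_fun setT S' -> measurable_fun setT e' ->
  (\forall w \ae Pr, forall q, s <= q :> R -> S (q, w) = S' (q, w) /\ e (q, w) = e' (q, w)) ->
  drift S e -> drift S' e'.
Proof.
move=> mS' me' hae h.
have haeS t : s <= t :> R -> \forall w \ae Pr, S (t, w) = S' (t, w).
  by move=> st; apply: filterS hae => w /(_ t st)[].
have haee : \forall p \ae (mu \x Pr)%E, (s : R) <= ((p : tm * Om).1 : R) -> e p = e' p.
  apply: (@ae_cyl _ _ _ Pr mu (fun p => (s : R) <= (p.1 : R) -> e p = e' p)).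
  by apply: filterS hae => w hw q /hw[].
have eES t xi k : s <= t :> R -> measurable_fun setT xi -> (forall w, `|xi w| <= k) ->
    EE (fun w => xi w * S (t, w)) = EE (fun w => xi w * S' (t, w)).
  move=> st mxi hk; apply: Rint_eq_integral; apply: ae_eq_integral => //.
  - exact: (measurable_int _ (igPM mxi hk (drift_ig h st))).
  - by apply/measurable_EFinP; apply: measurable_funM => //; exact: measurable_sec.
  - by apply: filterS (haeS t st) => w -> _.
have iS' t : s <= t :> R -> igP (fun w => S' (t, w)).
  move=> st; apply: (ae_integrable_R measurableT _ (drift_ig h st)).
    exact: measurable_sec.
  by apply: filterS (haeS t st) => w /= -> _.
have ie' : ig s tT e'.
  apply: (ae_integrable_R (measurable_cyl s tT) _ (drift_ige h)).
    exact: measurable_funTS.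
  by apply: filterS haee => -[q w] /= H [[/= sq _] _]; rewrite H// ltW.
split => // r t xi sr rt mxi nxi [k hk]; have st := le_trans sr rt.
rewrite -(eES _ _ k)// -(eES _ _ k)// (drift_eq h)//; last by exists k.
apply: Rint_eq_integral; apply: ae_eq_integral.
- exact: measurable_cyl.
- apply: (measurable_int (mu \x Pr)%E); apply: (igM mxi hk); apply: igS (drift_ige h) => //;
    exact: le_tT.
- apply: (measurable_int (mu \x Pr)%E); apply: (igM mxi hk); apply: igS ie' => //; exact: le_tT.
- apply: filterS haee => -[q w] /= H [[/= rq _] _]; rewrite H//.
  exact: le_trans sr (ltW rq).
Qed.

End drift2.

(** * Localization *)

Section level_sets.
Context {R : realType} {T : {nonneg R}}.
Local Notation tm := (time T).
Variable mu : {finite_measure set tm -> \bar R}.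
Hypothesis mu_atom : forall t, mu [set t] = 0%E.
Variables (s : tm) (k : tm -> R).
Hypothesis mk : measurable_fun setT k.
Hypothesis k0 : forall q, 0 <= k q.
Implicit Types (q r t : tm) (m : R).
Local Open Scope ereal_scope.

(** Extended-valued, because in the application k is integrable only along almost every path. It may
    jump to +oo, and every statement below has to survive that. *)
Definition clockint q : \bar R := \int[mu]_(p in oc s q) (k p)%:E.
Local Notation K := clockint.

Let mke (A : set tm) : measurable_fun A (EFin \o k).
Proof. by apply/measurable_funTS/measurable_EFinP. Qed.

Lemma clockint_ge0 q : 0 <= K q.
Proof. by apply: integral_ge0 => p _; rewrite lee_fin. Qed.

Lemma clockint_nd q r : (q <= r :> R)%R -> K q <= K r.
Proof.
move=> qr; apply: ge0_subset_integral => //; [exact: measurable_oc|exact: measurable_oc| |].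
  by move=> p _; rewrite lee_fin.
exact: sub_oc.
Qed.

Lemma clockint_s : K s = 0.
Proof. by rewrite /clockint oc0 integral_set0. Qed.

Lemma measurable_clockint : measurable_fun setT K.
Proof.
pose S := [set z : tm * tm | oc s z.1 z.2].
have mS : measurable S.
  have -> : S = [set z : tm * tm | (s < z.2 :> R)%R] `&` [set z : tm * tm | (z.2 <= z.1 :> R)%R] by [].
  by apply: measurableI; [apply: measurable_time_lt|apply: measurable_time_le].
pose H (z : tm * tm) : \bar R := (\1_S z)%:E * (k z.2)%:E.
rewrite (_ : K = fubini_F mu H).
  apply: measurable_fun_fubini_tonelli_F; last by move=> z; rewrite mule_ge0// lee_fin.
  apply: emeasurable_funM; first by apply/measurable_EFinP; exact: measurable_indic.
  by apply/measurable_EFinP; exact: (measurableT_comp mk measurable_snd).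
apply/funext => t; rewrite /fubini_F /clockint [LHS]integral_mkcond; apply: eq_integral => q _.
rewrite patchE /H/= indicE (_ : (_ \in S) = (q \in oc s t)).
  by case: ifPn => h; rewrite ?mul1e ?mul0e.
by apply/idP/idP => /set_mem h; apply/mem_set.
Qed.

Definition lvl m : set tm := [set q | K q <= m%:E].

Lemma measurable_lvl m : measurable (lvl m).
Proof.
rewrite -[lvl m]setTI; apply: emeasurable_fun_infty_c => //; exact: measurable_clockint.
Qed.

Section sup_level.
Variable m : R.
Hypothesis m0 : (0 <= m)%R.
Let S : set R := [set q : R | exists2 t : tm, q = t :> R & (s <= t :> R)%R /\ K t <= m%:E].

Let Ss : S (s : R).
Proof. by exists s; rewrite // clockint_s lee_fin; split. Qed.

Let supS : has_sup S.
Proof.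
split; first by exists (s : R).
by exists T%:num => _ [t -> _]; exact: time_leT.
Qed.

(** The last time at which the clock is at most m, as a supremum that turns out to be attained. *)
Let tau : tm := clamp (sup S).

Let tauE : tau = sup S :> R.
Proof.
apply: clamp_id; apply/andP; split.
  by apply: le_trans (time_ge0 s) _; exact: sup_upper_bound.
by apply: ge_sup => [|_ [t -> _]]; [exists (s : R)|exact: time_leT].
Qed.

Let s_tau : (s <= tau :> R)%R. Proof. by rewrite tauE; exact: sup_upper_bound. Qed.

Let lvl_tau q : (s <= q :> R)%R -> K q <= m%:E -> (q <= tau :> R)%R.
Proof. by move=> sq Kq; rewrite tauE; apply: sup_upper_bound => //; exists q. Qed.

Let lt_tau q : (q < tau :> R)%R -> K q <= m%:E.
Proof.
rewrite tauE => qS; have [_ [t -> [st Kt]] qt] := sup_gt (ex_intro _ (s : R) Ss) qS.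
by apply: le_trans Kt; apply: clockint_nd; exact: ltW.
Qed.

Let oc_lt (t : tm) : \int[mu]_(p in oc s t `&` [set p : tm | (p < t :> R)%R]) (k p)%:E = K t.
Proof.
have [ts|st] := leP (t : R) (s : R).
  rewrite /clockint (_ : oc s t = set0) ?set0I ?integral_set0//.
  by apply/seteqP; split => // p [/= sp pt]; move: (lt_le_trans sp (le_trans pt ts)); rewrite ltxx.
have mI : measurable (oc s t `&` [set p : tm | (p < t :> R)%R]).
  by apply: measurableI; [exact: measurable_oc|apply: measurable_time_lt].
have e : oc s t = (oc s t `&` [set p : tm | (p < t :> R)%R]) `|` [set t].
  apply/seteqP; split => p /=.
    move=> [sp]; rewrite le_eqVlt => /orP[/eqP/time_inj ->|pt]; [by right|left].
    by split => //; split => //; exact: ltW.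
  by move=> [[]//|->]; split => //=; rewrite lexx.
rewrite /clockint [in RHS]e integral_setU//.
- rewrite [X in _ = _ + X](_ : _ = 0) ?adde0//.
  by apply: null_set_integral; [exact: measurable_time1|exact: mke|exact: mu_atom].
- exact: measurable_time1.
- by apply/disj_setPS => p /= [[_ h] pq]; move: h; rewrite pq ltxx.
Qed.

(** Left-continuity of the clock: tau itself carries no mass, and monotone convergence applies on
    the times up to tau - 1 / (n + 1). Finiteness of the clock plays no part here. *)
Let K_tau : K tau <= m%:E.
Proof.
rewrite -oc_lt.
pose A n := oc s tau `&` [set p : tm | (p <= clamp (T := T) ((tau : R) - n.+1%:R^-1) :> R)%R] `&`
  [set p : tm | (p < tau :> R)%R].
have mA n : measurable (A n).
  apply: measurableI; last by apply: measurable_time_lt.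
  by apply: measurableI; [exact: measurable_oc|apply: measurable_time_le].
have ndA : nondecreasing_seq A.
  move=> n j nj; apply/subsetPset => p [[ps pn] pt]; split => //; split => //=.
  apply: le_trans pn _; apply: clamp_nd; rewrite lerD2l lerN2 lef_pV2 ?posrE//.
  by rewrite ler_nat.
have := @ge0_nondecreasing_set_cvg_integral _ _ _ A (fun p => (k p)%:E) mu ndA mA.
have -> : \bigcup_i A i = oc s tau `&` [set p : tm | (p < tau :> R)%R].
  apply/seteqP; split => p; first by move=> [n _] [[ps _] pt]; split.
  move=> [ps pt]; have pt' : (0 < (tau : R) - (p : R))%R by rewrite subr_gt0.
  have [N _ /(_ N (leqnn N)) hN] := near_inv_lt pt'.
  exists N => //; split => //; split => //=.
  rewrite -[X in (X <= _)%R](congr1 (@Defs.tval _ _) (clampK p)); apply: clamp_nd.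
  by rewrite lerBrDr addrC -lerBrDr ltW.
have k0e p : 0 <= (k p)%:E by rewrite lee_fin.
move=> /(_ (fun i => @mke (A i)) (fun i p _ => k0e p)) H.
rewrite -(cvg_lim _ H)//; apply: lime_le; first by apply/cvg_ex; eexists; exact: H.
apply: nearW => n; set u : tm := clamp ((tau : R) - n.+1%:R^-1).
have [ut|tu] := ltP (u : R) (tau : R).
  apply: le_trans (lt_tau ut); apply: ge0_subset_integral => //.
  - exact: measurable_oc.
  - by move=> p [[[sp _] pu] _].
(* If clamping tau - 1 / (n + 1) does not move it strictly before tau, then tau is 0 and nothing
   lies before it. *)
have tau0 : tau = 0%R :> R.
  apply/eqP; rewrite eq_le time_ge0 andbT leNgt; apply/negP => t0'.
  have : (u < tau :> R)%R.
    rewrite /u /=; rewrite gt_max t0' /= gt_min; apply/orP; left.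
    by rewrite ltrBlDr ltrDl invr_gt0.
  by rewrite ltNge tu.
rewrite (_ : A n = set0) ?integral_set0 ?lee_fin//.
apply/seteqP; split => // p [_ h].
by have := le_lt_trans (time_ge0 p) h; rewrite tau0 ltxx.
Qed.

(** Right-continuity of the clock at tau. It needs the clock to be finite at a later time q, which
    provides the dominating function; otherwise the clock could pass from a value below m to +oo at
    once. *)
Let K_tau_ge q : (s <= q :> R)%R -> K q < +oo -> m%:E < K q -> m%:E <= K tau.
Proof.
move=> sq Kq mq.
have tq : (tau < q :> R)%R.
  rewrite ltNge; apply/negP => qt; have := le_lt_trans (clockint_nd qt) (le_lt_trans K_tau mq).
  by rewrite ltxx.
pose v n : tm := clamp ((tau : R) + n.+1%:R^-1).
have vt n : (tau < v n :> R)%R.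
  rewrite /v /= lt_max; apply/orP; right; rewrite lt_min ltrDl invr_gt0 ltr0n/=.
  exact: lt_le_trans tq (time_leT q).
have Kv n : m%:E < K (v n).
  rewrite ltNge; apply/negP => Kvm; have := lvl_tau (le_trans s_tau (ltW (vt n))) Kvm.
  by rewrite leNgt vt.
have iq : mu.-integrable (oc s q) (EFin \o k).
  apply/integrableP; split; first exact: mke.
  apply: le_lt_trans Kq; rewrite le_eqVlt; apply/orP; left; apply/eqP.
  by apply: eq_integral => p _; rewrite /= ger0_norm.
pose f_ n (p : tm) : \bar R := (k p * \1_(oc s (v n)) p)%:E.
have mfn n : measurable_fun (oc s q) (f_ n).
  apply/measurable_EFinP/measurable_funTS; apply: measurable_funM => //.
  by apply: measurable_indic; exact: measurable_oc.
pose g p : \bar R := (k p * \1_(oc s tau) p)%:E.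
have mg : measurable_fun (oc s q) g.
  apply/measurable_EFinP/measurable_funTS; apply: measurable_funM => //.
  by apply: measurable_indic; exact: measurable_oc.
have fg : \forall p \ae mu, oc s q p -> f_ ^~ p x @[x --> \oo] --> g p.
  apply: aeW => p [/= sp _]; apply: cvg_near_cst.
  case: (leP (p : R) (tau : R)) => pt.
    apply: nearW => n; rewrite /f_ /g !indicE !mem_set//.
    by split; [exact: sp|exact: (le_trans pt (ltW (vt n)))].
  have pt' : (0 < (p : R) - (tau : R))%R by rewrite subr_gt0.
  apply: filterS (near_inv_lt pt') => n hn; rewrite /f_ /g !indicE !memNset//.
    by move=> [_ /=]; rewrite leNgt pt.
  move=> [_ /=]; apply/negP; rewrite -ltNge; have := @clamp_lip _ T (tau : R) ((tau : R) + n.+1%:R^-1).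
  rewrite clampK lerDl invr_ge0 ler0n => /(_ isT) h.
  by apply: le_lt_trans h _; rewrite addrAC subrr add0r -ltrBrDl.
have fd : \forall p \ae mu, forall n, oc s q p -> `|f_ n p| <= (k p)%:E.
  apply: aeW => p n _; rewrite /f_ lee_fin normrM [`|k p|%R]ger0_norm// ler_piMr//.
  by rewrite indicE ger0_norm// lern1 leq_b1.
have [_ _ H] := dominated_convergence (measurable_oc s q) mfn mg fg iq fd.
have Eg : \int[mu]_(p in oc s q) g p = K tau.
  rewrite /g; transitivity (\int[mu]_(p in oc s q) ((EFin \o k) \_ (oc s tau)) p).
    apply: eq_integral => p _; rewrite patchE indicE.
    by case: (p \in oc s tau); rewrite /= ?mulr1 ?mulr0.
  rewrite -integral_mkcondr (_ : oc s q `&` oc s tau = oc s tau)//.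
  by apply/seteqP; split => p /=; [case|move=> [sp pt]; split => //; split => //;
      apply: le_trans pt (ltW tq)].
rewrite -Eg -(cvg_lim _ H)//; apply: lime_ge; first by apply/cvg_ex; eexists; exact: H.
have qt' : (0 < (q : R) - (tau : R))%R by rewrite subr_gt0.
apply: filterS (near_inv_lt qt') => n hn; apply: le_trans (ltW (Kv n)) _.
have vq : (v n <= q :> R)%R.
  have := @clamp_lip _ T (tau : R) ((tau : R) + n.+1%:R^-1).
  rewrite clampK lerDl invr_ge0 ler0n => /(_ isT) h.
  by apply: le_trans h _; rewrite addrAC subrr add0r -lerBrDl ltW.
rewrite le_eqVlt; apply/orP; left; apply/eqP.
transitivity (\int[mu]_(p in oc s q) ((EFin \o k) \_ (oc s (v n))) p).
  rewrite -integral_mkcondr (_ : oc s q `&` oc s (v n) = oc s (v n))//.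
  by apply/seteqP; split => p /=; [case|move=> [sp pt]; split => //; split => //; apply: le_trans pt vq].
apply: eq_integral => p _; rewrite patchE /f_ indicE.
by case: (p \in oc s (v n)); rewrite /= ?mulr1 ?mulr0.
Qed.

Let lvl_int (t : tm) : (tau <= t :> R)%R -> \int[mu]_(p in oc s t `&` lvl m) (k p)%:E = K tau.
Proof.
move=> tt; rewrite (_ : oc s t `&` lvl m = oc s tau)//.
apply/seteqP; split => p /=.
  by move=> [[/= sp pt] Kp]; split => //; apply: lvl_tau => //; exact: ltW.
move=> [/= sp pt]; split; first by split => //; exact: le_trans tt.
by apply: le_trans K_tau; exact: clockint_nd.
Qed.

Lemma lvl_int_le (t : tm) : \int[mu]_(p in oc s t `&` lvl m) (k p)%:E <= m%:E.
Proof.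
apply: (@le_trans _ _ (\int[mu]_(p in oc s tT `&` lvl m) (k p)%:E)); last first.
  by rewrite (lvl_int (le_tT tau)); exact: K_tau.
apply: ge0_subset_integral => //.
- by apply: measurableI; [exact: measurable_oc|exact: measurable_lvl].
- by apply: measurableI; [exact: measurable_oc|exact: measurable_lvl].
- by move=> p _; rewrite lee_fin.
- by apply: setSI; apply: sub_oc => //; exact: le_tT.
Qed.

(** If the clock at t exceeds m, the integral stops at tau, where left- and right-continuity
    together force the value m. *)
Lemma lvl_intE (t : tm) : (s <= t :> R)%R -> K t < +oo ->
  \int[mu]_(p in oc s t `&` lvl m) (k p)%:E = mine (K t) m%:E.
Proof.
move=> st Kt; case: (leP (K t) m%:E) => h.
  rewrite (_ : oc s t `&` lvl m = oc s t)//.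
  apply/seteqP; split => p /=; first by case.
  by move=> pt; split => //; apply: le_trans h; apply: clockint_nd; case: pt.
have tt : (tau <= t :> R)%R.
  by rewrite leNgt; apply/negP => /lt_tau; rewrite leNgt h.
rewrite lvl_int//; apply/eqP; rewrite eq_le K_tau/=; exact: K_tau_ge h.
Qed.

End sup_level.
End level_sets.

Section localization.
Context {R : realType} {T : {nonneg R}} {E : completePseudoMetricType R}.
Local Notation tm := (time T).
Local Notation Om := (Omega T E).
Variable mu : {finite_measure set tm -> \bar R}.
Hypothesis mu_atom : forall t, mu [set t] = 0%E.
Variables (s : tm) (k : tm * Om -> R).
Hypothesis mk : measurable_fun setT k.
Hypothesis nk : forall q : tm, s <= q :> R -> na q (fun w => k (q, w)).
Hypothesis k0 : forall p, 0 <= k p.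
Implicit Types (q r t : tm) (w : Om) (n : nat) (b : tm * Om -> R).

Definition clockp (p : tm * Om) : \bar R := clockint mu s (fun q => k (q, p.2)) p.1.

(** Indicator of the random interval during which the clock has not passed m; it replaces stopping
    at a hitting time. *)
Definition below (m : R) (p : tm * Om) : R := \1_[set p | (clockp p <= m%:E)%E] p.

Lemma measurable_below m : measurable_fun setT (below m).
Proof.
apply: measurable_indic; rewrite -[X in measurable X]setTI.
apply: emeasurable_fun_infty_c => //.
apply: (@measurable_int_e _ _ _ mu s (EFin \o k)); first exact/measurable_EFinP.
by move=> p /=; rewrite lee_fin.
Qed.

Lemma na_below m q : s <= q :> R -> na q (fun w => below m (q, w)).
Proof.
move=> sq w; rewrite /below !indicE.
have e : clockp (q, stop q w) = clockp (q, w).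
  rewrite /clockp /clockint/=; apply: eq_integral => r /set_mem[/= sr rq].
  by congr EFin; exact: (na_le rq (nk (ltW sr))).
congr (_%:R); congr nat_of_bool.
by apply/idP/idP => /set_mem h; apply/mem_set; rewrite /mkset/= ?e in h *.
Qed.

Lemma below01 m p : 0 <= below m p <= 1.
Proof. by rewrite /below indicE ler0n lern1 leq_b1. Qed.

Lemma below1 m p : (clockp p <= m%:E)%E -> below m p = 1.
Proof. by move=> h; rewrite /below indicE mem_set. Qed.

Lemma below0 m p : (m%:E < clockp p)%E -> below m p = 0.
Proof. by move=> h; rewrite /below indicE memNset//= leNgt h. Qed.

Lemma below_le m m' p : m <= m' -> below m p <= below m' p.
Proof.
move=> mm; case: (leP (clockp p) m%:E) => h.
  by rewrite !below1//; apply: le_trans h _; rewrite lee_fin.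
by rewrite (below0 h); case/andP: (below01 m' p).
Qed.

Lemma clockp_nd q r w : q <= r :> R -> (clockp (q, w) <= clockp (r, w))%E.
Proof. by apply: clockint_nd => //; exact: measurable_time_sec. Qed.

Lemma int_below m t w : 0 <= m ->
  (\int[mu]_(q in oc s t) (below m (q, w) * k (q, w))%:E =
   \int[mu]_(q in oc s t `&` lvl mu s (fun q => k (q, w)) m) (k (q, w))%:E)%E.
Proof.
move=> m0; rewrite [RHS]integral_mkcondr; apply: eq_integral => q _; rewrite patchE.
rewrite /below indicE (_ : (_ \in [set p | _]) = (q \in lvl mu s (fun q => k (q, w)) m)).
  by case: ifPn => h; rewrite /= ?mul1r ?mul0r.
by apply/idP/idP => /set_mem h; apply/mem_set.
Qed.

Lemma int_below_le m t w : 0 <= m ->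
  (\int[mu]_(q in oc s t) (below m (q, w) * k (q, w))%:E <= m%:E)%E.
Proof.
by move=> m0; rewrite int_below//; apply: lvl_int_le => //; exact: measurable_time_sec.
Qed.

(** Below the level m, a process dominated by k has mass at most m along every path, including those
    on which k is not integrable. *)
Lemma fv_trunc (a m : R) b : 0 <= m -> measurable_fun setT b ->
  (forall q, s <= q :> R -> na q (fun w => b (q, w))) -> (forall p, `|b p| <= k p) ->
  fv mu s (`|a| + m) (fun p => a + \int[mu]_(q in oc s p.1) (below m (q, p.2) * b (q, p.2)))
    (fun p => below m p * b p).
Proof.
move=> m0 mb nb bk; apply: fv_int.
- by apply: measurable_funM => //; exact: measurable_below.
- by move=> q sq; apply: na_mul; [exact: na_below|exact: nb].
- move=> w; apply: le_trans (int_below_le tT w m0).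
  have mx (c : tm * Om -> R) : measurable_fun setT c -> measurable_fun (oc s tT) (fun q : tm => (c
      (q, w))%:E).
    by move=> mc; apply/measurable_EFinP/measurable_funTS/measurable_time_sec.
  apply: ge0_le_integral.
  + exact: measurable_oc.
  + by move=> q _; rewrite lee_fin.
  + apply: (mx (fun p => `|below m p * b p|)); apply: measurableT_comp => //.
    by apply: measurable_funM => //; exact: measurable_below.
  + apply: (mx (fun p => below m p * k p)).
    by apply: measurable_funM => //; exact: measurable_below.
  + move=> q _; rewrite lee_fin normrM ger0_norm; last by case/andP: (below01 m (q, w)).
    by apply: ler_wpM2l => //; case/andP: (below01 m (q, w)).
Qed.

(** The clock increases, so being below the level at t means having been below it at all earlier
    times: the truncation is then invisible. *)
Lemma trunc_eq m t w b : below m (t, w) != 0 ->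
  \int[mu]_(q in oc s t) (below m (q, w) * b (q, w)) = \int[mu]_(q in oc s t) b (q, w).
Proof.
move=> h; apply: eq_Rintegral => q /set_mem[_ /= qt]; rewrite below1 ?mul1r//.
rewrite leNgt; apply/negP => h'; move/negP: h; apply.
by rewrite below0//; apply: lt_le_trans h' _; exact: clockp_nd.
Qed.

(* chi decreases from 1 to 0 while int k dmu goes from n to n + 1: a localization
   which is continuous in time, and thus requires no stopping time. *)
Definition chi' n (p : tm * Om) : R := - ((below n.+1%:R p - below n%:R p) * k p).
Definition chi n (p : tm * Om) : R := 1 + \int[mu]_(q in oc s p.1) chi' n (q, p.2).

Lemma chi'_le0 n p : chi' n p <= 0.
Proof. by rewrite oppr_le0 mulr_ge0// subr_ge0 below_le// ler_nat. Qed.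

Lemma chi'_abs n p : `|chi' n p| <= below n.+1%:R p * k p.
Proof.
rewrite normrN ger0_norm; last by rewrite mulr_ge0// subr_ge0 below_le// ler_nat.
by rewrite ler_wpM2r// gerBl; case/andP: (below01 n%:R p).
Qed.

Lemma measurable_chi' n : measurable_fun setT (chi' n).
Proof.
apply: measurable_funN; apply: measurable_funM => //.
by apply: measurable_funB; exact: measurable_below.
Qed.

Lemma fv_chi n : fv mu s (1 + n.+1%:R) (chi n) (chi' n).
Proof.
rewrite -[X in X + _](@normr1 R); apply: fv_int.
- exact: measurable_chi'.
- by move=> q sq w; rewrite /chi' nk// !na_below.
- move=> w; apply: le_trans (@int_below_le n.+1%:R tT w _); last exact: ler0n.
  have mx (c : tm * Om -> R) : measurable_fun setT c -> measurable_fun (oc s tT) (fun q : tm => (c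
      (q, w))%:E).
    by move=> mc; apply/measurable_EFinP/measurable_funTS/measurable_time_sec.
  apply: ge0_le_integral.
  + exact: measurable_oc.
  + by move=> q _; rewrite lee_fin.
  + apply: (mx (fun p => `|chi' n p|)); apply: measurableT_comp => //.
    exact: measurable_chi'.
  + apply: (mx (fun p => below n.+1%:R p * k p)).
    by apply: measurable_funM => //; exact: measurable_below.
  + by move=> q _; rewrite lee_fin chi'_abs.
Qed.

Lemma chi_s n w : chi n (s, w) = 1.
Proof. by rewrite /chi/= oc0 Rintegral_set0 addr0. Qed.

(** Integrating k while the clock is at most m gives min(K, m), with K the clock at t; the integrals
    at the levels n + 1 and n are subtracted. *)
Lemma chiE n t w : s <= t :> R -> (clockp (tT, w) < +oo)%E ->
  chi n (t, w) = 1 - (Num.min (fine (clockp (t, w))) n.+1%:R - Num.min (fine (clockp (t, w))) n%:R).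
Proof.
move=> st KT.
have Kt : (clockp (t, w) < +oo)%E by apply: le_lt_trans KT; apply: clockp_nd; exact: le_tT.
have Kf : clockp (t, w) \is a fin_num by rewrite ge0_fin_numE//; exact: clockint_ge0.
have E1 m : 0 <= m -> \int[mu]_(q in oc s t) (below m (q, w) * k (q,
    w)) = Num.min (fine (clockp (t, w))) m.
  move=> m0; rewrite /Rintegral int_below// lvl_intE//; last exact: measurable_time_sec.
  rewrite -/(clockp (t, w)) -{1}(fineK Kf).
  by rewrite /Order.min lte_fin; case: ifP.
have I m : 0 <= m -> mu.-integrable (oc s t) (EFin \o (fun q => below m (q, w) * k (q, w))).
  move=> m0; apply/integrableP; split.
    apply/measurable_EFinP/measurable_funTS; apply: measurable_funM.
      by apply: (measurable_time_sec w (F := below m)); exact: measurable_below.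
    exact: measurable_time_sec.
  apply: le_lt_trans (ltry m); apply: le_trans (int_below_le t w m0).
  rewrite le_eqVlt; apply/orP; left; apply/eqP; apply: eq_integral => q _.
  by rewrite /= ger0_norm// mulr_ge0//; case/andP: (below01 m (q, w)).
rewrite /chi/=; congr (_ + _); rewrite -!E1 ?ler0n// -RintegralB ?I ?ler0n//; last exact: measurable_oc.
have i := integrableB_R (measurable_oc s t) (I _ (ler0n _ n.+1)) (I _ (ler0n _ n)).
rewrite -[RHS]mulN1r -RintegralZl//; last exact: measurable_oc.
by apply: eq_Rintegral => q _; rewrite /chi'; ring.
Qed.

Lemma chi01 n t w : s <= t :> R -> (clockp (tT, w) < +oo)%E -> 0 <= chi n (t, w) <= 1.
Proof.
move=> st KT; rewrite chiE//; set x := fine _.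
have nn : (n%:R : R) + 1 = n.+1%:R by rewrite -natr1.
by rewrite -nn; case: (leP x n%:R) => h1; case: (leP x (n%:R + 1)) => h2; lra.
Qed.

(** Once the clock has passed n + 1 the weight has reached 0. Hence chi times a process truncated at
    level n + 1 equals chi times the process itself. *)
Lemma chi_below n t w : s <= t :> R -> (clockp (tT, w) < +oo)%E ->
  chi n (t, w) != 0 -> below n.+1%:R (t, w) != 0.
Proof.
move=> st KT; apply: contra => h.
have Kt : (clockp (t, w) < +oo)%E by apply: le_lt_trans KT; apply: clockp_nd; exact: le_tT.
have Kf : clockp (t, w) \is a fin_num by rewrite ge0_fin_numE//; exact: clockint_ge0.
have Kn : n.+1%:R < fine (clockp (t, w)).
  rewrite ltNge; apply/negP => h1; move: h; rewrite below1 ?oner_eq0//.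
  by rewrite -(fineK Kf) lee_fin.
rewrite chiE// min_r ?ltW// min_r; first by rewrite -natr1; apply/eqP; lra.
by apply: le_trans (ltW Kn); rewrite ler_nat.
Qed.

Lemma chi'_below n p : chi' n p != 0 -> below n.+1%:R p != 0.
Proof.
apply: contra => /eqP h; have := chi'_abs n p; rewrite h mul0r normr_le0.
by [].
Qed.

Lemma chi_cvg t w : s <= t :> R -> (clockp (tT, w) < +oo)%E ->
  \forall n \near \oo, chi n (t, w) = 1.
Proof.
move=> st KT; near=> n; rewrite chiE//.
have h : fine (clockp (t, w)) <= n%:R by near: n; exact: nbhs_infty_ger.
rewrite min_l; last by apply: le_trans h _; rewrite ler_nat.
by rewrite min_l// subrr subr0.
Unshelve. all: by end_near. Qed.

End localization.

(** * The energy estimate *)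

Section energy.
Context {R : realType} {T : {nonneg R}} {E : completePseudoMetricType R}.
Local Notation tm := (time T).
Local Notation Om := (Omega T E).
Variables (Pr : probability Om R) (mu : {finite_measure set tm -> \bar R}).
Hypothesis mu_atom : forall t, mu [set t] = 0%E.
Implicit Types (s q r t : tm) (F G D S L M N d e : tm * Om -> R) (X Y xi : Om -> R).
Local Notation EE := (EE Pr).
Local Notation iint := (iint Pr mu).
Local Notation ig := (ig Pr mu).
Local Notation igP := (igP Pr).
Local Notation amart := (amart Pr).
Local Notation fv := (fv mu).
Local Notation drift := (drift Pr mu).

Lemma fv_iint s c D d r t X : fv s c D d -> s <= r :> R -> r <= t :> R ->
  measurable_fun setT X -> igP X ->
  [/\ igP (fun w => X w * D (t, w)), igP (fun w => X w * D (r, w)),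
    ig r t (fun p => X p.2 * d p) &
    EE (fun w => X w * D (t, w)) - EE (fun w => X w * D (r, w)) = iint r t (fun p => X p.2 * d p)].
Proof.
move=> h sr rt mX iX; have st := le_trans sr rt.
have i (u : tm) : (s : R) <= (u : R) -> igP (fun w => X w * D (u, w)).
  move=> su; apply: (eq_igP (X := fun w => D (u, w) * X w)); first by move=> w; rewrite mulrC.
  apply: (igPM (k := c)) => //; first by apply: measurable_sec; exact: (fv_mD h).
  by move=> w; exact: (fv_bd h).
have id : ig r t (fun p => X p.2 * d p) by exact: (ig_fv h).
split => //; [exact: i|exact: i|].
rewrite iint_EE// -EEB ?i//; apply: eq_EE => w.
have -> : \int[mu]_(q in oc r t) (X (q, w).2 * d (q, w)) = X w * \int[mu]_(q in oc r t) d (q, w).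
  exact: (RintegralZl (X w) (measurable_oc r t) (fv_ipath h t w sr)).
by rewrite (fv_incr h w sr rt); ring.
Qed.

Lemma fv_restrict s r c D d : s <= r :> R -> fv s c D d -> fv r c D d.
Proof.
move=> sr h; split.
- exact: (fv_mD h).
- exact: (fv_md h).
- by move=> q rq; apply: (fv_nD h); exact: le_trans rq.
- by move=> q rq; apply: (fv_nd h); exact: le_trans rq.
- by move=> t w rt; apply: (fv_bd h); exact: le_trans rt.
- move=> w; apply: le_trans (fv_var h w); apply: ge0_subset_integral => //.
  + exact: measurable_oc.
  + exact: measurable_oc.
  + apply/measurable_EFinP/measurable_funTS/measurableT_comp => //.
    exact: (measurable_time_sec w (fv_md h)).
  + by apply: sub_oc.
- by move=> t w rt; exact: (fv_incr h).
Qed.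

Lemma mart_restrict s r M : s <= r :> R -> amart s M -> amart r M.
Proof.
move=> sr h; split.
- exact: (mart_meas h).
- by move=> q rq; apply: (mart_na h); exact: le_trans rq.
- by move=> q rq; apply: (mart_ig h); exact: le_trans rq.
- by move=> q t A rq qt; apply: (mart_eq h) => //; exact: le_trans rq.
Qed.

Lemma igP_mul X Y : measurable_fun setT X -> measurable_fun setT Y ->
  igP (fun w => X w ^+ 2) -> igP (fun w => Y w ^+ 2) -> igP (fun w => X w * Y w).
Proof.
move=> mX mY iX iY; apply: (integrable_domD measurableT _ iX iY).
  exact: measurable_funM.
move=> w _; rewrite normrM ![`|_ ^+ 2|]ger0_norm ?sqr_ge0//.
rewrite -[X w ^+ 2]real_normK ?num_real// -[Y w ^+ 2]real_normK ?num_real//.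
by have := normr_ge0 (X w); have := normr_ge0 (Y w); nra.
Qed.

Definition sqint s M := forall t, s <= t :> R -> igP (fun w => M (t, w) ^+ 2).

(** The difference of the two sides is the expectation of (M_t - M_q)^2 over A, by orthogonality of
    the increment to what is known at q. *)
Lemma mart_sq_le s M q t (A : set Om) : amart s M -> sqint s M ->
  s <= q :> R -> q <= t :> R -> measurable A -> na q A ->
  (\int[Pr]_(w in A) (`|M (q, w) ^+ 2|)%:E <= \int[Pr]_(w in A) (`|M (t, w) ^+ 2|)%:E)%E.
Proof.
move=> mM iM sq qt mA nA; have st := le_trans sq qt.
have mMq := measurable_sec q (mart_meas mM).
have mMt := measurable_sec t (mart_meas mM).
have mI : measurable_fun setT (\1_A : Om -> R) by exact: measurable_indic.
have I1 w : `|\1_A w| <= 1 :> R by rewrite indicE ger0_norm// lern1 leq_b1.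
have nI : na q (\1_A : Om -> R).
  move=> w; rewrite !indicE; congr (_%:R); congr nat_of_bool.
  by apply/idP/idP => /set_mem h; apply/mem_set; move: h; rewrite nA.
have e u : (\int[Pr]_(w in A) (`|M (u, w) ^+ 2|)%:E = \int[Pr]_w (\1_A w * M (u, w) ^+ 2)%:E)%E.
  rewrite integral_mkcond; apply: eq_integral => w _; rewrite patchE indicE.
  by case: (w \in A); rewrite ?mul1r ?mul0r// ger0_norm// sqr_ge0.
have it := igPM mI I1 (iM t st); have iq := igPM mI I1 (iM q sq).
have iqt : igP (fun w => (\1_A w * M (q, w)) * M (t, w)).
  have := igPM mI I1 (igP_mul mMq mMt (iM q sq) (iM t st)).
  by apply: eq_igP => w; rewrite mulrA.
have [iqq eqq] := mart_fun mM sq qt (measurable_funM mI mMq) (na_mul nI (mart_na mM sq)) iqt.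
rewrite !e -(fineK (integrable_fin_num measurableT it)) -(fineK (integrable_fin_num measurableT iq)).
rewrite lee_fin -subr_ge0 -[X in 0 <= X - _]/(EE (fun w => \1_A w * M (t,
    w) ^+ 2)) -[X in 0 <= _ - X]/(EE (fun w => \1_A w * M (q, w) ^+ 2)).
have -> : EE (fun w => \1_A w * M (t, w) ^+ 2) - EE (fun w => \1_A w * M (q, w) ^+ 2) =
    EE (fun w => \1_A w * (M (t, w) - M (q, w)) ^+ 2).
  have e1 : EE (fun w => \1_A w * M (q, w) * M (t, w)) = EE (fun w => \1_A w * M (q, w) ^+ 2).
    rewrite [LHS]eqq; apply: eq_EE => w; by rewrite expr2 mulrA.
  transitivity (EE (fun w => \1_A w * M (t, w) ^+ 2) - EE (fun w => \1_A w * M (q, w) * M (t, w))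
     - (EE (fun w => \1_A w * M (q, w) * M (t, w)) - EE (fun w => \1_A w * M (q, w) ^+ 2))).
    by rewrite e1 subrr subr0.
  rewrite -!EEB//; first by apply: eq_EE => w; ring.
  - exact: igPB.
  - exact: igPB.
by apply: Rintegral_ge0 => w _; rewrite mulr_ge0 ?sqr_ge0.
Qed.

(* Conditional Jensen for the randomized time with weights chi_t and -chi'. *)
Section jensen.
Variables (r t : tm) (c : R) (D d M : tm * Om -> R).
Hypotheses (rt : r <= t :> R) (hD : fv r c D d) (mM : amart r M) (sM : sqint r M).

(** The square of M is a submartingale, so M_q^2 under the adapted weight |d| may be replaced by
    M_t^2, for which the bounded variation of D suffices. *)
Lemma ig_sq r' : r <= r' :> R -> r' <= t :> R -> ig r' t (fun p => d p * M p ^+ 2).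
Proof.
move=> rr rt'.
have mMt := measurable_sec t (mart_meas mM).
have mS : measurable_fun setT (fun p => M p ^+ 2) by apply: measurable_funX; exact: (mart_meas mM).
have mSt : measurable_fun setT (fun w => M (t, w) ^+ 2) by exact: measurable_funX.
apply/integrableP; split.
  by apply/measurable_EFinP/measurable_funTS/measurable_funM => //; exact: (fv_md hD).
under eq_integral do rewrite /= normrM.
apply: le_lt_trans.
  apply: (@na_le_iint _ _ _ Pr mu r' t (fun p => M p ^+ 2) (fun w => M (t, w) ^+ 2) d) => //.
  - exact: (fv_md hD).
  - by move=> q [/= rq qt]; apply: (fv_nd hD); exact: le_trans rr (ltW rq).
  - by move=> q A [/= rq qt] mA nA; apply: mart_sq_le mM sM _ _ _ _ => //; exact: le_trans rr (ltW rq).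
have /integrableP[_] := ig_fv hD t rr mSt (sM rt).
move=> h; apply: le_lt_trans h; rewrite le_eqVlt; apply/orP; left; apply/eqP.
by apply: eq_integral => p _; rewrite -normrM mulrC.
Qed.

Lemma jensen_fv : (\forall w \ae Pr, 0 <= D (t, w)) -> (forall p, d p <= 0) ->
  0 <= EE (fun w => D (t, w) * M (t, w) ^+ 2) - EE (fun w => D (r, w) * M (r, w) ^+ 2)
    - iint r t (fun p => d p * M p ^+ 2).
Proof.
move=> D0 d0.
have mMr := measurable_sec r (mart_meas mM).
have mMt := measurable_sec t (mart_meas mM).
have mMS : measurable_fun setT (fun w => M (r, w) ^+ 2) by exact: measurable_funX.
have mDt := measurable_sec t (fv_mD hD).
have Dc (u : tm) w : (r : R) <= (u : R) -> `|D (u, w)| <= c by move=> ru; exact: (fv_bd hD).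
have iM : igP (fun w => D (t, w) * M (t, w) ^+ 2).
  by apply: (igPM (k := c)) => [//|w|]; [exact: Dc|exact: sM].
have irt := igP_mul mMr mMt (sM (lexx _)) (sM rt).
have [i1 i2 i3 e1] := mart_fv hD mM (lexx _) rt mMr (mart_na mM (lexx _)) irt.
have [j1 j2 j3 e2] := fv_iint hD (lexx _) rt mMS (sM (lexx _)).
have i4 := ig_sq (lexx _) rt.
(* The squares of M - M_r under the two nonnegative weights D_t and -d are the quantities whose
   positivity is used; P2 is the second one. *)
have P1 : 0 <= EE (fun w => D (t, w) * (M (t, w) - M (r, w)) ^+ 2).
  have mF : measurable_fun setT (fun w => D (t, w) * (M (t, w) - M (r, w)) ^+ 2).
    by apply: measurable_funM => //; apply: measurable_funX; exact: measurable_funB.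
  have -> : EE (fun w => D (t, w) * (M (t, w) - M (r, w)) ^+ 2) =
      EE (fun w => `|D (t, w) * (M (t, w) - M (r, w)) ^+ 2|).
    apply: Rint_eq_integral; apply: ae_eq_integral => //.
    - exact/measurable_EFinP.
    - by apply/measurable_EFinP; exact: measurableT_comp.
    - by apply: filterS D0 => w h _; rewrite ger0_norm// mulr_ge0// sqr_ge0.
  exact: Rintegral_ge0.
have P2 : 0 <= - iint r t (fun p => d p * (M p - M (r, p.2)) ^+ 2).
  have -> : iint r t (fun p => d p * (M p - M (r, p.2)) ^+ 2) =
     - iint r t (fun p => (- d p) * (M p - M (r, p.2)) ^+ 2).
    rewrite -mulN1r -iintZ; last first.
      apply: (@eq_ig _ _ _ _ _ _ _ (fun p => - (d p * M p ^+ 2 - (2 * (M (r,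
          p.2) * (d p * M p)) - M (r, p.2) ^+ 2 * d p)))).
        by move=> p; ring.
      apply: (@eq_ig _ _ _ _ _ _ _ (fun p => -1 * (d p * M p ^+ 2 - (2 * (M (r,
          p.2) * (d p * M p)) - M (r, p.2) ^+ 2 * d p)))).
        by move=> p; ring.
      by apply: igZ; apply: igB => //; apply: igB => //; exact: igZ.
    by apply: eq_iint => p; ring.
  rewrite opprK; apply: Rintegral_ge0 => p _.
  by rewrite mulr_ge0 ?sqr_ge0// oppr_ge0.
have E1 : EE (fun w => D (t, w) * (M (t, w) - M (r, w)) ^+ 2) =
    EE (fun w => D (t, w) * M (t, w) ^+ 2) -
    (EE (fun w => M (r, w) * (D (t, w) * M (t, w))) + EE (fun w => M (r, w) * (D (t, w) * M (t, w)))
     - EE (fun w => M (r, w) ^+ 2 * D (t, w))).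
  have i5 := igPD i1 i1; have i6 := igPB i5 j1.
  by rewrite -EED// -EEB// -EEB//; apply: eq_EE => w; ring.
have E2 : iint r t (fun p => d p * (M p - M (r, p.2)) ^+ 2) =
    iint r t (fun p => d p * M p ^+ 2) -
    (iint r t (fun p => M (r, p.2) * (d p * M p)) + iint r t (fun p => M (r, p.2) * (d p * M p))
     - iint r t (fun p => M (r, p.2) ^+ 2 * d p)).
  have i5 := igD i3 i3; have i6 := igB i5 j3.
  by rewrite -iintD// -iintB// -iintB//; apply: eq_iint => p; ring.
have E3 : EE (fun w => M (r, w) * (D (r, w) * M (r, w))) = EE (fun w => D (r, w) * M (r, w) ^+ 2).
  by apply: eq_EE => w; ring.
have E4 : EE (fun w => M (r, w) ^+ 2 * D (r, w)) = EE (fun w => D (r, w) * M (r, w) ^+ 2).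
  by apply: eq_EE => w; ring.
(* In P1 + P2 the cross terms recombine by e1 into -2 D_r M_r^2 and the terms in M_r^2 by e2 into
   D_r M_r^2, which leaves the claimed difference. *)
move: P1 P2; rewrite E1 E2 -e1 -e2 E3 E4; lra.
Qed.

End jensen.
End energy.

(** * Density of step processes *)

Section step_processes.
Context {R : realType} {T : {nonneg R}} {E : completePseudoMetricType R}.
Local Notation tm := (time T).
Local Notation Om := (Omega T E).
Variables (Pr : probability Om R) (mu : {finite_measure set tm -> \bar R}).
Variables (s : tm) (nn : nat) (h : nat -> Om -> R) (K : R) (F : tm * Om -> R).
Hypotheses (mh : forall j, measurable_fun setT (h j)) (hK : forall j (w : Om), `|h j w| <= K).

Lemma stepf_bd p : `|stepf s nn h p| <= K.
Proof.
case: p => q w; case: (pselect (oc s tT q)) => [sq|nq].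
  by have [k _ kq] := cell_exists nn sq; rewrite (stepfE _ _ kq).
by rewrite stepf_out// normr0; apply: le_trans (hK 0%N point).
Qed.

Lemma ig_step : ig Pr mu s tT F -> ig Pr mu s tT (fun p => stepf s nn h p * F p).
Proof.
move=> iF; apply: (integrable_bnd (measurable_cyl s tT) _ iF (c := K)).
  by apply: measurable_funTS; exact: measurable_stepf.
by move=> p _; exact: stepf_bd.
Qed.

Lemma ig_step2 : ig Pr mu s tT F -> ig Pr mu s tT (fun p => stepf s nn h p ^+ 2 * F p).
Proof.
move=> iF; apply: (integrable_bnd (measurable_cyl s tT) _ iF (c := K ^+ 2)).
  by apply: measurable_funTS; apply: measurable_funX; exact: measurable_stepf.
move=> p _; rewrite normrX ler_pXn2r ?nnegrE//; first exact: stepf_bd.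
by apply: le_trans (stepf_bd p).
Qed.

End step_processes.

Section density.
Context {R : realType} {T : {nonneg R}} {E : completePseudoMetricType R}.
Local Notation tm := (time T).
Local Notation Om := (Omega T E).
Local Notation bE := (borel E).

(** Generators stable under intersection whose indicator is a left-continuous function of time times
    the indicator of an open set: the form to which sampling at left endpoints applies. *)
Lemma measurable_time_states :
  @measurable _ (tm * bE)%type = <<s [set A : set (tm * bE) | exists (t : tm) (O : set E),
     open O /\ A = [set p : tm * bE | (p.1 : R) <= (t : R) /\ O p.2]] >>.
Proof.
set G := [set A | _].
have GM : G `<=` @measurable _ (tm * bE)%type.
  move=> _ [t [U [oU ->]]].
  apply: (@measurableI _ _ [set p : tm * bE | (p.1 : R) <= (t : R)] [set p : tm * bE | U p.2]).
    exact: measurable_time_le.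
  rewrite -[X in measurable X]setTI; apply: measurable_snd => //; exact: sub_gen_smallest.
apply/seteqP; split; last by apply: smallest_sub GM; exact: sigma_algebra_measurable.
have m1 : measurable_fun [set: g_sigma_algebraType G] (fst : tm * bE -> tm).
  apply: measurable_to_time.
  apply: (@measurability _ _ (g_sigma_algebraType G) _ setT _ _ (RGenInftyO.measurableE R)).
  move=> _ [_ [x ->] <-]; rewrite setTI.
  have [x0|x0] := leP x 0.
    rewrite (_ : _ @^-1` _ = set0); first exact: measurable0.
    apply/seteqP; split => // -[q y] /=; rewrite in_itv/= => h.
    by have := lt_le_trans h x0; rewrite ltNge time_ge0.
  rewrite (_ : _ @^-1` _ = \bigcup_n [set p : tm * bE | (p.1 : R) <= (clamp (T := T) (x -
      n.+1%:R^-1) : R) /\ p.1 < x :> R]).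
    apply: bigcupT_measurable => n; have [h|h] := ltP (clamp (T := T) (x - n.+1%:R^-1) : R) x.
      apply: sub_gen_smallest; exists (clamp (x - n.+1%:R^-1)), setT; split; first exact: openT.
      by apply/seteqP; split => p /= [a b]; split => //; exact: le_lt_trans h.
    exfalso; move: h; rewrite leNgt => /negP; apply => /=.
    by rewrite gt_max x0/= gt_min ltrBlDr ltrDl invr_gt0 ltr0n.
  apply/seteqP; split => -[q y] /=; rewrite in_itv/=; last by case=> n _ [].
  move=> qx; have xq : 0 < x - (q : R) by rewrite subr_gt0.
  have [N _ /(_ N (leqnn N)) hN] := near_inv_lt xq.
  exists N => //; split => //; rewrite -[X in X <= _](congr1 (@Defs.tval _ _) (clampK q)).
  by apply: clamp_nd; rewrite lerBrDr addrC -lerBrDr ltW.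
have m2 : measurable_fun [set: g_sigma_algebraType G] (snd : tm * bE -> bE).
  apply: (@measurability _ _ (g_sigma_algebraType G) bE setT _ open) => //.
  move=> _ [U oU <-]; rewrite setTI; apply: sub_gen_smallest; exists tT, U; split => //.
  by apply/seteqP; split => p /=; [split => //; exact: le_tT|case].
have m : measurable_fun [set: g_sigma_algebraType G] (fun p : tm * bE => (p.1, p.2)).
  exact: measurable_fun_pair.
move=> A mA; have := m measurableT A mA; rewrite setTI.
by rewrite (_ : _ @^-1` A = A)//; apply/seteqP; split => -[q y].
Qed.

Lemma dct_Rintegral d (X : measurableType d) (nu : {measure set X -> \bar R}) (A : set X)
    (u_ : nat -> X -> R) (u g : X -> R) : measurable A ->
  (forall m, measurable_fun A (u_ m)) -> measurable_fun A u ->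
  (\forall x \ae nu, A x -> u_ m x @[m --> \oo] --> u x) ->
  nu.-integrable A (EFin \o g) -> (\forall x \ae nu, forall m, A x -> `|u_ m x| <= g x) ->
  nu.-integrable A (EFin \o u) /\ \int[nu]_(x in A) u_ m x @[m --> \oo] --> \int[nu]_(x in A) u x.
Proof.
move=> mA mu_ mu cv ig ug.
have me (f : X -> R) : measurable_fun A f -> measurable_fun A (fun x => (f x)%:E).
  by move/measurable_EFinP.
have [] := @dominated_convergence _ X R nu A mA (fun m x => (u_ m x)%:E) (fun x => (u x)%:E)
  (fun x => (g x)%:E) (fun m => me _ (mu_ m)) (me _ mu) _ ig.
- apply: filterS cv => x h Ax; apply: cvg_EFin; first exact: nearW.
  exact: h.
- by apply: filterS ug => x ug m Ax; rewrite /= lee_fin; exact: ug.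
move=> iu _ H.
split => //; apply: fine_cvg; rewrite fineK//; exact: integrable_fin_num iu.
Qed.

Variables (Pr : probability Om R) (mu : {finite_measure set tm -> \bar R}).
Hypothesis mu_atom : forall t, mu [set t] = 0%E.
Variables (s : tm) (e : tm * Om -> R).
Hypotheses (e0 : forall p, 0 <= e p) (ie : ig Pr mu s tT e).
Implicit Types (q r t : tm) (F G H : tm * Om -> R).
Local Notation iint := (iint Pr mu).
Local Notation ig := (ig Pr mu).
Local Notation cylT := (cyl (E := E) s tT).

Definition bfun F := measurable_fun setT F /\ exists b : R, forall p, `|F p| <= b.
Definition adm nn (h : nat -> Om -> R) (K : R) := [/\ forall j, measurable_fun setT (h j),
  forall j, na (grid s nn j) (h j) & forall j (w : Om), `|h j w| <= K].
Definition dist F G := iint s tT (fun p => `|F p - G p| * e p).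
(** The approximation is asked on all fine enough grids, not just on one, so that two approximations
    can be taken on a common grid and added. *)
Definition apx F := bfun F /\ forall eps : R, 0 < eps ->
  \forall nn \near \oo, exists h K, adm nn h K /\ dist (stepf s nn h) F <= eps.

Lemma bfun_step nn h K : adm nn h K -> bfun (stepf s nn h).
Proof.
move=> [mh _ hK]; split; first exact: measurable_stepf.
by exists K => p; exact: stepf_bd.
Qed.

Lemma bfun_lin (a : R) F G : bfun F -> bfun G -> bfun (fun p => a * F p + G p).
Proof.
move=> [mF [b hb]] [mG [c hc]]; split; first by apply: measurable_funD => //; exact: measurable_funM.
exists (`|a| * b + c) => p; apply: le_trans (ler_normD _ _) _.
by rewrite normrM lerD// ler_wpM2l.
Qed.

Lemma ig_dist F G : bfun F -> bfun G -> ig s tT (fun p => `|F p - G p| * e p).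
Proof.
move=> [mF [b hb]] [mG [c hc]].
apply: (integrable_bnd (measurable_cyl s tT) _ ie (c := b + c)).
  by apply: measurable_funTS; apply: measurableT_comp => //; exact: measurable_funB.
move=> p _; rewrite normr_id; apply: le_trans (ler_normB _ _) _; exact: lerD.
Qed.

Lemma le_iint r t F G : ig r t F -> ig r t G -> (forall p, F p <= G p) -> iint r t F <= iint r t G.
Proof. by move=> iF iG FG; apply: le_Rintegral => //; exact: measurable_cyl. Qed.

Lemma dist_tri F G H : bfun F -> bfun G -> bfun H -> dist F H <= dist F G + dist G H.
Proof.
move=> bF bG bH; rewrite -iintD; [|exact: ig_dist|exact: ig_dist].
apply: le_iint; [exact: ig_dist|by apply: igD; exact: ig_dist|].
move=> p; rewrite -mulrDl ler_wpM2r//.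
by rewrite (_ : F p - H p = (F p - G p) + (G p - H p)) ?ler_normD//; ring.
Qed.

Lemma dist_lin (a : R) F G F' G' : bfun F -> bfun G -> bfun F' -> bfun G' ->
  dist (fun p => a * F p + G p) (fun p => a * F' p + G' p) <= `|a| * dist F F' + dist G G'.
Proof.
move=> bF bG bF' bG'; rewrite -iintZ; last exact: ig_dist.
rewrite -iintD; [|by apply: igZ; exact: ig_dist|exact: ig_dist].
apply: le_iint; [|by apply: igD; [apply: igZ|]; exact: ig_dist|].
  by apply: ig_dist; exact: bfun_lin.
move=> p; rewrite mulrA -mulrDl ler_wpM2r// -normrM.
by rewrite (_ : a * F p + G p - _ = a * (F p - F' p) + (G p - G' p)) ?ler_normD//; ring.
Qed.

Lemma restr_ig r t F : ig r t F -> (mu \x Pr)%E.-integrable setT (EFin \o (F \_ (cyl r t))).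
Proof. by rewrite -restrict_EFin; move/(integrable_mkcond _ (measurable_cyl r t)). Qed.

Lemma patch_cyl r t F q w : (F \_ (cyl r t)) (q, w) = ((fun q => F (q, w)) \_ (oc r t)) q.
Proof.
rewrite !patchE (_ : (_ \in cyl r t) = (q \in oc r t))//.
by apply/idP/idP => /set_mem h; apply/mem_set => //; case: h.
Qed.

(** Dominated convergence twice, in time along each path and then over the paths. Convergence is
    thus needed only for almost every time of a given path, which is what left sampling provides. *)
Lemma dist_cvg (F_ : nat -> tm * Om -> R) F (b : R) :
  (forall m, measurable_fun setT (F_ m)) -> measurable_fun setT F ->
  (forall m p, `|F_ m p| <= b) -> (forall p, `|F p| <= b) ->
  (forall w, \forall q \ae mu, oc s tT q -> F_ m (q, w) @[m --> \oo] --> F (q, w)) ->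
  dist (F_ m) F @[m --> \oo] --> 0.
Proof.
move=> mF_ mF hb hF cv.
have b0 : 0 <= b by apply: le_trans (hF point).
have bF : bfun F by split => //; exists b.
have bF_ m : bfun (F_ m) by split => //; exists b; exact: hb.
have iew : \forall w \ae Pr, mu.-integrable (oc s tT) (fun q => (e (q, w))%:E).
  have := @ae_integrable2 _ _ _ _ _ mu Pr (EFin \o (e \_ cylT)) (restr_ig ie).
  apply: filterS => w /= H; apply/(integrable_mkcond _ (measurable_oc s tT)); move: H.
  by congr (integrable _ _ _); apply/funext => q /=; rewrite patch_cyl patchE /patch; case: ifP.
have mdm m w : measurable_fun (oc s tT) (fun q : tm => `|F_ m (q, w) - F (q, w)|).
  apply/measurable_funTS/measurableT_comp => //.
  by apply: measurable_funB; exact: measurable_time_sec.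
have key w : mu.-integrable (oc s tT) (fun q => (e (q, w))%:E) ->
    \int[mu]_(q in oc s tT) (`|F_ m (q, w) - F (q, w)| * e (q, w)) @[m --> \oo] --> (0 : R).
  move=> iw; have mew : measurable_fun (oc s tT) (fun q : tm => e (q, w)).
    by apply/measurable_EFinP; exact: (measurable_int _ iw).
  have igw : mu.-integrable (oc s tT) (EFin \o (fun q => (b + b) * e (q, w))).
    by apply: (@integrable_bnd _ _ _ _ _ (cst (b + b)) _ `|b + b| (measurable_oc _ _) _ iw).
  have [] := @dct_Rintegral _ _ mu (oc s tT) (fun m q => `|F_ m (q, w) - F (q, w)| * e (q, w)) (fun=> 0)
    (fun q => (b + b) * e (q, w)) (measurable_oc s tT) _ (measurable_cst _) _ igw _.
  - by move=> m; apply: measurable_funM => //; exact: mdm.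
  - apply: filterS (cv w) => q h cq; rewrite -[X in _ --> X](mul0r (e (q, w))); apply: cvgMl.
    rewrite -[X in _ --> X](normr0 R) -(subrr (F (q, w))); apply: cvg_norm.
    by apply: cvgB; [exact: h|exact: cvg_cst].
  - apply: aeW => q m _; rewrite ger0_norm ?mulr_ge0// ler_wpM2r//.
    by apply: le_trans (ler_normB _ _) _; apply: lerD.
  by move=> _; rewrite Rintegral_cst ?mul0r//; exact: measurable_oc.
have ib : ig s tT (fun p => (b + b) * e p) by exact: igZ.
have igd m := ig_dist (bF_ m) bF.
have [] := @dct_Rintegral _ _ Pr setT (fun m w => \int[mu]_(q in oc s tT) (`|F_ m (q, w) - F (q,
    w)| * e (q, w)))
  (fun=> 0) (fun w => \int[mu]_(q in oc s tT) ((b + b) * e (q,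
      w))) measurableT _ (measurable_cst _) _ (igP_int ib) _.
- by move=> m; apply/measurable_EFinP; exact: (measurable_int _ (igP_int (igd m))).
- by apply: filterS iew => w /key.
- apply: filterS iew => w iw m _; rewrite ger0_norm; last by apply: Rintegral_ge0 => q _;
    rewrite mulr_ge0.
  have igw : mu.-integrable (oc s tT) (EFin \o (fun q => (b + b) * e (q, w))).
    by apply: (@integrable_bnd _ _ _ _ _ (cst (b + b)) _ `|b + b| (measurable_oc _ _) _ iw).
  have le q : `|F_ m (q, w) - F (q, w)| <= b + b by apply: le_trans (ler_normB _ _) _; exact: lerD.
  apply: le_Rintegral => //; first exact: measurable_oc.
    apply: (@integrable_bnd _ _ _ _ _ (fun q => `|F_ m (q, w) - F (q,
        w)|) _ (b + b) (measurable_oc _ _) (mdm m w) iw) => q _.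
    by rewrite normr_id.
  by move=> q _; rewrite ler_wpM2r.
move=> _; rewrite Rintegral_cst// mul0r; apply: cvg_trans.
by apply: near_eq_cvg; apply: nearW => m; rewrite /dist iint_EE.
Qed.

Lemma apx_lin (a : R) F G : apx F -> apx G -> apx (fun p => a * F p + G p).
Proof.
move=> [bF aF] [bG aG]; split => [|eps eps0]; first exact: bfun_lin.
have d0 : 0 < eps / (`|a| + 1) by rewrite divr_gt0// ltr_wpDl.
have d1 : 0 < eps / (`|a| + 1) / (`|a| + 1) by rewrite divr_gt0// ltr_wpDl.
have a1 : 0 < `|a| + 1 by rewrite ltr_wpDl.
set d := eps / (`|a| + 1).
apply: filterS (filterI (aF _ d0) (aG _ d0)) => nn [[h [K [Kh Hh]]] [g [K' [Kg Hg]]]].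
have bh := bfun_step Kh; have bg := bfun_step Kg; move: Kh Kg => [mh nh hK] [mg ng gK].
exists (fun j w => a * h j w + g j w), (`|a| * K + K'); split.
  split => [j|j w|j w]; first by apply: measurable_funD => //; exact: measurable_funM.
    by rewrite nh ng.
  by apply: le_trans (ler_normD _ _) _; rewrite normrM lerD// ler_wpM2l.
rewrite (_ : stepf s nn _ = (fun p => a * stepf s nn h p + stepf s nn g p)).
  apply: le_trans (dist_lin _ bh bg bF bG) _.
  rewrite (_ : eps = `|a| * d + d); first by apply: lerD => //; exact: ler_wpM2l.
  by rewrite /d; field; rewrite gt_eqF.
apply/funext => p; rewrite /stepf mulr_sumr -big_split/=; apply: eq_bigr => i _; ring.
Qed.

(** One term F_N is within eps/2 of F by [dist_cvg], and is in turn approximated within eps/2 by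
    steps. *)
Lemma apx_lim (F_ : nat -> tm * Om -> R) F (b : R) :
  (forall m, apx (F_ m)) -> measurable_fun setT F ->
  (forall m p, `|F_ m p| <= b) -> (forall p, F_ m p @[m --> \oo] --> F p) -> apx F.
Proof.
move=> aF mF hb cv.
have Fb p : `|F p| <= b.
  have /(cvg_norm) h := cv p; rewrite -(cvg_lim _ h)//; apply: limr_le; last exact: nearW.
  by apply/cvg_ex; eexists; exact: h.
have bF : bfun F by split => //; exists b.
split => // eps eps0.
have /cvgrPdist_le H := @dist_cvg F_ F b (fun m => (aF m).1.1) mF hb Fb (fun w => aeW _ (fun q _ =>
    cv (q, w))).
have e2 : 0 < eps / 2 by rewrite divr_gt0.
have [N _ /(_ N (leqnn N))] := H _ e2; rewrite sub0r normrN => hN.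
have [bN aN] := aF N.
apply: filterS (aN _ e2) => nn [h [K [Kh Hh]]]; exists h, K; split => //.
apply: le_trans (dist_tri (bfun_step Kh) bN bF) _; rewrite [eps]splitr; apply: lerD => //.
exact: le_trans (ler_norm _) hN.
Qed.

(** The steps are the values at left endpoints. They converge off the jumps of the path, a null set
    of times depending on the path. *)
Lemma apx_left (phi : E -> R) (t : tm) : continuous phi -> (forall x, `|phi x| <= 1) ->
  apx (fun p => \1_[set q : tm | (q : R) <= (t : R)] p.1 * phi (p.2 p.1)).
Proof.
move=> cphi phi1; pose I : tm -> R := \1_[set q : tm | (q : R) <= (t : R)].
have mI : measurable_fun setT I by apply: measurable_indic; exact: measurable_time_le.
have I1 q : `|I q| <= 1 by rewrite /I indicE ger0_norm// lern1 leq_b1.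
have mF : measurable_fun setT (fun p : tm * Om => I p.1 * phi (p.2 p.1)).
  apply: measurable_funM; first exact: measurableT_comp.
  exact: (measurableT_comp (continuous_borel cphi) measurable_X).
have Fb (p : tm * Om) : `|I p.1 * phi (p.2 p.1)| <= 1 by rewrite normrM mulr_ile1.
split; first by split => //; exists 1.
pose h nn (j : nat) (w : Om) := I (grid s nn j) * phi (w (grid s nn j)).
have Kh nn : adm nn (h nn) 1.
  split => [j|j w|j w]; last by rewrite normrM mulr_ile1.
    by apply: measurable_funM => //; exact: measurable_cont_eval.
  by rewrite /h stopE.
move=> eps eps0.
have H := @dist_cvg (fun nn => stepf s nn (h nn)) (fun p => I p.1 * phi (p.2 p.1)) 1
  (fun nn => (bfun_step (Kh nn)).1) mF (fun nn => stepf_bd s nn (let: And3 _ _ x := Kh nn in x)) Fb.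
suff cvs : forall w, \forall q \ae mu, oc s tT q -> stepf s m (h m) (q,
    w) @[m --> \oo] --> I q * phi (w q).
  have /cvgrPdist_le/(_ eps eps0) := H cvs; apply: filterS => nn; rewrite sub0r normrN => hn.
  by exists (h nn), 1; split => //; exact: le_trans (ler_norm _) hn.
move=> w {H}.
have nt : mu.-negligible [set t].
  by exists [set t]; split => //; exact: measurable_time1.
have [B [mB B0 hB]] := negligibleU (jump_negl mu_atom w) nt.
exists B; split => // q /= hq; apply: hB.
have [->|qt] := eqVneq q t; [by right|left].
apply: contrapT => /not_andP hn; apply: hq => sq.
have tq : (t0 : tm) < q :> R by apply: le_lt_trans (t0_le s) sq.1.
have {hn} cq : (w \o clamp) @ (q : R)^'- --> w q by case: hn => [//|/contrapT].
have H2 : I q * stepf s m (fun k (w : Om) => phi (w (grid s m k))) (q,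
    w) @[m --> \oo] --> I q * phi (w q).
  by apply: cvgMr; exact: left_step_cvg.
apply: cvg_trans H2; apply: near_eq_cvg.
(* When t < q, a mesh smaller than q - t puts the left endpoint of the cell of q after t as well, so
   the sampled time indicator is already exact. *)
have : \forall m \near \oo, (t : R) < (q : R) -> (t : R) < (q : R) - m.+1%:R^-1.
  have [tq'|qt'] := ltP (t : R) (q : R); last by apply: nearW => m.
  have := near_inv_lt (d := (q : R) - (t : R)); rewrite subr_gt0 => /(_ tq').
  by apply: filterS => m; rewrite ltrBrDr addrC -ltrBrDr.
apply: filterS => m hm; have [k _ kq] := cell_exists m sq.
rewrite !(stepfE _ _ kq) /h; congr (_ * _).
have [tq'|qt'] := ltP (t : R) (q : R).
  rewrite /I !indicE !memNset//=; apply/negP; rewrite -ltNge//.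
  apply: lt_le_trans (hm tq') _; rewrite lerBlDr; apply: le_trans kq.2 _.
  exact: grid_step.
rewrite /I !indicE !mem_set//=; exact: ltW (lt_le_trans kq.1 qt').
Qed.

(** A Dynkin argument: complements come from linearity, disjoint unions from the limit of the
    partial unions [U n]. *)
Lemma apx_set (A : set (tm * bE)) : measurable A ->
  apx (fun p => \1_A (p.1, p.2 p.1 : bE)).
Proof.
rewrite measurable_time_states; move: A.
have mX : measurable_fun setT (fun p : tm * Om => (p.1, p.2 p.1 : bE)).
  by apply: measurable_fun_pair => //; exact: measurable_X.
have mI (A : set (tm * bE)) : measurable A -> measurable_fun setT (fun p : tm * Om => \1_A (p.1,
    p.2 p.1 : bE) : R).
  move=> mA; have mi : measurable_fun setT (\1_A : tm * bE -> R) by exact: measurable_indic.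
  exact: (measurableT_comp mi mX).
have bI (A : set (tm * bE)) p : `|\1_A p| <= 1 :> R by rewrite indicE ger0_norm// lern1 leq_b1.
have aE F G : (forall p, F p = G p) -> apx F -> apx G by move=> /funext ->.
have aT : apx (fun p => \1_[set: tm * bE] (p.1, p.2 p.1 : bE)).
  apply: (aE _ _ _ (@apx_left (cst 1) tT _ _)).
  - by move=> p; rewrite !indicE !mem_set//= ?mulr1//; exact: le_tT.
  - exact: cst_continuous.
  - by move=> x; rewrite normr1.
apply: (@dynkin_induction _ (tm * bE)%type _ (fun A => apx (fun p => \1_A (p.1, p.2 p.1 : bE)))).
- exact: measurable_time_states.
- move=> _ _ [t [U [oU ->]]] [t' [U' [oU' ->]]].
  exists (clamp (Num.min (t : R) (t' : R))), (U `&` U'); split; first exact: openI.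
  apply/seteqP; rewrite clamp_id; last first.
    by rewrite le_min !time_ge0/= ge_min time_leT.
  by split => p /=; rewrite le_min; [move=> [[-> ?] [-> ?]]|move=> [/andP[-> ->] [? ?]]].
- exact: aT.
- move=> _ [t [U [oU ->]]].
  apply: (@apx_lim (fun m p => \1_[set q : tm | (q : R) <= (t : R)] p.1 * uapprox U m (p.2 p.1)) _ 1).
  + move=> m; apply: apx_left; first exact: uapprox_continuous.
    by move=> x; have /andP[? ?] := uapprox_bd U m x; rewrite ger0_norm.
  + apply: mI; rewrite measurable_time_states; apply: sub_gen_smallest; by exists t, U.
  + move=> m p; have /andP[? ?] := uapprox_bd U m (p.2 p.1).
    by rewrite normrM mulr_ile1// ?indicE ger0_norm// lern1 leq_b1.
  + move=> p; rewrite (_ : \1_ _ (p.1,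
      _) = \1_[set q : tm | (q : R) <= (t : R)] p.1 * \1_U (p.2 p.1) :> R).
      by apply: cvgMr; exact: uapprox_cvg.
    rewrite !indicE -natrM mulnb; congr (_%:R); congr nat_of_bool.
    by apply/idP/andP => [/set_mem[a b]|[/set_mem a /set_mem b]]; [split; exact: mem_set|apply/mem_set].
- move=> A mA aA; apply: (aE _ _ _ (apx_lin (-1) aA aT)) => p.
  by rewrite !indicE in_setC in_setT; case: (_ \in A); rewrite /=; ring.
- move=> F mF tF aF.
  pose U n := [set x | exists2 i, (i < n)%N & F i x].
  have US n : (fun p : tm * bE => \1_(U n.+1) p : R) = (fun p => 1 * \1_(F n) p + \1_(U n) p).
    apply/funext => p; rewrite mul1r !indicE; case: (boolP (p \in F n)) => h.
      rewrite mem_set; last by exists n => //; exact: set_mem.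
      rewrite memNset ?addr0// => -[i iN Fi].
      have := tF i n Logic.I Logic.I; move=> /(_ (ex_intro _ p (conj Fi (set_mem h)))) e'.
      by move: iN; rewrite e' ltnn.
    rewrite add0r; congr (_%:R); congr nat_of_bool; apply/idP/idP => /set_mem[i iN Fi]; apply/mem_set.
      exists i => //; move: iN; rewrite ltnS leq_eqVlt => /orP[/eqP ii|//].
      by move: h; rewrite -ii mem_set.
    by exists i => //; exact: ltnW.
  have aU n : apx (fun p => \1_(U n) (p.1, p.2 p.1 : bE)).
    elim: n => [|n IH].
      apply: (aE _ _ _ (apx_lin (-1) aT aT)) => p.
      rewrite !indicE [in RHS]memNset ?mem_set//=; last by case.
      by ring.
    by apply: (aE _ _ _ (apx_lin 1 (aF n) IH)) => p; rewrite [RHS](congr1 (@^~ _) (US n)).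
  apply: (@apx_lim _ _ 1 aU).
  + by apply: mI; exact: bigcupT_measurable.
  + by move=> m p; exact: bI.
  + move=> p; apply: cvg_near_cst; rewrite !indicE.
    case: (pselect ((\bigcup_k F k) (p.1, p.2 p.1))) => [[k _ Fk]|nF].
      have -> : (p.1, p.2 p.1 : bE) \in \bigcup_k F k by rewrite mem_set//; exists k.
      by near=> n; rewrite indicE mem_set//; exists k => //; near: n; exact: nbhs_infty_gt.
    rewrite (memNset nF); apply: nearW => n; rewrite indicE memNset// => -[k _ Fk].
    by apply: nF; exists k.
Unshelve. all: by end_near. Qed.

Import HBNNSimple.

Lemma apx_bounded (phi : tm * bE -> R) (b : R) : measurable_fun setT phi -> (forall p, `|phi p| <= b) ->
  apx (fun p => phi (p.1, p.2 p.1 : bE)).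
Proof.
move=> mphi hb.
have mX : measurable_fun setT (fun p : tm * Om => (p.1, p.2 p.1 : bE)).
  by apply: measurable_fun_pair => //; exact: measurable_X.
have aE F G : (forall p, F p = G p) -> apx F -> apx G by move=> /funext ->.
have aT := apx_set (@measurableT _ (tm * bE)%type).
have a0 : apx (fun=> 0).
  by apply: (aE _ _ _ (apx_lin (-1) aT aT)) => p; rewrite indicE mem_set//=; ring.
(* The shift by b makes the function nonnegative, hence an increasing limit of simple functions,
   which are finite combinations of indicators. *)
pose g p := (phi p + b)%:E.
have mg : measurable_fun setT g by apply/measurable_EFinP; exact: measurable_funD.
have g0 p : (0 <= g p)%E by rewrite lee_fin -lerBlDr sub0r; have := hb p; rewrite ler_norml => /andP[].
pose f n := nnsfun_approx measurableT mg n.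
have af n : apx (fun p => (f n : tm * bE -> R) (p.1, p.2 p.1 : bE)).
  rewrite (_ : (fun p => _) = (fun p : tm * Om =>
      \sum_(y <- finmap.enum_fset (fset_set (range (f n)))) y * \1_((f n : tm * bE -> R) @^-1` [set
          y]) (p.1, p.2 p.1 : bE))); last first.
    by apply/funext => p; rewrite [LHS](fimfunE (f n)) fsbig_finite.
  elim: (finmap.enum_fset _) => [|y r IH]; first by apply: (aE _ _ _ a0) => p; rewrite big_nil.
  have my : measurable (f n @^-1` [set y]) by [].
  by apply: (aE _ _ _ (apx_lin y (apx_set my) IH)) => p; rewrite big_cons.
have fb n p : `|(f n : tm * bE -> R) p| <= b + b.
  rewrite ger0_norm//; have : (phi p + b) <= b + b by rewrite lerD2r;
      exact: le_trans (ler_norm _) (hb p).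
  by apply: le_trans; rewrite (nnsfun_approxE measurableT mg n) -lee_fin; exact: le_approx.
have ag : apx (fun p => phi (p.1, p.2 p.1 : bE) + b).
  apply: (@apx_lim _ _ (b + b) af).
  - by apply: measurable_funD => //; exact: (measurableT_comp mphi mX).
  - by move=> m p; exact: fb.
  - move=> p; have := cvg_nnsfun_approx measurableT mg (fun x _ => g0 x) (x := (p.1,
      p.2 p.1 : bE)) Logic.I.
    by move=> /fine_cvg.
by apply: (aE _ _ _ (apx_lin (- b) aT ag)) => p; rewrite indicE mem_set//=; ring.
Qed.

(** The approximating steps are clipped to [-b, b]. This brings them closer to phi and gives them a
    bound that does not depend on eps, as is needed to control their squares. *)
Lemma density (phi : tm * bE -> R) (b : R) : measurable_fun setT phi -> (forall p, `|phi p| <= b) ->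
  forall eps : R, 0 < eps -> exists nn h, adm nn h b /\
    dist (stepf s nn h) (fun p => phi (p.1, p.2 p.1 : bE)) <= eps.
Proof.
move=> mphi hb eps eps0; have b0 : 0 <= b by apply: le_trans (hb point).
have [bF aF] := apx_bounded mphi hb.
have [N _ /(_ N (leqnn N)) [h [K [Kh Hh]]]] := aF _ eps0; have bh := bfun_step Kh.
move: Kh => [mh nh hK]; pose cl (x : R) := Num.max (- b) (Num.min x b).
have clb x : `|cl x| <= b.
  by rewrite ler_norml /cl; apply/andP; split;
      [rewrite le_max lexx|rewrite ge_max ge_min lexx orbT andbT; lra].
have Kc : adm N (fun j w => cl (h j w)) b.
  split => // [j|j w]; last by rewrite nh.
  by apply: measurable_maxr => //; exact: measurable_minr.
exists N, (fun j w => cl (h j w)); split => //; apply: le_trans Hh.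
apply: le_iint; [exact: ig_dist (bfun_step Kc) bF|exact: ig_dist|].
move=> -[q w]; rewrite ler_wpM2r//=.
have -> : stepf s N (fun j w => cl (h j w)) (q, w) = cl (stepf s N h (q, w)).
  case: (pselect (oc s tT q)) => [sq|nq].
    by have [k _ kq] := cell_exists N sq; rewrite !(stepfE _ _ kq).
  by rewrite !stepf_out// /cl min_l// max_r// oppr_le0.
have := hb (q, w q); move: (phi _) (stepf _ _ _ _) => x y; rewrite ler_norml => /andP[x1 x2].
rewrite /cl; case: (leP y b) => h1; case: (leP (- b) _) => h2 //.
- by rewrite [leLHS]ler0_norm ?[leRHS]ler0_norm; lra.
- by rewrite [leLHS]ger0_norm ?[leRHS]ger0_norm; lra.
- by rewrite [leLHS]ger0_norm ?[leRHS]ger0_norm; lra.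
Qed.

End density.

Section density_consequences.
Context {R : realType} {T : {nonneg R}} {E : completePseudoMetricType R}.
Local Notation tm := (time T).
Local Notation Om := (Omega T E).
Local Notation bE := (borel E).
Variables (Pr : probability Om R) (mu : {finite_measure set tm -> \bar R}).
Hypothesis mu_atom : forall t, mu [set t] = 0%E.
Variable s : tm.
Implicit Types (q r t : tm) (F G H : tm * Om -> R) (phi : tm * bE -> R).
Local Notation iint := (iint Pr mu).
Local Notation ig := (ig Pr mu).

Definition onX phi (p : tm * Om) : R := phi (p.1, p.2 p.1 : bE).

Lemma measurable_onX phi : measurable_fun setT phi -> measurable_fun setT (onX phi).
Proof.
move=> mphi; have mX : measurable_fun setT (fun p : tm * Om => (p.1, p.2 p.1 : bE)).
  by apply: measurable_fun_pair => //; exact: measurable_X.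
exact: (measurableT_comp mphi mX).
Qed.

Lemma na_onX phi q : na q (fun w => onX phi (q, w)).
Proof. by move=> w; rewrite -[LHS]/(phi (q, stop q w q : bE)) stopE. Qed.

Lemma ig_onXM phi (b : R) F : measurable_fun setT phi -> (forall p, `|phi p| <= b) -> ig s tT F ->
  ig s tT (fun p => onX phi p * F p).
Proof.
move=> mphi hb iF; apply: (integrable_bnd (measurable_cyl s tT) _ iF (c := b)) => //.
  by apply: measurable_funTS; exact: measurable_onX.
by move=> p _; exact: hb.
Qed.

Lemma norm_iint r t F : ig r t F -> `|iint r t F| <= iint r t (fun p => `|F p|).
Proof. by move=> iF; exact: le_normr_Rintegral (measurable_cyl r t) iF. Qed.

Lemma ig_norm r t F : ig r t F -> ig r t (fun p => `|F p|).
Proof. by move=> iF; exact: integrable_norm. Qed.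

Lemma dist_swap (e F G : tm * Om -> R) H : measurable_fun setT H -> ig s tT e ->
  (forall p, `|H p| <= e p) -> bfun F -> bfun G ->
  `|iint s tT (fun p => F p * H p) - iint s tT (fun p => G p * H p)| <= dist Pr mu s e F G.
Proof.
move=> mH ie He bF bG; have e0 p : 0 <= e p by exact: le_trans (He p).
have iH : ig s tT H.
  apply: (integrable_dom (measurable_cyl s tT) _ ie); first exact: measurable_funTS.
  by move=> p _; exact: le_trans (ler_norm _).
have iM K : bfun K -> ig s tT (fun p => K p * H p).
  move=> [mK [c hc]]; apply: (integrable_bnd (measurable_cyl s tT) _ iH (c := c)) => //.
  exact: measurable_funTS.
rewrite -iintB; [|exact: iM|exact: iM].
have iB : ig s tT (fun p => F p * H p - G p * H p) by apply: igB; exact: iM.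
apply: le_trans (norm_iint iB) _; apply: le_iint; [exact: ig_norm|exact: ig_dist|].
by move=> p; rewrite -mulrBl normrM ler_wpM2l.
Qed.

(** With the weight |H|, closeness in [dist] is closeness of the integrals against H. *)
Lemma step_orthogonal phi (b : R) H : measurable_fun setT H -> ig s tT H ->
  (forall nn h K, adm s nn h K -> iint s tT (fun p => stepf s nn h p * H p) = 0) ->
  measurable_fun setT phi -> (forall p, `|phi p| <= b) ->
  iint s tT (fun p => onX phi p * H p) = 0.
Proof.
move=> mH iH H0 mphi hb; apply/eqP; rewrite -normr_le0.
apply/ler_addgt0Pr => eps eps0; rewrite add0r.
have e0 p : 0 <= `|H p| by [].
have [nn [h [Kh]]] := density mu_atom e0 (ig_norm iH) mphi hb eps0.
apply: le_trans; have := dist_swap mH (ig_norm iH) (fun p => lexx _) (bfun_step Kh)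
  (conj (measurable_onX mphi) (ex_intro _ b (fun p => hb _))).
by rewrite (H0 _ _ _ Kh) sub0r normrN.
Qed.

(* H runs over the step processes first; they are dense for the weight |F| + |G|. *)
Lemma quadratic_density phi (b m : R) F G : measurable_fun setT F -> measurable_fun setT G ->
  ig s tT F -> ig s tT G ->
  (forall nn h K, adm s nn h K -> 2 * iint s tT (fun p => stepf s nn h p * F p) -
    iint s tT (fun p => stepf s nn h p ^+ 2 * G p) <= m) ->
  measurable_fun setT phi -> (forall p, `|phi p| <= b) ->
  2 * iint s tT (fun p => onX phi p * F p) - iint s tT (fun p => onX phi p ^+ 2 * G p) <= m.
Proof.
move=> mF mG iF iG Hm mphi hb; have b0 : 0 <= b by apply: le_trans (hb point).
apply/ler_addgt0Pr => eps eps0.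
have e0 p : 0 <= `|F p| + `|G p| by exact: addr_ge0.
have ie : ig s tT (fun p => `|F p| + `|G p|) by apply: igD; exact: ig_norm.
(* The linear term contributes twice the distance and the quadratic one b + b times the distance,
   since x^2 is (b + b)-Lipschitz on [-b, b]. *)
have d0 : 0 < eps / (2 + (b + b)) by rewrite divr_gt0// ltr_wpDr// addr_ge0.
have [nn [h [Kh Hd]]] := density mu_atom e0 ie mphi hb d0.
have bX : bfun (onX phi) by split; [exact: measurable_onX|exists b => p; exact: hb].
have bh := bfun_step Kh.
have hF p : `|F p| <= `|F p| + `|G p| by rewrite lerDl.
have hG p : `|G p| <= `|F p| + `|G p| by rewrite lerDr.
have d1 := le_trans (dist_swap mF ie hF bh bX) Hd.
have bsq (K : tm * Om -> R) : bfun K -> bfun (fun p => K p ^+ 2).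
  move=> [mK [c hc]]; split; first exact: measurable_funX.
  exists (c ^+ 2) => p; rewrite normrX ler_pXn2r ?nnegrE//.
  by apply: le_trans (hc p).
have d2 := dist_swap mG ie hG (bsq _ bh) (bsq _ bX).
have d3 : dist Pr mu s (fun p => `|F p| + `|G p|) (fun p => stepf s nn h p ^+ 2) (fun p => onX phi
    p ^+ 2) <=
    (b + b) * dist Pr mu s (fun p => `|F p| + `|G p|) (stepf s nn h) (onX phi).
  rewrite -iintZ; last exact: ig_dist.
  apply: le_iint; [by apply: ig_dist => //; exact: bsq|by apply: igZ; exact: ig_dist|].
  move=> p; rewrite mulrA ler_wpM2r// subr_sqr normrM mulrC ler_wpM2r//.
  by apply: le_trans (ler_normD _ _) _; apply: lerD; [case: Kh => ? ? hK; exact: stepf_bd|exact: hb].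
have d4 : (b + b) * dist Pr mu s (fun p => `|F p| + `|G p|) (stepf s nn h) (onX phi) <= (b + b) *
    (eps / (2 + (b + b))).
  by apply: ler_wpM2l => //; exact: addr_ge0.
have := Hm _ _ _ Kh.
have e1 : eps = 2 * (eps / (2 + (b + b))) + (b + b) * (eps / (2 + (b + b))).
  by field; rewrite gt_eqF// ltr_wpDr// addr_ge0.
have := le_trans d2 (le_trans d3 d4); move: d1; rewrite !ler_norml => /andP[a1 a2] /andP[a3 a4].
move: a1 a2 a3 a4 e1; set x := iint _ _ _; set y := iint _ _ _; set z := iint _ _ _; set v := iint _ _ _.
lra.
Qed.

End density_consequences.

Section ae_comparison.
Context d (X : measurableType d) (R : realType) (nu : {measure set X -> \bar R}).
Variable A : set X.
Hypothesis mA : measurable A.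
Implicit Types f g : X -> R.

Lemma integrable_ae_le f g : measurable_fun A f -> nu.-integrable A (EFin \o g) ->
  (\forall x \ae nu, A x -> `|f x| <= `|g x|) -> nu.-integrable A (EFin \o f).
Proof.
move=> mf /integrableP[mg lg] fg; have mf' : measurable_fun A (EFin \o f) by exact/measurable_EFinP.
apply/integrableP; split => //; apply: le_lt_trans lg; apply: ae_ge0_le_integral => //.
- exact: measurableT_comp.
- exact: measurableT_comp.
Qed.

Lemma le_Rintegral_ae f g : nu.-integrable A (EFin \o f) -> nu.-integrable A (EFin \o g) ->
  (\forall x \ae nu, A x -> f x <= g x) -> \int[nu]_(x in A) f x <= \int[nu]_(x in A) g x.
Proof.
move=> iff ig fg; pose h x := Num.max (f x) (g x).
have mf : measurable_fun A f by apply/measurable_EFinP; exact: (measurable_int _ iff).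
have mg : measurable_fun A g by apply/measurable_EFinP; exact: (measurable_int _ ig).
have ih : nu.-integrable A (EFin \o h).
  apply: (integrable_domD mA _ iff ig); first exact: measurable_maxr.
  by move=> x _; rewrite /h maxEle; case: ifP => _; rewrite ?lerDl ?lerDr.
have -> : \int[nu]_(x in A) g x = \int[nu]_(x in A) h x.
  apply: Rint_eq_integral; apply: ae_eq_integral => //.
  - exact: (measurable_int _ ig).
  - exact: (measurable_int _ ih).
  - by apply: filterS fg => x fgx Ax; rewrite /h max_r// fgx.
by apply: le_Rintegral => // x _; rewrite /h le_max lexx.
Qed.

Lemma fatou_bound (f_ : nat -> X -> R) f (K : R) : (forall n, measurable_fun A (f_ n)) ->
  measurable_fun A f -> (forall n x, 0 <= f_ n x) ->
  (\forall x \ae nu, A x -> f_ n x @[n --> \oo] --> f x) ->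
  (forall n, (\int[nu]_(x in A) (f_ n x)%:E <= K%:E)%E) ->
  (\int[nu]_(x in A) (f x)%:E <= K%:E)%E.
Proof.
move=> mf_ mf f0 cv fK.
have mfe n : measurable_fun A (fun x => (f_ n x)%:E) by exact/measurable_EFinP.
have -> : (\int[nu]_(x in A) (f x)%:E = \int[nu]_(x in A) limn_einf (fun n => (f_ n x)%:E))%E;
    last first.
  have fe n x : A x -> (0 <= (f_ n x)%:E)%E by rewrite lee_fin.
  apply: le_trans (fatou _ mA mfe fe) _.
  rewrite limn_einf_lim; apply: lime_le; first exact: is_cvg_einfs.
  apply: nearW => n; apply: le_trans (fK n); apply: ereal_inf_lbound.
  by exists n => //=; exact: leqnn.
apply: ae_eq_integral => //.
- exact/measurable_EFinP.
- have me := measurable_fun_limn_esup (fun n => measurableT_comp (@oppe_measurable R setT) (mfe n)).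
  by rewrite /limn_einf; apply: measurableT_comp.
- apply: filterS cv => x h Ax; apply/esym; have hx : (f_ n x)%:E @[n --> \oo] --> (f x)%:E.
    by apply: cvg_EFin; [exact: nearW|exact: h].
  by rewrite is_cvg_limn_einfE; [exact: cvg_lim hx|apply/cvg_ex; eexists; exact: hx].
Qed.

End ae_comparison.

Lemma ae_cyl_from (R : realType) (T : {nonneg R}) (E : completePseudoMetricType R)
    (Pr : probability (Omega T E) R) (mu : {finite_measure set (time T) -> \bar R})
    (s t : time T) (Q : time T * Omega T E -> Prop) :
  (\forall w \ae Pr, forall q : time T, (s : R) <= (q : R) -> Q (q, w)) ->
  \forall p \ae (mu \x Pr)%E, cyl s t p -> Q p.
Proof.
move=> h; suff : \forall p \ae (mu \x Pr)%E, (s : R) <= ((p : time T * Omega T E).1 : R) -> Q p.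
  by apply: filterS => -[q w] /= hq [[/= sq _] _]; exact: hq (ltW sq).
exact: (@ae_cyl _ _ _ Pr mu (fun p => (s : R) <= (p.1 : R) -> Q p)).
Qed.

(** * Square integrability of the bracket *)

Section energy_step.
Context {R : realType} {T : {nonneg R}} {E : completePseudoMetricType R}.
Local Notation tm := (time T).
Local Notation Om := (Omega T E).
Variables (Pr : probability Om R) (mu : {finite_measure set tm -> \bar R}).
Hypothesis mu_atom : forall t, mu [set t] = 0%E.
Variable s : tm.
Implicit Types (q r t : tm).
Local Notation EE := (EE Pr).
Local Notation iint := (iint Pr mu).
Local Notation ig := (ig Pr mu).
Local Notation igP := (igP Pr).
Local Notation amart := (amart Pr).
Local Notation fv := (fv mu).
Local Notation drift := (drift Pr mu).
Variables (M N L Q : tm * Om -> R) (b c sg G k : tm * Om -> R) (y0 z0 C : R).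
Hypotheses (mM : amart s M) (mN : amart s N) (mL : amart s L) (mQ : amart s Q).
Hypotheses (sM : sqint Pr s M) (sN : sqint Pr s N).
Hypotheses (mb : measurable_fun setT b) (mc : measurable_fun setT c)
  (msg : measurable_fun setT sg) (mG : measurable_fun setT G) (mk : measurable_fun setT k).
Hypotheses (nb : forall q, s <= q :> R -> na q (fun w => b (q, w)))
  (nc : forall q, s <= q :> R -> na q (fun w => c (q, w)))
  (nsg : forall q, s <= q :> R -> na q (fun w => sg (q, w)))
  (nG : forall q, s <= q :> R -> na q (fun w => G (q, w)))
  (nk : forall q, s <= q :> R -> na q (fun w => k (q, w))).
Hypotheses (k0 : forall p, 0 <= k p) (bk : forall p, `|b p| <= k p)
  (ck : forall p, `|c p| <= k p) (sgk : forall p, `|sg p| <= k p) (GC : forall p, `|G p| <= C).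
Local Notation Int F := (fun p : tm * Om => \int[mu]_(q in oc s p.1) F (q, p.2)).

Definition proc_of (y : R) (M b : tm * Om -> R) : tm * Om -> R :=
  fun p => y + M p + \int[mu]_(q in oc s p.1) b (q, p.2).
Local Notation Y := (proc_of y0 M b).
Local Notation Z := (proc_of z0 N c).

(** The carré du champ along the path. With Y = u, Z = psi_i, b = a(u), c = a(psi_i) and sg = a(u
    psi_i), it is the i-th component of Gamma(u). *)
Definition Gam p := sg p - Y p * c p - Z p * b p.

Hypothesis kfin : \forall w \ae Pr, (clockp mu s k (tT, w) < +oo)%E.
Hypothesis YZ : \forall w \ae Pr, forall t, s <= t :> R ->
  Y (t, w) * Z (t, w) = L (t, w) + Int sg (t, w).
Hypothesis NN : \forall w \ae Pr, forall t, s <= t :> R ->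
  N (t, w) ^+ 2 = Q (t, w) + Int G (t, w).

Variable n : nat.
Local Notation chi := (chi mu s k n).
Local Notation chi' := (chi' mu s k n).
Local Notation bel := (below mu s k n.+1%:R).

Lemma measurable_proc_of y F g : measurable_fun setT F -> measurable_fun setT g ->
  measurable_fun setT (proc_of y F g).
Proof.
move=> mF mg; apply: measurable_funD; first by apply: measurable_funD.
exact: measurable_int_r.
Qed.

Lemma measurable_Gam : measurable_fun setT Gam.
Proof.
have mY := measurable_proc_of y0 (mart_meas mM) mb.
have mZ := measurable_proc_of z0 (mart_meas mN) mc.
by apply: measurable_funB; [apply: measurable_funB => //|]; exact: measurable_funM.
Qed.

Let fchi := fv_chi mu_atom mk nk k0 n.
Let fb := fv_trunc mu_atom mk nk k0 y0 (ler0n R n.+1) mb nb bk.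
Let fc := fv_trunc mu_atom mk nk k0 z0 (ler0n R n.+1) mc nc ck.
Let fs := fv_trunc mu_atom mk nk k0 0 (ler0n R n.+1) msg nsg sgk.

(** M N equals Y Z minus terms in which a bounded-variation process multiplies M, N or another such
    process. Multiplied by chi and truncated, each term has a known drift (D1 to D5); apart from
    chi' M N, these add up to chi times [Gam]. *)
Lemma drift_cross : drift s (fun p => chi p * (M p * N p))
  (fun p => chi' p * (M p * N p) + chi p * Gam p).
Proof.
have mChi := fv_mD fchi; have mChi' := fv_md fchi.
have D1 := drift_mart_fv mL fchi.
have D2 := drift_fv Pr (fv_mul mu_atom fchi fs).
have D3 := drift_mart_fv mM (fv_mul mu_atom fchi fc).
have D4 := drift_mart_fv mN (fv_mul mu_atom fchi fb).
have D5 := drift_fv Pr (fv_mul mu_atom fchi (fv_mul mu_atom fb fc)).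
have D := driftB (driftB (driftB (driftD D1 D2) D3) D4) D5.
have mMN := measurable_funM (mart_meas mM) (mart_meas mN).
apply: (drift_ae _ _ _ D).
- exact: measurable_funM.
- by apply: measurable_funD; apply: measurable_funM => //; exact: measurable_Gam.
apply: filterS (filterI kfin YZ) => w [Kw yz] q sq /=.
have {yz} := yz q sq; rewrite /Gam /proc_of/=.
(* Either the level is passed, and chi and chi' vanish, or it is not, and the truncated integrals
   are the true ones. *)
case: (eqVneq (bel (q, w)) 0) => h.
  have h1 : chi (q, w) = 0 by apply/eqP/negPn/negP => /(chi_below mu_atom mk k0 sq Kw)/eqP.
  have h2 : chi' (q, w) = 0 by apply/eqP/negPn/negP => /(chi'_below k0); rewrite h eqxx.
  by rewrite h1 h2; split; ring.
have h1 : bel (q, w) = 1.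
  by move: h; rewrite /below indicE; case: (_ \in _) => //=; rewrite eqxx.
rewrite !(trunc_eq mk k0 _ h) h1.
set B := \int[mu]_(_ in _) b _; set Cc := \int[mu]_(_ in _) c _; set S := \int[mu]_(_ in _) sg _ => yz.
have e : M (q, w) * N (q, w) = L (q, w) + S - (z0 + Cc) * M (q, w) - (y0 + B) * N (q,
    w) - (y0 + B) * (z0 + Cc).
  by rewrite -yz; ring.
by rewrite e; split; ring.
Qed.

(** G is bounded and the time measure finite, so its integral has bounded variation without
    truncation. *)
Lemma drift_square : drift s (fun p => chi p * (N p * N p))
  (fun p => chi' p * (N p * N p) + chi p * G p).
Proof.
have mChi := fv_mD fchi; have mChi' := fv_md fchi.
have C0 : 0 <= C by apply: le_trans (GC point); exact: normr_ge0.
have fG : fv s (`|0 : R| + C * fine (mu setT)) (fun p => 0 + Int G p) G.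
  apply: fv_int => // w.
  have m1 : measurable_fun (oc s tT) (fun q : tm => (`|G (q, w)|)%:E).
    by apply/measurable_EFinP/measurable_funTS/measurableT_comp => //; exact: measurable_time_sec.
  apply: (@le_trans _ _ (\int[mu]_(q in oc s tT) (cst C%:E q))%E).
    apply: ge0_le_integral => //; first exact: measurable_oc.
    by move=> q _; rewrite lee_fin GC.
  rewrite integral_cst; last exact: measurable_oc.
  rewrite EFinM fineK ?fin_num_measure// lee_wpmul2l ?lee_fin//.
  by apply: le_measure; rewrite ?inE//; exact: measurable_oc.
have D := driftD (drift_mart_fv mQ fchi) (drift_fv Pr (fv_mul mu_atom fchi fG)).
have mNN := measurable_funM (mart_meas mN) (mart_meas mN).
apply: (drift_ae _ _ _ D).
- exact: measurable_funM.
- by apply: measurable_funD; apply: measurable_funM.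
apply: filterS NN => w nn q sq /=; have := nn q sq; rewrite expr2 => -> /=.
by split; ring.
Qed.

(** The coefficient h is known at r, hence acts as a constant for the martingale property from r
    on. *)
Lemma mart_lin r (h : Om -> R) (K : R) : s <= r :> R -> measurable_fun setT h -> na r h -> (forall
    w : Om, `|h w| <= K) ->
  amart r (fun p => M p - h p.2 * N p) /\ sqint Pr r (fun p => M p - h p.2 * N p).
Proof.
move=> sr mh nh hK.
have mr := mart_restrict sr mM; have nr := mart_restrict sr mN.
have m2 := measurableT_comp mh (@measurable_snd _ _ tm Om).
have mMM := mart_meas mM; have mNN := mart_meas mN.
have i2 t : r <= t :> R -> igP (fun w => h w * N (t, w)).
  by move=> rt; apply: (igPM mh hK); exact: (mart_ig nr).
have mR : measurable_fun setT (fun p : tm * Om => M p - h p.2 * N p).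
  exact: (measurable_funB mMM (measurable_funM m2 mNN)).
split; first split => //.
- by move=> q rq w /=; rewrite (mart_na mr)// (mart_na nr)// (na_le rq nh).
- by move=> t rt; apply: igPB; [exact: (mart_ig mr)|exact: i2].
- move=> q t A rq qt mA nA; have rt := le_trans rq qt.
  have mI : measurable_fun setT (\1_A : Om -> R) by exact: measurable_indic.
  have I1 w : `|\1_A w| <= 1 :> R by rewrite indicE ger0_norm// lern1 leq_b1.
  have nI : na q (\1_A : Om -> R).
    move=> w; rewrite !indicE; congr (_%:R); congr nat_of_bool.
    by apply/idP/idP => /set_mem hA; apply/mem_set; move: hA; rewrite nA.
  have iA X : igP X -> Pr.-integrable A (EFin \o X) by move=> iX; exact: integrableS iX.
  rewrite !integralB_EFin//; try by apply: iA; first [exact: (mart_ig mr)|exact: i2].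
  congr (_ - _)%E; first exact: (mart_eq mr).
  have e u : (\int[Pr]_(w in A) (h w * N (u, w))%:E = \int[Pr]_w (\1_A w * h w * N (u, w))%:E)%E.
    rewrite integral_mkcond; apply: eq_integral => w _; rewrite patchE indicE.
    by case: (w \in A); rewrite ?mul1r ?mul0r.
  have it := igPM mI I1 (i2 t rt).
  have it' : igP (fun w => \1_A w * h w * N (t, w)) by apply: eq_igP it => w; rewrite mulrA.
  have [iq eq] := mart_fun nr rq qt (measurable_funM mI mh) (na_mul nI (na_le rq nh)) it'.
  rewrite !e -(fineK (integrable_fin_num measurableT it')) -(fineK (integrable_fin_num measurableT iq)).
  by congr EFin.
- move=> t rt; have st := le_trans sr rt.
  have i3 : igP (fun w => h w ^+ 2 * N (t, w) ^+ 2).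
    apply: (@igPM _ _ _ _ _ (K ^+ 2)); [exact: measurable_funX| |exact: sN].
    by move=> w; rewrite normrX ler_pXn2r ?nnegrE//; exact: le_trans (hK w).
  apply: (integrable_domD measurableT _ (igPD (sM st) (sM st)) (igPD i3 i3)).
    by apply: measurable_funX; exact: (measurable_sec t mR).
  move=> w _; set x := M _; set y := N _; set z := h w.
  rewrite ![`|_|]ger0_norm ?sqr_ge0//; first by have := sqr_ge0 (x + z * y); lra.
  - by rewrite addr_ge0// mulr_ge0// sqr_ge0.
  - by rewrite addr_ge0 ?sqr_ge0.
Qed.

(** What the integral of chi against the bracket of M would be, written without that bracket. *)
Definition enbal r t := EE (fun w => chi (t, w) * M (t, w) ^+ 2)
  - EE (fun w => chi (r, w) * M (r, w) ^+ 2) - iint r t (fun p => chi' p * M p ^+ 2).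

Lemma chi_ae_ge0 t : s <= t :> R -> \forall w \ae Pr, 0 <= chi (t, w).
Proof. by move=> st; apply: filterS kfin => w Kw; case/andP: (chi01 mu_atom mk k0 n st Kw). Qed.

Lemma ig_chi'M : ig s tT (fun p => chi' p * M p ^+ 2).
Proof. exact: (ig_sq (le_tT s) fchi mM sM (lexx _) (le_tT s)). Qed.

Lemma ig_chi'N : ig s tT (fun p => chi' p * (N p * N p)).
Proof.
by have := (ig_sq (le_tT s) fchi mN sN (lexx _) (le_tT s)); apply: eq_ig => p; rewrite expr2.
Qed.

Lemma ig_chi'MN : ig s tT (fun p => chi' p * (M p * N p)).
Proof.
apply: (integrable_domD (measurable_cyl _ _) _ ig_chi'M ig_chi'N).
  apply: measurable_funTS; apply: measurable_funM; first exact: (fv_md fchi).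
  exact: (measurable_funM (mart_meas mM) (mart_meas mN)).
move=> p _; rewrite !normrM -mulrDr; apply: ler_wpM2l => //.
have := normr_ge0 (M p); have := normr_ge0 (N p); nra.
Qed.

(** The drift of chi M N is integrable by [drift_cross]; removing its part chi' M N, integrable
    because M and N are square integrable, leaves chi times [Gam]. *)
Lemma ig_chiGam : ig s tT (fun p => chi p * Gam p).
Proof.
have := igB (drift_ige drift_cross) ig_chi'MN; apply: eq_ig => p.
by rewrite addrAC subrr add0r.
Qed.

Lemma ig_chiG : ig s tT (fun p => chi p * G p).
Proof.
have := igB (drift_ige drift_square) ig_chi'N; apply: eq_ig => p.
by rewrite addrAC subrr add0r.
Qed.

(** [jensen_fv] for M - h N says that its weighted energy is nonnegative on the cell. Expanding in
    h, the cross term is the drift of chi M N and the square term that of chi N^2. *)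
Lemma energy_cell r t (h : Om -> R) (K : R) : s <= r :> R -> r <= t :> R ->
  measurable_fun setT h -> na r h -> (forall w : Om, `|h w| <= K) ->
  2 * iint r t (fun p => h p.2 * (chi p * Gam p)) -
    iint r t (fun p => h p.2 ^+ 2 * (chi p * G p)) <= enbal r t.
Proof.
move=> sr rt mh nh hK; have st := le_trans sr rt.
have [mR sR] := mart_lin sr mh nh hK.
have := jensen_fv rt (fv_restrict sr fchi) mR sR (chi_ae_ge0 st) (fun p => chi'_le0 _ _ k0 _ p).
have mh2 : measurable_fun setT (fun w => h w ^+ 2) by exact: measurable_funX.
have h2K w : `|h w ^+ 2| <= K ^+ 2.
  by rewrite normrX ler_pXn2r ?nnegrE//; exact: le_trans (hK w).
have nh2 : na r (fun w => h w ^+ 2) by move=> w; rewrite nh.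
have E1 := drift_eq drift_cross sr rt mh nh (ex_intro _ K hK).
have E2 := drift_eq drift_square sr rt mh2 nh2 (ex_intro _ _ h2K).
have igr F : ig s tT F -> ig r t F by apply: igS => //; exact: le_tT.
have i1 := igM mh hK (igr _ ig_chi'MN); have i2 := igM mh hK (igr _ ig_chiGam).
have i3 := igM mh2 h2K (igr _ ig_chi'N); have i4 := igM mh2 h2K (igr _ ig_chiG).
have i5 := igr _ ig_chi'M.
have E1' : iint r t (fun p => h p.2 * (chi' p * (M p * N p) + chi p * Gam p)) =
  iint r t (fun p => h p.2 * (chi' p * (M p * N p))) + iint r t (fun p => h p.2 * (chi p * Gam p)).
  by rewrite -iintD//; apply: eq_iint => p; rewrite mulrDr.
have E2' : iint r t (fun p => h p.2 ^+ 2 * (chi' p * (N p * N p) + chi p * G p)) =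
  iint r t (fun p => h p.2 ^+ 2 * (chi' p * (N p * N p))) + iint r t (fun p => h p.2 ^+ 2 * (chi p
      * G p)).
  by rewrite -iintD//; apply: eq_iint => p; rewrite mulrDr.
have E3 (u : tm) : (r : R) <= (u : R) -> EE (fun w => chi (u, w) * (M (u, w) - h w * N (u, w)) ^+ 2) =
    EE (fun w => chi (u, w) * M (u, w) ^+ 2) -
    (EE (fun w => h w * (chi (u, w) * (M (u, w) * N (u, w)))) +
     EE (fun w => h w * (chi (u, w) * (M (u, w) * N (u, w))))) +
    EE (fun w => h w ^+ 2 * (chi (u, w) * (N (u, w) * N (u, w)))).
  move=> ru; have su := le_trans sr ru.
  have mx : measurable_fun setT (fun w => chi (u, w)) by apply: measurable_sec; exact: (fv_mD fchi).
  have j1 := igPM mh hK (drift_ig drift_cross su).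
  have j2 := igPM mh2 h2K (drift_ig drift_square su).
  have j3 : igP (fun w => chi (u, w) * M (u, w) ^+ 2).
    by apply: (igPM mx _ (sM su)) => w; exact: (fv_bd fchi).
  have j4 := igPD j1 j1; have j5 := igPB j3 j4.
  by rewrite -EED// -EEB// -EED//; apply: eq_EE => w; ring.
have E4 : iint r t (fun p => chi' p * (M p - h p.2 * N p) ^+ 2) =
    iint r t (fun p => chi' p * M p ^+ 2) -
    (iint r t (fun p => h p.2 * (chi' p * (M p * N p))) +
     iint r t (fun p => h p.2 * (chi' p * (M p * N p)))) +
    iint r t (fun p => h p.2 ^+ 2 * (chi' p * (N p * N p))).
  have j4 := igD i1 i1; have j5 := igB i5 j4.
  by rewrite -iintD// -iintB// -iintD//; apply: eq_iint => p; ring.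
rewrite /= E3// E3 ?lexx// E4 /enbal; move: E1 E2; rewrite E1' E2' /=; lra.
Qed.

Lemma enbalU r (u : tm) t : s <= r :> R -> (r : R) <= (u : R) -> (u : R) <= (t : R) ->
  enbal r t = enbal r u + enbal u t.
Proof.
move=> sr ru ut; rewrite /enbal (iintU ru ut); first by ring.
by apply: igS ig_chi'M => //; exact: le_tT.
Qed.

(** Since chi' <= 0 and M^2 is a submartingale, M may be replaced by its terminal value in the
    integral against chi'. What remains is the total variation of chi plus its final value, that is
    chi_s = 1, times M_T^2. *)
Lemma enbal_le : enbal s tT <= EE (fun w => M (tT, w) ^+ 2).
Proof.
have sT := le_tT s.
have mMT := measurable_sec tT (mart_meas mM).
have mX : measurable_fun setT (fun w => M (tT, w) ^+ 2) by exact: measurable_funX.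
have mS : measurable_fun setT (fun p => M p ^+ 2) by apply: measurable_funX; exact: (mart_meas mM).
have [i1 i2 i3 e] := fv_iint (Pr := Pr) fchi (lexx _) sT mX (sM sT).
have e1 : EE (fun w => M (tT, w) ^+ 2 * chi (s, w)) = EE (fun w => M (tT, w) ^+ 2).
  by apply: eq_EE => w; rewrite chi_s mulr1.
have e2 : EE (fun w => chi (s, w) * M (s, w) ^+ 2) = EE (fun w => M (s, w) ^+ 2).
  by apply: eq_EE => w; rewrite chi_s mul1r.
have e3 : EE (fun w => chi (tT, w) * M (tT, w) ^+ 2) = EE (fun w => M (tT, w) ^+ 2 * chi (tT, w)).
  by apply: eq_EE => w; rewrite mulrC.
have p1 : 0 <= EE (fun w => M (s, w) ^+ 2) by apply: Rintegral_ge0 => w _; exact: sqr_ge0.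
(* The term in M_s^2 has the right sign and is dropped. *)
suff : iint s tT (fun p => M (tT, p.2) ^+ 2 * chi' p) <= iint s tT (fun p => chi' p * M p ^+ 2).
  by rewrite /enbal e2 e3; move: e; rewrite e1; lra.
have H := @na_le_iint _ _ _ Pr mu s tT _ _ _ mS mX (fv_md fchi).
have {}H : (\int[mu \x Pr]_(p in cyl s tT) (`|chi' p| * `|M p ^+ 2|)%:E <=
   \int[mu \x Pr]_(p in cyl s tT) (`|chi' p| * `|M (tT, p.2) ^+ 2|)%:E)%E.
  apply: H; first by move=> q [/= sq _]; apply: (fv_nd fchi); exact: ltW.
  by move=> q A [/= sq qT] mA nA; apply: mart_sq_le mM sM _ _ _ _ => //; exact: ltW.
have c0 p : `|chi' p| = - chi' p by rewrite ler0_norm// chi'_le0.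
have a1 : iint s tT (fun p => M (tT,
    p.2) ^+ 2 * chi' p) = - iint s tT (fun p => `|chi' p| * `|M (tT, p.2) ^+ 2|).
  rewrite -mulN1r -iintZ.
    by apply: eq_iint => p; rewrite c0 ger0_norm ?sqr_ge0//; ring.
  by have := igZ (-1) i3; apply: eq_ig => p; rewrite c0 ger0_norm ?sqr_ge0//; ring.
have a2 : iint s tT (fun p => chi' p * M p ^+ 2) = - iint s tT (fun p => `|chi' p| * `|M p ^+ 2|).
  rewrite -mulN1r -iintZ.
    by apply: eq_iint => p; rewrite c0 ger0_norm ?sqr_ge0//; ring.
  by have := igZ (-1) ig_chi'M; apply: eq_ig => p; rewrite c0 ger0_norm ?sqr_ge0//; ring.
rewrite a1 a2 lerN2; apply: fine_le => //.
- apply: (@integrable_fin_num _ _ _ (mu \x Pr)%E); first exact: measurable_cyl.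
  have := igZ (-1) ig_chi'M; apply: eq_ig => p; rewrite c0 ger0_norm ?sqr_ge0//; ring.
- apply: (@integrable_fin_num _ _ _ (mu \x Pr)%E); first exact: measurable_cyl.
  have := igZ (-1) i3; apply: eq_ig => p; rewrite c0 ger0_norm ?sqr_ge0//; ring.
Qed.

(** The step is a single h on each cell, and the cell bounds telescope because [enbal] is additive
    in time. *)
Lemma energy_steps (nn : nat) (h : nat -> Om -> R) (K : R) :
  (forall j, measurable_fun setT (h j)) -> (forall j, na (grid s nn j) (h j)) ->
  (forall j (w : Om), `|h j w| <= K) ->
  2 * iint s tT (fun p => stepf s nn h p * (chi p * Gam p)) -
    iint s tT (fun p => stepf s nn h p ^+ 2 * (chi p * G p)) <= EE (fun w => M (tT, w) ^+ 2).
Proof.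
move=> mh nh hK; apply: le_trans enbal_le.
have [iA iB] := (ig_step nn mh hK ig_chiGam, ig_step2 nn mh hK ig_chiG).
rewrite -(gridN_tT s nn); elim: (gridN nn) => [|j IH].
  rewrite grid0 /enbal /iint /cyl oc0 !set0X !Rintegral_set0; lra.
set t := grid s nn j; set t' := grid s nn j.+1.
have st : (s : R) <= (t : R).
  by rewrite -[X in X <= _](congr1 (@Defs.tval _ _) (grid0 s nn)); exact: grid_le.
have tt' : (t : R) <= (t' : R) by exact: grid_le.
have igr F : ig s tT F -> ig s t' F by apply: igS => //; exact: le_tT.
rewrite (enbalU (lexx _) st tt') (iintU st tt' (igr _ iA)) (iintU st tt' (igr _ iB)).
have cellE (F : R -> tm * Om -> R) : iint t t' (fun p => F (stepf s nn h p) p) =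
    iint t t' (fun p => F (h j p.2) p).
  by apply: eq_Rintegral => -[q w] /set_mem[qt _]; rewrite (stepfE _ _ qt).
rewrite (cellE (fun x p => x * (chi p * Gam p))) (cellE (fun x p => x ^+ 2 * (chi p * G p))).
have := energy_cell st tt' (mh j) (nh j) (hK j); move: IH; rewrite -/t; lra.
Qed.

Lemma energy_density (phi : tm * borel E -> R) (b0 : R) : measurable_fun setT phi -> (forall p,
    `|phi p| <= b0) ->
  2 * iint s tT (fun p => onX phi p * (chi p * Gam p)) -
    iint s tT (fun p => onX phi p ^+ 2 * (chi p * G p)) <= EE (fun w => M (tT, w) ^+ 2).
Proof.
move=> mphi hb; have mchi := fv_mD fchi.
apply: (quadratic_density mu_atom _ _ ig_chiGam ig_chiG _ mphi hb).
- by apply: measurable_funM => //; exact: measurable_Gam.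
- exact: measurable_funM.
- by move=> nn h K [mh nh hK]; apply: (energy_steps (K := K)).
Qed.

End energy_step.

Section energy_bound.
Context {R : realType} {T : {nonneg R}} {E : completePseudoMetricType R}.
Local Notation tm := (time T).
Local Notation Om := (Omega T E).
Variables (Pr : probability Om R) (mu : {finite_measure set tm -> \bar R}).
Hypothesis mu_atom : forall t, mu [set t] = 0%E.
Variable s : tm.
Implicit Types (q r t : tm).
Variables (M N L Q : tm * Om -> R) (b c sg G k : tm * Om -> R) (y0 z0 C : R).
Hypotheses (mM : amart Pr s M) (mN : amart Pr s N) (mL : amart Pr s L) (mQ : amart Pr s Q).
Hypotheses (sM : sqint Pr s M) (sN : sqint Pr s N).
Hypotheses (mb : measurable_fun setT b) (mc : measurable_fun setT c)
  (msg : measurable_fun setT sg) (mG : measurable_fun setT G) (mk : measurable_fun setT k).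
Hypotheses (nb : forall q, s <= q :> R -> na q (fun w => b (q, w)))
  (nc : forall q, s <= q :> R -> na q (fun w => c (q, w)))
  (nsg : forall q, s <= q :> R -> na q (fun w => sg (q, w)))
  (nG : forall q, s <= q :> R -> na q (fun w => G (q, w)))
  (nk : forall q, s <= q :> R -> na q (fun w => k (q, w))).
Hypotheses (k0 : forall p, 0 <= k p) (bk : forall p, `|b p| <= k p)
  (ck : forall p, `|c p| <= k p) (sgk : forall p, `|sg p| <= k p) (GC : forall p, `|G p| <= C).
Local Notation Int F := (fun p : tm * Om => \int[mu]_(q in oc s p.1) F (q, p.2)).
Local Notation Y := (proc_of mu s y0 M b).
Local Notation Z := (proc_of mu s z0 N c).
Hypothesis kfin : \forall w \ae Pr, (clockp mu s k (tT, w) < +oo)%E.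
Hypothesis YZ : \forall w \ae Pr, forall t, s <= t :> R ->
  Y (t, w) * Z (t, w) = L (t, w) + Int sg (t, w).
Hypothesis NN : \forall w \ae Pr, forall t, s <= t :> R ->
  N (t, w) ^+ 2 = Q (t, w) + Int G (t, w).
Variable gam : tm * borel E -> R.
Hypothesis mgam : measurable_fun setT gam.
Hypothesis Gamgam : \forall w \ae Pr, forall t, s <= t :> R ->
  Gam mu s M N b c sg y0 z0 (t, w) = onX gam (t, w).

(** C may be 0; C + 1 is positive and still bounds G. *)
Let C1 := C + 1.
Let C0 : 0 <= C. Proof. by apply: le_trans (GC point). Qed.

Let C10 : 0 < C1. Proof. by rewrite ltr_wpDl. Qed.

Let I n : tm * borel E -> R := \1_[set p | `|gam p| <= n%:R].
Let mI n : measurable_fun setT (I n).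
Proof.
apply: measurable_indic; rewrite -[X in measurable X]setTI.
by apply: measurable_fun_le => //; exact: measurableT_comp.
Qed.

(** The near-optimal h, truncated where gam exceeds n so as to be bounded. *)
Let phi n p := I n p * gam p / C1.

Let energy_trunc n :
  (\int[mu \x Pr]_(p in cyl s tT) (`|chi mu s k n p| * (onX (I n) p * onX gam p ^+ 2))%:E <=
   (C1 * EE Pr (fun w => M (tT, w) ^+ 2))%:E)%E.
Proof.
have phib p : `|phi n p| <= n%:R / C1.
  rewrite /phi normrM [`|C1^-1|]gtr0_norm ?invr_gt0// ler_pM2r ?invr_gt0// /I indicE.
  case: (boolP (p \in _)) => [/set_mem/= h|_]; first by rewrite mul1r.
  by rewrite mul0r normr0.
have mphi : measurable_fun setT (phi n).
  by apply: measurable_funM => //; exact: measurable_funM.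
have H := energy_density mu_atom mM mN mL mQ sM sN mb mc msg mG mk nb nc nsg nG nk
  k0 bk ck sgk GC kfin YZ NN n mphi phib.
have i1 := ig_chiGam mu_atom mM mN mL sM sN mb mc msg mk nb nc nsg nk k0 bk ck sgk kfin YZ n.
have i2 := ig_chiG mu_atom mN mQ sN mG mk nG nk k0 GC NN n.
have fchi := fv_chi mu_atom mk nk k0 n.
pose F p := `|chi mu s k n p| * (onX (I n) p * onX gam p ^+ 2).
have mF : measurable_fun setT F.
  apply: measurable_funM; first by apply: measurableT_comp => //; exact: (fv_mD fchi).
  apply: measurable_funM; first exact: measurable_onX.
  by apply: measurable_funX; exact: measurable_onX.
have haeF : \forall p \ae (mu \x Pr)%E, cyl s tT p ->
   F p <= C1 * (2 * (onX (phi n) p * (chi mu s k n p * Gam mu s M N b c sg y0 z0 p))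
     - onX (phi n) p ^+ 2 * (chi mu s k n p * G p)).
  apply: ae_cyl_from.
  apply: filterS (filterI kfin Gamgam) => w [Kw GG] q /= sq.
  have /andP[c0 _] := chi01 mu_atom mk k0 n sq Kw.
  rewrite (GG _ sq) /F ger0_norm//.
  have -> : onX (phi n) (q, w) = onX (I n) (q, w) * onX gam (q, w) / C1 by [].
  have II : onX (I n) (q, w) ^+ 2 = onX (I n) (q, w).
    by rewrite /onX /I indicE; case: (_ \in _); rewrite /= ?expr1n ?expr0n.
  have I0 : 0 <= onX (I n) (q, w) by rewrite /onX /I indicE.
  move: c0 II I0; set x := chi _ _ _ _ _; set i := onX (I n) _; set g := onX gam _ => x0 II I0.
  (* The indicator i is kept as a variable: i = i^2 kills the second term, and 2 - G / C1 is at
     least 1, so the integrand is at least chi i g^2. *)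
  have -> : C1 * (2 * (i * g / C1 * (x * g)) - (i * g / C1) ^+ 2 * (x * G (q, w))) =
    x * (i * g ^+ 2) * (2 - G (q, w) / C1) + x * (i - i ^+ 2) * g ^+ 2 * G (q, w) / C1.
    by field; rewrite gt_eqF.
  rewrite II subrr mulr0 !mul0r addr0 ler_peMr//; first by rewrite mulr_ge0// mulr_ge0// sqr_ge0.
  have : G (q, w) / C1 <= 1.
    by rewrite ler_pdivrMr// mul1r; have := ler_norm (G (q, w)); have := GC (q, w); rewrite /C1; lra.
  by lra.
have iphi1 := ig_onXM mphi phib i1.
have phib2 p : `|phi n p ^+ 2| <= (n%:R / C1) ^+ 2.
  by rewrite normrX ler_pXn2r ?nnegrE//; apply: le_trans (phib p).
have iphi2 := ig_onXM (measurable_funX 2 mphi) phib2 i2.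
have iR := igZ C1 (igB (igZ 2 iphi1) iphi2).
have iF : ig Pr mu s tT F.
  apply: (integrable_ae_le (measurable_cyl s tT) _ iR); first exact: measurable_funTS.
  apply: filterS haeF => p h cp.
  rewrite [`|F _|]ger0_norm; last by rewrite /F/onX/I indicE mulr_ge0// mulr_ge0// sqr_ge0.
  by apply: le_trans (h cp) _; exact: ler_norm.
have -> : (\int[mu \x Pr]_(p in cyl s tT) (F p)%:E)%E = (iint Pr mu s tT F)%:E.
  by rewrite fineK//; exact: (integrable_fin_num (measurable_cyl _ _) iF).
rewrite lee_fin.
apply: (@le_trans _ _ (C1 * (2 * iint Pr mu s tT (fun p => onX (phi n) p * (chi mu s k n p * Gam mu
    s M N b c sg y0 z0 p)) -
    iint Pr mu s tT (fun p => onX (phi n) p ^+ 2 * (chi mu s k n p * G p))))); last first.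
  by rewrite ler_pM2l.
rewrite -iintZ// -iintB//; last exact: igZ.
rewrite -iintZ; last by apply: igB => //; exact: igZ.
exact: (le_Rintegral_ae (measurable_cyl s tT) iF iR).
Qed.

(** The bound of [energy_trunc] does not depend on n. On almost every path the weight and the
    truncation are eventually 1, and Fatou concludes. *)
Lemma energy_finite : (\int[mu \x Pr]_(p in cyl s tT) (onX gam p ^+ 2)%:E < +oo)%E.
Proof.
apply: le_lt_trans (ltry (C1 * EE Pr (fun w => M (tT, w) ^+ 2))).
apply: (fatou_bound (measurable_cyl s tT) _ _ _ _ energy_trunc).
- move=> n; apply: measurable_funTS; apply: measurable_funM.
    by apply: measurableT_comp => //; exact: (fv_mD (fv_chi mu_atom mk nk k0 n)).
  apply: measurable_funM; first exact: measurable_onX.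
  by apply: measurable_funX; exact: measurable_onX.
- by apply: measurable_funTS; apply: measurable_funX; exact: measurable_onX.
- by move=> n p; rewrite /onX/I indicE mulr_ge0// mulr_ge0// sqr_ge0.
apply: ae_cyl_from.
apply: filterS kfin => w Kw q /= sq; apply: cvg_near_cst.
have h := chi_cvg mu_atom mk k0 sq Kw.
near=> n; rewrite (_ : chi mu s k n (q, w) = 1); last by near: n.
rewrite normr1 mul1r (_ : onX (I n) (q, w) = 1) ?mul1r// /onX/I indicE mem_set//=.
by near: n; exact: nbhs_infty_ger.
Unshelve. all: by end_near. Qed.

End energy_bound.

(** * Gronwall's lemma for an atomless measure *)

Section gronwall.
Context {R : realType} {T : {nonneg R}}.
Local Notation tm := (time T).
Variable mu : {finite_measure set tm -> \bar R}.
Hypothesis mu_atom : forall t, mu [set t] = 0%E.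
Variable s : tm.
Implicit Types (q r t : tm) (y alpha : tm -> R).

Let one : tm -> R := cst 1.
Let v := clockint mu s one.
Let V := fine (mu setT).
Let mone : measurable_fun setT one. Proof. exact: measurable_cst. Qed.

Let one0 q : 0 <= one q. Proof. exact: ler01. Qed.

Let S (m : R) := lvl mu s one m.
Let mS (m : R) : measurable (oc s tT `&` S m).
Proof. by apply: measurableI; [exact: measurable_oc|exact: measurable_lvl]. Qed.

Let int1 (B : set tm) : measurable B -> (\int[mu]_(q in B) (one q)%:E = mu B)%E.
Proof. by move=> mB; rewrite -[RHS]mul1e -(integral_cst mu mB). Qed.

Let vV q : (v q <= V%:E)%E.
Proof.
rewrite /v /clockint int1; last exact: measurable_oc.
by rewrite fineK ?fin_num_measure// le_measure// inE//; exact: measurable_oc.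
Qed.

Let V0 : 0 <= V. Proof. exact: fine_ge0. Qed.

Let mu_lvl (m : R) : 0 <= m -> mu (oc s tT `&` S m) = mine (v tT) m%:E.
Proof.
move=> m0; have := lvl_intE mu_atom mone one0 m0 (le_tT s) (le_lt_trans (vV tT) (ltry _)).
by rewrite int1//; exact: mS.
Qed.

(** Without atoms the clock takes all intermediate values, so the times at which it lies in ]m, m +
    e] have mass at most e. *)
Let mu_lvlD (m e : R) : 0 <= m -> 0 <= e ->
  (mu (oc s tT `&` (S (m + e) `\` S m)) <= e%:E)%E.
Proof.
move=> m0 e0.
have sub : oc s tT `&` S m `<=` oc s tT `&` S (m + e).
  by move=> q [h1 h2]; split => //; apply: le_trans h2 _; rewrite lee_fin lerDl.
have -> : oc s tT `&` (S (m + e) `\` S m) = (oc s tT `&` S (m + e)) `\` (oc s tT `&` S m).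
  apply/seteqP; split => q /=; first by move=> [h1 [h2 h3]]; split => // -[].
  by move=> [[h1 h2] h3]; split => //; split => // h4; apply: h3.
rewrite measureD//; last by rewrite -ge0_fin_numE// fin_num_measure.
rewrite (setIidr sub) [X in (X - _)%E](mu_lvl (addr_ge0 m0 e0)) [X in (_ - X)%E](mu_lvl m0).
have vf : v tT \is a fin_num by rewrite ge0_fin_numE ?(le_lt_trans (vV _) (ltry _))// clockint_ge0.
rewrite -(fineK vf) -!EFin_min -EFinB lee_fin.
by case: (leP (fine (v tT)) (m + e)) => h1; case: (leP (fine (v tT)) m) => h2; lra.
Qed.

Let intS y m : \bar R := (\int[mu]_(q in oc s tT `&` S m) (y q)%:E)%E.

(** The levels of the clock are cut into slabs of mass at most e with c e <= 1/2, so that the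
    contribution of a slab to its own bound can be absorbed. K is fixed before y and alpha, hence is
    the same for all paths. The finiteness of the integral of y is what permits the absorption. *)
Lemma gronwall (c : R) : 0 <= c -> exists2 K : R, 0 <= K & forall y alpha,
  measurable_fun setT y -> measurable_fun setT alpha ->
  (forall q, 0 <= y q) -> (forall q, 0 <= alpha q) ->
  (\int[mu]_(q in oc s tT) (y q)%:E < +oo)%E ->
  (forall t, oc s tT t -> ((y t)%:E <= (alpha t)%:E + c%:E * \int[mu]_(q in oc s t) (y q)%:E)%E) ->
  (\int[mu]_(q in oc s tT) (y q)%:E <= K%:E * \int[mu]_(q in oc s tT) (alpha q)%:E)%E.
Proof.
move=> c0; pose e : R := (2 * (c + 1))^-1.
have e0 : 0 < e by rewrite invr_gt0 mulr_gt0// ltr_wpDl.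
have ce : c * e <= 2^-1.
  by rewrite /e invfM mulrCA -[leRHS]mulr1 ler_wpM2l// ?invr_ge0// ler_pdivrMr ?ltr_wpDl// mul1r lerDl.
(* With x and x' the integrals of y up to two consecutive levels and A that of alpha, the estimate
   below reads x' <= A + c V x + x' / 2, that is x' <= 2 A + 2 c V x. At level 0 the mass is 0. *)
pose k := fix k n : R := if n is n'.+1 then 2 + 2 * c * V * k n' else 0.
have k0 n : 0 <= k n by elim: n => //= n IH; rewrite addr_ge0// !mulr_ge0.
exists (k (Num.bound (V / e))) => // y alpha my ma y0 a0 fin hy.
set A := (\int[mu]_(q in oc s tT) (alpha q)%:E)%E.
have A0 : (0 <= A)%E by apply: integral_ge0 => q _; rewrite lee_fin.
have mye (B : set tm) : measurable_fun B (fun q => (y q)%:E) by apply/measurable_EFinP/measurable_funTS.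
have mae (B : set tm) : measurable_fun B (fun q => (alpha q)%:E) by
    apply/measurable_EFinP/measurable_funTS.
have y0e q : (0 <= (y q)%:E)%E by rewrite lee_fin.
have step n : (intS y (n%:R * e) <= (k n)%:E * A)%E.
  elim: n => [|n IH].
    rewrite mul0r mul0e /intS null_set_integral//.
    by apply: etrans (mu_lvl (lexx 0)) _; rewrite min_r ?clockint_ge0.
  have m0 : 0 <= n%:R * e by rewrite mulr_ge0// ltW.
  have eS : n.+1%:R * e = n%:R * e + e by rewrite -natr1 mulrDl mul1r.
  set m := n%:R * e in IH m0 eS; rewrite eS.
  have fS u : (intS y u < +oo)%E.
    apply: le_lt_trans fin; apply: ge0_subset_integral => //; exact: measurable_oc.
  have S0 u : (0 <= intS y u)%E by apply: integral_ge0.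
  have fSf u : intS y u \is a fin_num by rewrite ge0_fin_numE.
  pose x := fine (intS y m); pose x' := fine (intS y (m + e)).
  have x0 : 0 <= x by rewrite fine_ge0. have x'0 : 0 <= x' by rewrite fine_ge0.
  (* For q below the old level the inner integral is at most x; in the new slab it is bounded by x',
     at a cost proportional to the mass of the slab. *)
  pose g q : \bar R := ((alpha q)%:E + (c * x)%:E + (c * x' * \1_(S (m + e) `\` S m) q)%:E)%E.
  have mSD : measurable (S (m + e) `\` S m) by apply: measurableD; exact: measurable_lvl.
  have B q : (oc s tT `&` S (m + e)) q -> ((y q)%:E <= g q)%E.
    move=> [sq Sq]; apply: le_trans (hy q sq) _.
    have Sr r u : oc s q r -> S u q -> (oc s tT `&` S u) r.
      move=> [/= sr rq] Su; split; first by split => //=; exact: le_trans rq (le_tT _).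
      by apply: le_trans Su; exact: clockint_nd.
    rewrite /g -addeA leeD2l// indicE; case: (boolP (q \in _)) => h.
      rewrite mulr1 -EFinD -mulrDr EFinM lee_wpmul2l ?lee_fin//.
      apply: (@le_trans _ _ x'%:E); last by rewrite lee_fin lerDr.
      rewrite fineK//; apply: ge0_subset_integral => //; first exact: measurable_oc.
      by move=> r /Sr; apply.
    rewrite mulr0 adde0 EFinM lee_wpmul2l ?lee_fin// fineK//.
    have Smq : S m q by apply: contrapT => nS; move/negP: h; apply; apply/mem_set.
    apply: ge0_subset_integral => //; first exact: measurable_oc.
    by move=> r /Sr; apply.
  have mc (r : R) (D : set tm) : measurable_fun D (fun=> r%:E) by exact: measurable_cst.
  have mi : measurable_fun (oc s tT `&` S (m + e)) (fun q => (c * x' * \1_(S (m + e) `\` S m) q)%:E).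
    by apply/measurable_EFinP/measurable_funTS/measurable_funM => //; exact: measurable_indic.
  have : (intS y (m + e) <= \int[mu]_(q in oc s tT `&` S (m + e)) g q)%E.
    apply: ge0_le_integral => //; first by apply: emeasurable_funD => //; exact: emeasurable_funD.
  rewrite /g ge0_integralD//; first last.
  - by move=> q _; rewrite lee_fin !mulr_ge0.
  - exact: emeasurable_funD.
  - by move=> q _; rewrite -EFinD lee_fin addr_ge0// mulr_ge0.
  rewrite ge0_integralD//; first last.
  - by move=> q _; rewrite lee_fin mulr_ge0.
  - by move=> q _; rewrite lee_fin.
  rewrite integral_cst//.
  have -> : (\int[mu]_(q in oc s tT `&` S (m + e)) (c * x' * \1_(S (m + e) `\` S m) q)%:E =
     (c * x')%:E * mu (oc s tT `&` (S (m + e) `\` S m)))%E.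
    under eq_integral do rewrite EFinM.
    rewrite ge0_integralZl_EFin ?mulr_ge0//; last first.
      by apply/measurable_EFinP/measurable_funTS; exact: measurable_indic.
    rewrite integral_indic//; congr (_ * mu _)%E.
    apply/seteqP; split => q /=; first by move=> [[h1 h2] [h3 h4]].
    by move=> [h1 [h2 h3]].
  move=> H.
  have h1 : (\int[mu]_(q in oc s tT `&` S (m + e)) (alpha q)%:E <= A)%E.
    apply: ge0_subset_integral => //; first exact: measurable_oc.
    by move=> q _; rewrite lee_fin.
  have h2 : ((c * x)%:E * mu (oc s tT `&` S (m + e)) <= (c * x * V)%:E)%E.
    rewrite [X in (_ <= X)%E]EFinM lee_wpmul2l ?lee_fin ?mulr_ge0// /V fineK ?fin_num_measure//.
    by rewrite le_measure// inE//; exact: mS.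
  have h3 : ((c * x')%:E * mu (oc s tT `&` (S (m + e) `\` S m)) <= (2^-1 * x')%:E)%E.
    apply: (@le_trans _ _ ((c * x')%:E * e%:E)%E).
      by rewrite lee_wpmul2l ?lee_fin ?mulr_ge0//; apply: mu_lvlD => //; exact: ltW.
    by rewrite -EFinM lee_fin mulrAC ler_wpM2r.
  have {h1 h2 h3 H} := le_trans H (leeD (leeD h1 h2) h3).
  rewrite -(fineK (fSf (m + e))) -/x' => H.
  (* If the integral of alpha is infinite the bound is trivial, as the constant at n + 1 is
     positive. *)
  have [Af|Ai] := boolP (A \is a fin_num); last first.
    have -> : A = +oo%E by apply/eqP; move: Ai; rewrite ge0_fin_numE// -leNgt leye_eq.
    by rewrite gt0_muley ?leey// lte_fin ltr_pwDl// !mulr_ge0.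
  have {}H : x' <= fine A + c * x * V + 2^-1 * x' by rewrite -lee_fin !EFinD (fineK Af).
  have {}IH : x <= k n * fine A by rewrite -lee_fin /x (fineK (fSf m)) EFinM (fineK Af).
  rewrite -(fineK Af) -EFinM lee_fin; move: H IH; set z := fine A => H IH.
  have : c * x * V <= c * V * (k n * z).
    by rewrite mulrAC ler_wpM2l// mulr_ge0.
  by rewrite /= mulrDl -!mulrA; move: H; rewrite -!mulrA; lra.
(* At this number of slabs the level exceeds the total mass V, so no time is left out. *)
have -> : (\int[mu]_(q in oc s tT) (y q)%:E = intS y ((Num.bound (V / e))%:R * e))%E.
  rewrite /intS setIidl// => q sq; apply: le_trans (vV q) _; rewrite lee_fin.
  rewrite -ler_pdivrMr//; have /andP[_ /ltW] := lt_bound (V / e); exact.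
exact: step.
Qed.

End gronwall.

(** * The completed basis and square integrability *)

Section image_integral.
Context d1 d2 (X : measurableType d1) (Y : measurableType d2) (R : realType).
Variables (m1 : {measure set X -> \bar R}) (m2 : {measure set Y -> \bar R}) (phi : X -> Y).
Hypothesis mphi : measurable_fun setT phi.
Hypothesis m12 : forall A, measurable A -> m2 A = m1 (phi @^-1` A).

Lemma integral_image (D : set Y) (f : Y -> \bar R) : measurable D -> measurable_fun D f ->
  (\int[m2]_(y in D) f y = \int[m1]_(x in phi @^-1` D) f (phi x))%E.
Proof.
move=> mD mf; pose m := Measure.clone _ _ _ (pushforward m1 phi)
  (measure_function_pushforward__canonical__measure_function_Measure m1 mphi).
have H (g : Y -> \bar R) : measurable_fun D g -> (forall y, 0 <= g y)%E ->
    (\int[m2]_(y in D) g y = \int[m1]_(x in phi @^-1` D) g (phi x))%E.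
  move=> mg g0; transitivity (\int[m]_(y in D) g y)%E.
    by apply: eq_measure_integral => A mA _; rewrite m12.
  exact: (ge0_integral_pushforward mphi).
rewrite integralE [RHS]integralE; congr (_ - _)%E.
  by rewrite H//; [apply: eq_integral => x _; rewrite !funeposE|exact: measurable_funepos].
by rewrite H//; [apply: eq_integral => x _; rewrite !funenegE|exact: measurable_funeneg].
Qed.

Lemma integrable_image (f : Y -> \bar R) : measurable_fun setT f ->
  m1.-integrable setT (f \o phi) -> m2.-integrable setT f.
Proof.
move=> mf /integrableP[_ h]; apply/integrableP; split => //.
by rewrite (@integral_image setT (fun y => `|f y|%E))//; exact: measurableT_comp.
Qed.

End image_integral.

Section completion.
Context {R : realType} {T : {nonneg R}} {E : completePseudoMetricType R}.
Local Notation tm := (time T).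
Local Notation Om := (Omega T E).
Variable Pr : probability Om R.
Implicit Types (s q r t : tm) (F : tm * Om -> R).
Local Notation cP := (@completion R T E Pr).

Lemma completion_measurable (A : set Om) : measurable A ->
  (caratheodory_display (Pr^*)%mu).-measurable (A : set (caratheodory_type (Pr^*)%mu)).
Proof. by move=> mA; apply: sub_caratheodory; apply: sub_sigma_algebra. Qed.

Lemma completionE (A : set Om) : measurable A -> cP A = Pr A.
Proof. by move=> mA; rewrite /completion /completed_measure_extension measurable_mu_extE. Qed.

Lemma measurable_completion_id :
  measurable_fun setT (fun w : caratheodory_type (Pr^*)%mu => w : Om).
Proof. by move=> _ A mA; rewrite setTI; exact: completion_measurable. Qed.

Lemma completion_integral (A : set Om) (f : Om -> \bar R) : measurable A -> measurable_fun A f ->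
  (\int[Pr]_(w in A) f w = \int[cP]_(w in A) f w)%E.
Proof.
move=> mA mf; apply: (integral_image measurable_completion_id) => // B mB.
exact/esym/completionE.
Qed.

Lemma completion_integrable (f : Om -> \bar R) : measurable_fun setT f ->
  (cP).-integrable setT f -> Pr.-integrable setT f.
Proof.
move=> mf; apply: (integrable_image measurable_completion_id) => // B mB.
exact/esym/completionE.
Qed.

Lemma completion_ae (Q : Om -> Prop) : (\forall w \ae Pr, Q w) -> \forall w \ae cP, Q w.
Proof.
move=> [B [mB B0 hB]]; exists B; split => //; first exact: completion_measurable.
by rewrite completionE.
Qed.

(** Passes from the completed basis to the raw one: events unchanged by stopping at q lie in
    [cfilt Pr q], and integrals of measurable functions agree with those for the completion. The
    process may be replaced by a jointly measurable F that equals it almost surely at each time. *)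
Lemma mart_of_martingale s r (M : tm -> Om -> R) F : r <= s :> R ->
  martingale_from Pr r M -> measurable_fun setT F ->
  (forall q, s <= q :> R -> na q (fun w => F (q, w))) ->
  (forall t, s <= t :> R -> \forall w \ae Pr, M t w = F (t, w)) -> amart Pr s F.
Proof.
move=> rs hM mF nF MF.
have mFt t : measurable_fun setT (fun w : caratheodory_type (Pr^*)%mu => F (t, w)).
  exact: (measurableT_comp (measurable_sec t mF) measurable_completion_id).
have iF t : s <= t :> R -> (cP).-integrable setT (fun w => (F (t, w))%:E).
  move=> st; have [iM _ _ _] := hM t t (le_trans rs st) (lexx _).
  apply: (ae_integrable_R measurableT _ iM); first exact: mFt.
  by apply: completion_ae; apply: filterS (MF t st) => w -> _.
split => // [t st|q t A sq qt mA nA].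
  apply: completion_integrable; last exact: iF.
  by apply/measurable_EFinP; exact: measurable_sec.
have st := le_trans sq qt.
have [iMt iMq _ eqA] := hM q t (le_trans rs sq) qt.
have cA : cfilt Pr q A by apply: sub_sigma_algebra; left; exact: filt_na.
have := eqA A cA.
have e (u : tm) : (s : R) <= (u : R) -> (\int[cP]_(w in A) (M u w)%:E = \int[Pr]_(w in A) (F (u,
    w))%:E)%E.
  move=> su; rewrite completion_integral//; last first.
    by apply/measurable_EFinP; apply: measurable_funTS; exact: measurable_sec.
  have [iMu _ _ _] := hM u u (le_trans rs su) (lexx _).
  apply: ae_eq_integral.
  - exact: completion_measurable.
  - exact: (measurable_funTS (measurable_int _ iMu)).
  - by apply/measurable_EFinP; apply: measurable_funTS; exact: mFt.
  - by apply: completion_ae; apply: filterS (MF u su) => w -> _.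
by rewrite !e.
Qed.

End completion.

Section clock_measure.
Context {R : realType} {T : {nonneg R}} (V : clock T).

Lemma dV_fin_num : fin_num_fun (time_measure (clock_ext V) : set (time T) -> \bar R).
Proof.
apply: lty_fin_num_fun; exact: dV_fin.
Qed.

HB.instance Definition _ := Measure_isFinite.Build _ (time T) R
  (time_measure (clock_ext V) : set (time T) -> \bar R) dV_fin_num.

Definition muV : {finite_measure set (time T) -> \bar R} := time_measure (clock_ext V).

Lemma muV_atom t : muV [set t] = 0%E.
Proof. exact: dV_atom. Qed.

End clock_measure.

Section L2_tools.
Context {R : realType} {T : {nonneg R}} {E : completePseudoMetricType R}.
Local Notation tm := (time T).
Local Notation Om := (Omega T E).
Variables (Pr : probability Om R) (mu : {finite_measure set tm -> \bar R}).
Implicit Types (s q r t : tm) (F G M : tm * Om -> R) (X : Om -> R).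
Local Notation ig := (ig Pr mu).
Local Notation igP := (igP Pr).

(** The total mass plus 1 avoids dividing by 0, and the right-hand side may be infinite. *)
Lemma cauchy_schwarz_cst (A : set tm) (b : tm -> R) : measurable A -> mu.-integrable A (EFin \o b) ->
  (((\int[mu]_(q in A) `|b q|) ^+ 2)%:E <=
   (fine (mu setT) + 1)%:E * \int[mu]_(q in A) (b q ^+ 2)%:E)%E.
Proof.
move=> mA ib; set v := fine (mu setT); set i := \int[mu]_(q in A) `|b q|.
have v0 : 0 <= v by exact: fine_ge0.
have i0 : 0 <= i by apply: Rintegral_ge0.
have mb : measurable_fun A b by apply/measurable_EFinP; exact: (measurable_int _ ib).
have mb2 : measurable_fun A (fun q => (b q ^+ 2)%:E) by apply/measurable_EFinP; exact: measurable_funX.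
have B0 : (0 <= \int[mu]_(q in A) (b q ^+ 2)%:E)%E by apply: integral_ge0 => q _;
    rewrite lee_fin sqr_ge0.
have [fB|] := boolP (\int[mu]_(q in A) (b q ^+ 2)%:E \is a fin_num)%E; last first.
  rewrite ge0_fin_numE// -leNgt leye_eq => /eqP ->.
  by rewrite gt0_muley ?leey// lte_fin ltr_wpDl.
(* Integrating 2 m |b| <= b^2 + m^2 gives 2 m i - m^2 v <= B; at this m the left-hand side exceeds
   i^2 / (v + 1) by the square m^2. *)
pose m := i / (v + 1); have m0 : 0 <= m by rewrite divr_ge0// addr_ge0.
have ie : (\int[mu]_(q in A) (`|b q|)%:E = i%:E)%E.
  by rewrite fineK//; apply: integrable_fin_num => //; exact: integrable_norm ib.
have H : (\int[mu]_(q in A) (2 * m * `|b q|)%:E <= \int[mu]_(q in A) ((b q ^+ 2)%:E + (m ^+ 2)%:E))%E.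
  apply: ge0_le_integral => //.
  - by move=> q _; rewrite lee_fin mulr_ge0// mulr_ge0.
  - by apply/measurable_EFinP; apply: measurable_funM => //; exact: measurableT_comp.
  - exact: emeasurable_funD.
  - move=> q _; rewrite -EFinD lee_fin -[b q ^+ 2]real_normK ?num_real//.
    by have := sqr_ge0 (`|b q| - m); lra.
move: H; rewrite ge0_integralD//; first last.
- by move=> q _; rewrite lee_fin sqr_ge0.
- by move=> q _; rewrite lee_fin sqr_ge0.
have m20 : 0 <= 2 * m by rewrite mulr_ge0.
have -> : (\int[mu]_(q in A) (2 * m * `|b q|)%:E = (2 * m)%:E * \int[mu]_(q in A) `|b q|%:E)%E.
  rewrite -ge0_integralZl_EFin//.
  by apply/measurable_EFinP; exact: measurableT_comp.
rewrite integral_cst// ie -(fineK fB) => H.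
have h2 : ((m ^+ 2)%:E * mu A <= (m ^+ 2 * v)%:E)%E.
  rewrite EFinM lee_wpmul2l ?lee_fin ?sqr_ge0// /v fineK ?fin_num_measure//.
  by rewrite le_measure// inE.
have {h2} := le_trans H (leeD (lexx _) h2); rewrite -!EFinM -EFinD !lee_fin.
set B := fine _ => {}H; have {}H : 2 * m * i - m ^+ 2 * v <= B by rewrite lerBlDr.
have v1 : 0 < v + 1 by rewrite ltr_wpDl.
rewrite mulrC -ler_pdivrMr//; apply: le_trans H.
rewrite -subr_ge0 (_ : _ - _ = (i / (v + 1)) ^+ 2); first exact: sqr_ge0.
by rewrite /m; field; rewrite gt_eqF.
Qed.

Lemma ig_snd s t X : igP X -> ig s t (fun p => X p.2).
Proof.
move=> iX; have mX : measurable_fun setT X by apply/measurable_EFinP; exact: (measurable_int _ iX).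
have m2 : measurable_fun setT (fun p : tm * Om => X p.2) by exact: (measurableT_comp mX measurable_snd).
apply/integrableP; split; first exact/measurable_EFinP/measurable_funTS.
rewrite (@tonelli_cyl _ _ _ Pr mu s t (fun p => `|(X p.2)%:E|%E))//; last first.
  by apply: measurableT_comp => //; exact/measurable_EFinP.
have /integrableP[_ l] := iX.
rewrite (_ : (\int[mu]_(q in oc s t) _)%E = \int[mu]_(q in oc s t) cst (\int[Pr]_w `|(X w)%:E|)%E q)%E//.
rewrite integral_cst; last exact: measurable_oc.
rewrite lte_mul_pinfty// ?ge0_fin_numE ?integral_ge0//.
by rewrite -ge0_fin_numE// fin_num_measure//; exact: measurable_oc.
Qed.

Lemma ig_path s t F : ig s t F ->
  \forall w \ae Pr, mu.-integrable (oc s t) (fun q => (F (q, w))%:E).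
Proof.
move=> iF; have := @ae_integrable2 _ _ _ _ _ mu Pr (EFin \o (F \_ (cyl s t))) (restr_ig iF).
apply: filterS => w /= H; apply/(integrable_mkcond _ (measurable_oc s t)); move: H.
by congr (integrable _ _ _); apply/funext => q /=; rewrite patch_cyl patchE /patch; case: ifP.
Qed.

(** The second moment increases in time up to its value at T, and the time measure is finite. *)
Lemma ig_mart_sq s M : amart Pr s M -> sqint Pr s M -> ig s tT (fun p => M p ^+ 2).
Proof.
move=> mM sM; have sT := le_tT s.
have mMM := mart_meas mM; have mMT := measurable_sec tT mMM.
have mS : measurable_fun setT (fun p => M p ^+ 2) by exact: measurable_funX.
apply/integrableP; split; first exact/measurable_EFinP/measurable_funTS.
have H := @na_le_iint _ _ _ Pr mu s tT (fun p => M p ^+ 2) (fun w => M (tT, w) ^+ 2) (cst 1) mS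
  (measurable_funX 2 mMT) (measurable_cst _).
have {}H := H (fun q h w => erefl).
have /integrableP[_ l] := ig_snd s tT (sM tT sT).
apply: le_lt_trans l; rewrite /= in H *.
have e (K : tm * Om -> R) : (\int[mu \x Pr]_(p in cyl s tT) (`|1| * `|K p|)%:E =
    \int[mu \x Pr]_(p in cyl s tT) `|K p|%:E)%E.
  by apply: eq_integral => p _; rewrite normr1 mul1r.
move: H; rewrite !e; apply.
by move=> q A [/= sq qT] mA nA; apply: mart_sq_le mM sM _ _ _ _ => //; exact: ltW.
Qed.

End L2_tools.

(** * The Markov property *)

Section finite_kernels.
Context d1 d2 (X : measurableType d1) (Y : measurableType d2) (R : realType).
Variable k : X -> {measure set Y -> \bar R}.

(** The family under a name that carries its measurability and its bound, so that a kernel structure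
    can be attached to it. *)
Definition fkern (mk : forall U, measurable U -> measurable_fun [set: X] (k ^~ U))
  (kb : measure_fam_uub k) : X -> {measure set Y -> \bar R} := k.

Hypothesis mk : forall U, measurable U -> measurable_fun [set: X] (k ^~ U).
Hypothesis kb : measure_fam_uub k.

HB.instance Definition _ := isKernel.Build _ _ X Y R (fkern mk kb) mk.
HB.instance Definition _ := Kernel_isFinite.Build _ _ X Y R (fkern mk kb) kb.

Lemma measurable_fkern_integral (F : X * Y -> \bar R) : (forall p, 0 <= F p)%E ->
  measurable_fun setT F -> measurable_fun setT (fun x => \int[k x]_y F (x, y))%E.
Proof. by move=> F0 mF; exact: (measurable_fun_integral_finite_kernel F (fkern mk kb)). Qed.

End finite_kernels.

(** The measure m is seen as a kernel from a one-point space. Its composition with k is the image of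
    m by phi on sets, hence against nonnegative functions. *)
Lemma integral_mixture d1 d2 (Y : measurableType d1) (Z : measurableType d2) (R : realType)
    (m : {measure set Y -> \bar R}) (k : Y -> {measure set Z -> \bar R}) (phi : Y -> Z)
    (F : Z -> \bar R) :
  (m setT < +oo)%E -> (forall U, measurable U -> measurable_fun setT (k ^~ U)) ->
  measure_fam_uub k -> measurable_fun setT phi ->
  (forall U, measurable U -> (\int[m]_y k y U = m (phi @^-1` U))%E) ->
  (forall z, 0 <= F z)%E -> measurable_fun setT F ->
  (\int[m]_y \int[k y]_z F z = \int[m]_y F (phi y))%E.
Proof.
move=> mfin mk [r kb] mphi h F0 mF.
have mb : measure_fam_uub (fun _ : unit => m).
  exists (fine (m setT) + 1) => _; rewrite -(fineK (_ : m setT \is a fin_num)) ?ge0_fin_numE//.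
  by rewrite lte_fin ltrDl.
have ml U : measurable U -> measurable_fun [set: unit] (fun _ : unit => m U) by move=> _;
    exact: measurable_cst.
have mk' U : measurable U -> measurable_fun [set: unit * Y] (fun p : unit * Y => k p.2 U).
  by move=> mU; exact: (measurableT_comp (mk U mU) measurable_snd).
have kb' : measure_fam_uub (fun p : unit * Y => k p.2) by exists r => p; exact: kb.
have H := @integral_kcomp _ _ _ unit Y Z R (fkern ml mb) (fkern mk' kb') tt F F0 mF.
rewrite -[LHS]H; apply: (integral_image (m1 := m) (phi := phi)) => //.
Qed.

Lemma integral_mrestr d (Y : measurableType d) (R : realType) (m : {measure set Y -> \bar R})
    (A : set Y) (mA : measurable A) (F : Y -> \bar R) : (forall y, 0 <= F y)%E ->
  measurable_fun setT F -> (\int[mrestr m mA]_y F y = \int[m]_(y in A) F y)%E.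
Proof.
move=> F0 mF; rewrite -(setUv A) ge0_integral_setU//; first last.
- by apply/disj_setPS => y [].
- exact: measurable_funTS.
- exact: measurableC.
rewrite [X in (_ + X)%E]null_set_integral ?adde0.
- by apply: eq_measure_integral => B mB BA; rewrite /= /mrestr setIidl.
- exact: measurableC.
- exact: measurable_funTS.
- by rewrite /= /mrestr setICl measure0.
Qed.

Section joint_kernel.
Context {R : realType} {T : {nonneg R}} {E : completePseudoMetricType R}.
Local Notation tm := (time T).
Local Notation Om := (Omega T E).
Local Notation bE := (borel E).
Variable P : tm -> tm -> R.-pker bE ~> bE.
Variable PP : tm -> E -> probability Om R.
Hypothesis hPP : canonical_Markov_class P PP.
Implicit Types (s q r t : tm).

Lemma law_integral s x t (F : bE -> \bar R) : measurable_fun setT F ->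
  (\int[P s t x]_y F y = \int[PP s x]_w F (w t : bE))%E.
Proof.
move=> mF; apply: (integral_image (m1 := PP s x) (phi := fun w : Om => w t : bE)) => //.
  exact: measurable_eval.
by move=> A mA; case: hPP => h _; rewrite -h.
Qed.

Lemma pker_le1 s t (y : bE) (B : set bE) : measurable B -> (P s t y B <= 1)%E.
Proof. by move=> mB; rewrite -(@prob_kernel _ _ _ _ _ (P s t) y); apply: le_measure; rewrite ?inE. Qed.

Lemma pker_fin s t (y : bE) (B : set bE) : measurable B -> P s t y B \is a fin_num.
Proof. by move=> mB; rewrite ge0_fin_numE// (le_lt_trans (pker_le1 s t y mB)) ?ltry. Qed.

(* In the time variable the kernel is the limit of right step functions when
   integrated against a continuous function, by right-continuity of the paths. *)
Lemma measurable_pker_cont t (phi : E -> R) : continuous phi -> (forall x, 0 <= phi x <= 1) ->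
  measurable_fun setT (fun p : tm * bE => fine (\int[P t p.1 p.2]_z (phi z)%:E)%E).
Proof.
move=> cphi phi01; have mphi := continuous_borel cphi.
have mphie : measurable_fun setT (fun z : bE => (phi z)%:E) by exact/measurable_EFinP.
have mk r : measurable_fun setT (fun y : bE => fine (\int[P t r y]_z (phi z)%:E)%E).
  apply: measurableT_comp => //; apply: measurable_fun_integral_kernel => //.
    by move=> U mU; exact: (measurable_kernel (P t r)).
  by move=> z; rewrite lee_fin; case/andP: (phi01 z).
have eqs := @eq_step_cvg_measurable R T _ bE (fun p => fine (\int[P t p.1 p.2]_z (phi z)%:E)%E)
  (fun n k y => fine (\int[P t (grid t0 n k.+1) y]_z (phi z)%:E)%E).
apply: eqs => // [n k|q y q0].
  exact: mk.
have e r : fine (\int[P t r y]_z (phi z)%:E)%E = \int[PP t y]_w phi (w r).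
  by rewrite /Rintegral law_integral.
rewrite /= e.
have ic : (PP t y).-integrable setT (EFin \o (cst (1 : R))) by exact: finite_measure_integrable_cst.
have [] := @dct_Rintegral _ _ _ (PP t y) setT
  (fun n w => stepf t0 n (fun k (w : Om) => phi (w (grid t0 n k.+1))) (q,
      w)) (fun w => phi (w q)) (cst 1)
  measurableT _ _ _ ic _.
- move=> n; have [k _ kq] := cell_exists n q0.
  rewrite (_ : (fun w : Om => _) = (fun w : Om => phi (w (grid t0 n k.+1)))).
    exact: measurable_cont_eval.
  by apply/funext => w; rewrite (stepfE _ _ kq).
- exact: measurable_cont_eval.
- by apply: aeW => w _; exact: right_step_cvg.
- apply: aeW => w n _; have [k _ kq] := cell_exists n q0; rewrite (stepfE _ _ kq)/=.
  by have /andP[? ?] := phi01 (w (grid t0 n k.+1)); rewrite ger0_norm.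
move=> _; apply: cvg_trans; apply: near_eq_cvg; apply: nearW => n.
have [k _ kq] := cell_exists n q0; rewrite (stepfE _ _ kq) e.
by apply: eq_Rintegral => w _; rewrite (stepfE _ _ kq).
Qed.

(** Jointly in the arrival time and the starting state. Open sets are reached from continuous
    functions through [uapprox]; the Dynkin argument does the rest. *)
Lemma measurable_pker_joint t (B : set bE) : measurable B ->
  measurable_fun setT (fun p : tm * bE => P t p.1 p.2 B).
Proof.
apply: (@dynkin_induction _ bE (@open E) (fun B => measurable_fun setT (fun p : tm * bE => P t p.1
    p.2 B))).
- by [].
- by move=> A A'; exact: openI.
- by under eq_fun do rewrite prob_kernel; exact: measurable_cst.
- move=> U oU.
  have mU : measurable (U : set bE) by exact: sub_gen_smallest.
  rewrite (_ : (fun p => _) = EFin \o (fun p : tm * bE => fine (P t p.1 p.2 U))); last first.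
    by apply/funext => p /=; rewrite fineK// pker_fin.
  apply/measurable_EFinP.
  apply: (@measurable_fun_cvg _ _ _ _ (fun m (p : tm * bE) => fine (\int[P t p.1 p.2]_z (uapprox U
      m z)%:E)%E)).
    by move=> m; apply: measurable_pker_cont; [exact: uapprox_continuous|exact: uapprox_bd].
  move=> [r y] _ /=.
  have ic : (P t r y).-integrable setT (EFin \o (cst (1 : R))).
    apply/integrableP; split; first exact/measurable_EFinP/measurable_cst.
    rewrite (_ : (\int[_]_z _)%E = (\int[P t r y]_z cst 1%E z)%E);
        last by apply: eq_integral => z _ /=; rewrite normr1.
    by rewrite integral_cst// mul1e prob_kernel ltry.
  have [] := @dct_Rintegral _ _ _ (P t r y) setT (fun m (z : bE) => uapprox U m z) (fun z => \1_U
      z) (cst 1)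
    measurableT _ _ _ ic _.
  + by move=> m; apply: continuous_borel; exact: uapprox_continuous.
  + exact: measurable_indic.
  + by apply: aeW => z _; exact: uapprox_cvg.
  + by apply: aeW => z m _; have /andP[? ?] := uapprox_bd U m z; rewrite ger0_norm.
  by move=> _; rewrite [X in _ --> X -> _]/Rintegral integral_indic// setIT.
- move=> A mA h; rewrite (_ : (fun p => _) = (fun p : tm * bE => 1 - P t p.1 p.2 A)%E).
    exact: emeasurable_funB.
  apply/funext => p; rewrite -setTD measureD ?setTI//.
    by congr (_ - _)%E; exact: prob_kernel.
  by rewrite -ge0_fin_numE// pker_fin.
- move=> F mF tF h.
  rewrite (_ : (fun p => _) = (fun p : tm * bE => \sum_(n <oo) P t p.1 p.2 (F n))%E).
    by apply: ge0_emeasurable_sum.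
  apply/funext => p; apply/esym/cvg_lim => //.
  by apply: measure_semi_sigma_additive => //; exact: bigcupT_measurable.
Qed.

End joint_kernel.

Section Markov_property.
Context {R : realType} {T : {nonneg R}} {E : completePseudoMetricType R}.
Local Notation tm := (time T).
Local Notation Om := (Omega T E).
Local Notation bE := (borel E).
Variable P : tm -> tm -> R.-pker bE ~> bE.
Variable PP : tm -> E -> probability Om R.
Hypothesis hPP : canonical_Markov_class P PP.
Variable mu : {finite_measure set tm -> \bar R}.
Implicit Types (s q r t : tm).

(** The uniform bound is strict, hence 2 for probabilities. *)
Lemma pker_path_uub t d (X : measurableType d) (k1 : X -> tm) (k2 : X -> Om) :
  measure_fam_uub (fun x : X => P t (k1 x) (k2 x t : bE)).
Proof. by exists 2 => x; rewrite (@prob_kernel _ _ _ _ _ (P t (k1 x))) lte_fin ltr1n. Qed.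

Lemma measurable_pker_path t (U : set bE) : measurable U ->
  measurable_fun setT (fun p : tm * Om => P t p.1 (p.2 t : bE) U).
Proof.
move=> mU; apply: (measurableT_comp (measurable_pker_joint hPP t mU)
  (g := fun p : tm * Om => (p.1, p.2 t : bE))).
apply: measurable_fun_pair => //.
exact: (measurableT_comp (measurable_eval t) measurable_snd).
Qed.

Lemma measurable_pker_path_integral t (F : tm * bE -> \bar R) : measurable_fun setT F ->
  (forall p, 0 <= F p)%E ->
  measurable_fun setT (fun p : tm * Om => \int[P t p.1 (p.2 t : bE)]_y F (p.1, y))%E.
Proof.
move=> mF F0.
have := @measurable_fkern_integral _ _ (tm * Om)%type bE R
  (fun p : tm * Om => P t p.1 (p.2 t : bE)) (measurable_pker_path t) (@pker_path_uub t _ (tm *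
      Om)%type fst snd)
  (fun z => F (z.1.1, z.2)).
apply=> //; apply: (measurableT_comp mF (g := fun z : tm * Om * bE => (z.1.1, z.2))).
apply: measurable_fun_pair => //.
exact: (measurableT_comp measurable_fst measurable_fst).
Qed.

(** For indicators this is the Markov property on the event A, which lies in [filt t]. Restricting
    the law to A makes [integral_mixture] applicable. *)
Lemma markov_cond s x t r (A : set Om) (Phi : bE -> \bar R) :
  s <= t :> R -> t <= r :> R -> measurable A -> na t A ->
  measurable_fun setT Phi -> (forall y, 0 <= Phi y)%E ->
  (\int[PP s x]_(w in A) \int[P t r (w t : bE)]_y Phi y = \int[PP s x]_(w in A) Phi (w r : bE))%E.
Proof.
move=> st tr mA nA mPhi Phi0.
have mk U : measurable U -> measurable_fun setT (fun w : Om => P t r (w t : bE) U).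
  by move=> mU; exact: (measurableT_comp (measurable_kernel (P t r) U mU) (measurable_eval t)).
have mPhir : measurable_fun setT (fun w : Om => Phi (w r : bE)).
  exact: (measurableT_comp mPhi (measurable_eval r)).
have mPhit : measurable_fun setT (fun w : Om => \int[P t r (w t : bE)]_y Phi y)%E.
  apply: (measurableT_comp (measurable_pker_path_integral t (F := fun z => Phi z.2) _ _)
    (g := fun w : Om => (r, w))) => //.
    exact: (measurableT_comp mPhi measurable_snd).
  exact: measurable_pair1.
rewrite -[LHS](integral_mrestr _ mA)//; last by move=> w; apply: integral_ge0.
rewrite -[RHS](integral_mrestr _ mA)//.
apply: (integral_mixture (phi := fun w : Om => w r : bE)) => //.
- by rewrite /= /mrestr setTI (le_lt_trans (probability_le1 _ mA)) ?ltry.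
- exact: (@pker_path_uub t _ _ (fun=> r) id).
- exact: measurable_eval.
move=> U mU; have [_ /(_ s x t r U mU st tr)[_ _ _ /(_ A (filt_na mA nA)) h]] := hPP.
rewrite (integral_mrestr _ mA)//; last exact: mk.
transitivity (\int[PP s x]_(w in A) (fine (P t r (w t : bE) U))%:E)%E.
  by apply: eq_integral => w _; rewrite fineK// pker_fin.
rewrite h (eq_integral (fun w => (\1_((fun w : Om => w r : bE) @^-1` U) w)%:E)).
  rewrite integral_indic// -[X in measurable X]setTI.
  exact: (measurable_eval r measurableT mU).
by move=> w _.
Qed.

Lemma tonelli_in (Pr : probability Om R) t (A : set Om) (G : tm * Om -> \bar R) :
  measurable A -> measurable_fun setT G -> (forall p, 0 <= G p)%E ->
  (\int[Pr]_(w in A) \int[mu]_(q in oc t tT) G (q, w) =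
   \int[mu]_(q in oc t tT) \int[Pr]_(w in A) G (q, w))%E.
Proof.
move=> mA mG G0.
have m1 : measurable_fun setT (fun p : tm * Om => (\1_A p.2 : R)%:E).
  by apply/measurable_EFinP; exact: (measurableT_comp (measurable_indic mA) measurable_snd).
have mGA : measurable_fun setT (fun p : tm * Om => G p * (\1_A p.2)%:E)%E.
  exact: emeasurable_funM.
have GA0 p : (0 <= G p * (\1_A p.2)%:E)%E by rewrite mule_ge0// lee_fin.
transitivity (\int[Pr]_w \int[mu]_(q in oc t tT) (G (q, w) * (\1_A w)%:E))%E.
  rewrite integral_mkcond epatch_indic; apply: eq_integral => w _ /=.
  by rewrite ge0_integralZr//; [exact: measurable_oc|exact/measurable_funTS/(measurableT_comp mG)].
rewrite -(tonelli_cyl2 Pr mu t tT mGA GA0) (tonelli_cyl Pr mu t tT mGA GA0).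
by apply: eq_integral => q _; rewrite [RHS]integral_mkcond epatch_indic.
Qed.

(** Tonelli on both sides reduces the identity to [markov_cond] at each fixed r. *)
Lemma markov_cond_int s x t (A : set Om) (F : tm * bE -> \bar R) :
  s <= t :> R -> measurable A -> na t A -> measurable_fun setT F -> (forall p, 0 <= F p)%E ->
  (\int[PP s x]_(w in A) \int[mu]_(r in oc t tT) \int[P t r (w t : bE)]_y F (r, y) =
   \int[PP s x]_(w in A) \int[mu]_(r in oc t tT) F (r, w r : bE))%E.
Proof.
move=> st mA nA mF F0.
rewrite (tonelli_in _ t mA (measurable_pker_path_integral t mF F0)); last first.
  by move=> p; exact: integral_ge0.
have mFX : measurable_fun setT (fun p : tm * Om => F (p.1, p.2 p.1 : bE)).
  apply: (measurableT_comp mF (g := fun p : tm * Om => (p.1, p.2 p.1 : bE))).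
  by apply: measurable_fun_pair => //; exact: measurable_X.
rewrite (tonelli_in _ t mA mFX)//; apply: eq_integral => r; rewrite inE => -[tr _].
have H := markov_cond (Phi := fun y => F (r, y)) x st (ltW tr) mA nA
  (measurableT_comp mF (measurable_pair1 r)) (fun y => F0 (r, y)).
exact: H.
Qed.

End Markov_property.

(** * Mild solutions as martingales *)

Section drift_uniqueness.
Context {R : realType} {T : {nonneg R}} {E : completePseudoMetricType R}.
Local Notation tm := (time T).
Local Notation Om := (Omega T E).
Local Notation bE := (borel E).
Variables (Pr : probability Om R) (mu : {finite_measure set tm -> \bar R}).
Hypothesis mu_atom : forall t, mu [set t] = 0%E.
Variable s : tm.
Implicit Types (q r t : tm).
Local Notation iint := (iint Pr mu).
Local Notation ig := (ig Pr mu).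
Variables (S : tm * Om -> R) (b1 b2 : tm * bE -> R).
Hypotheses (mb1 : measurable_fun setT b1) (mb2 : measurable_fun setT b2).
Local Notation Int b := (fun p : tm * Om => \int[mu]_(q in oc s p.1) onX b (q, p.2)).
Hypotheses (mM1 : amart Pr s (fun p => S p - Int b1 p)) (mM2 : amart Pr s (fun p => S p - Int b2 p)).
Hypotheses
  (ib1 : \forall w \ae Pr, mu.-integrable (oc s tT) (fun q => (onX b1 (q, w))%:E))
  (ib2 : \forall w \ae Pr, mu.-integrable (oc s tT) (fun q => (onX b2 (q, w))%:E)).
Let h (p : tm * Om) := onX b1 p - onX b2 p.
Let k (p : tm * Om) := `|onX b1 p| + `|onX b2 p|.

Let mh : measurable_fun setT h.
Proof. by apply: measurable_funB; exact: measurable_onX. Qed.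

Let mk : measurable_fun setT k.
Proof. by apply: measurable_funD; apply: measurableT_comp => //; exact: measurable_onX. Qed.

Let nh (q : tm) : s <= q :> R -> na q (fun w => h (q, w)).
Proof. by move=> _ w; rewrite /h !na_onX. Qed.

Let nk (q : tm) : s <= q :> R -> na q (fun w => k (q, w)).
Proof. by move=> _ w; rewrite /k !na_onX. Qed.

Let k0 p : 0 <= k p. Proof. exact: addr_ge0. Qed.

Let hk p : `|h p| <= k p. Proof. exact: ler_normB. Qed.

Let kfin : \forall w \ae Pr, (clockp mu s k (tT, w) < +oo)%E.
Proof.
apply: filterS (filterI ib1 ib2) => w [i1 i2].
have := integrableD_R (measurable_oc s tT) (integrable_norm i1) (integrable_norm i2).
move=> /integrableP[_]; apply: le_lt_trans; rewrite le_eqVlt; apply/orP; left; apply/eqP.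
by apply: eq_integral => q _; rewrite /= ger0_norm// addr_ge0.
Qed.

Section level.
Variable n : nat.
Local Notation chi := (chi mu s k n).
Local Notation chi' := (chi' mu s k n).

(** The difference of the two martingales is a process of finite variation. The drift of chi times
    it is computed in two ways, by the martingale rule and by Leibniz' rule; chi h is the
    discrepancy, carried by the null process. *)
Lemma drift_truncated : drift Pr mu s (fun=> 0) (fun p => chi p * h p).
Proof.
have fchi := fv_chi mu_atom mk nk k0 n.
have mChi := fv_mD fchi; have mChi' := fv_md fchi.
have n0 : (0 : R) <= n.+1%:R by [].
have ftr := fv_trunc mu_atom mk nk k0 (0 : R) n0 mh nh hk.
have D1 := drift_mart_fv mM1 fchi; have D2 := drift_mart_fv mM2 fchi.
have D3 := drift_fv Pr (fv_mul mu_atom fchi ftr).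
pose L (p : tm * Om) := Int b1 p - Int b2 p.
have mL : measurable_fun setT L.
  by apply: measurable_funB; apply: measurable_int_r; exact: measurable_onX.
have D4 : drift Pr mu s (fun p => chi p * L p) (fun p => chi p * h p + chi' p * L p).
  apply: (drift_ae _ _ _ D3).
  - exact: measurable_funM.
  - by apply: measurable_funD; exact: measurable_funM.
  apply: filterS (filterI kfin (filterI ib1 ib2)) => w [Kw [i1 i2]] q sq /=.
  case: (eqVneq (below mu s k n.+1%:R (q, w)) 0) => hb.
    have h1 : chi (q, w) = 0 by apply/eqP/negPn/negP => /(chi_below mu_atom mk k0 sq Kw)/eqP.
    have h2 : chi' (q, w) = 0 by apply/eqP/negPn/negP => /(chi'_below k0); rewrite hb eqxx.
    by rewrite h1 h2; split; ring.
  have h1 : below mu s k n.+1%:R (q, w) = 1.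
    by move: hb; rewrite /below indicE; case: (_ \in _) => //=; rewrite eqxx.
  have iq b : mu.-integrable (oc s tT) (fun q => (onX b (q, w))%:E) ->
      mu.-integrable (oc s q) (fun q => (onX b (q, w))%:E).
    apply: (integrableS (measurable_oc s tT)); first exact: measurable_oc.
    by apply: sub_oc => //; exact: le_tT.
  rewrite (trunc_eq mk k0 _ hb) h1 /h /L/= (RintegralB (measurable_oc s q) (iq _ i1) (iq _ i2)).
  by split; ring.
(* In the sum the values cancel, and so do the terms in chi'. *)
have D := driftD (driftB D1 D2) D4.
by apply: eq_drift D => p; rewrite /L /=; ring.
Qed.

Let ie : ig s tT (fun p => chi p * h p) := drift_ige drift_truncated.

Lemma truncated_steps nn g K : adm s nn g K ->
  iint s tT (fun p => stepf s nn g p * (chi p * h p)) = 0.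
Proof.
move=> [mg ng gK]; have iA := ig_step nn mg gK ie.
rewrite -(gridN_tT s nn); elim: (gridN nn) => [|j IH].
  by rewrite grid0 /iint /cyl oc0 !set0X !Rintegral_set0.
set t := grid s nn j; set t' := grid s nn j.+1.
have st : (s : R) <= (t : R).
  by rewrite -[X in X <= _](congr1 (@Defs.tval _ _) (grid0 s nn)); exact: grid_le.
have tt' : (t : R) <= (t' : R) by exact: grid_le.
rewrite (iintU st tt'); last by apply: igS iA => //; exact: le_tT.
rewrite IH add0r; transitivity (iint t t' (fun p => g j p.2 * (chi p * h p))).
  by apply: eq_Rintegral => -[q w] /set_mem[qt _]; rewrite (stepfE _ _ qt).
rewrite -(drift_eq drift_truncated st tt' (mg j) (ng j)); last by exists K.
by rewrite subrr.
Qed.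

(** The sign of b1 - b2 is a bounded function of time and state, hence an admissible test function
    for [step_orthogonal]. *)
Lemma truncated_abs : iint s tT (fun p => chi p * `|h p|) = 0.
Proof.
pose sg (p : tm * bE) : R := \1_[set p | b2 p < b1 p] p - \1_[set p | b1 p < b2 p] p.
have mlt (b b' : tm * bE -> R) : measurable_fun setT b -> measurable_fun setT b' ->
    measurable [set p | b p < b' p].
  move=> mb mb'; rewrite -[X in measurable X]setTI.
  exact: (measurable_fun_ltr mb mb' measurableT (Y := [set true])).
have m12 := mlt _ _ mb2 mb1; have m21 := mlt _ _ mb1 mb2.
have msg : measurable_fun setT sg by apply: measurable_funB; exact: measurable_indic.
have sg1 p : `|sg p| <= 1.
  by rewrite /sg !indicE; case: (_ \in _); case: (_ \in _);
      rewrite ?subrr ?subr0 ?sub0r ?normrN ?normr0 ?normr1.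
have me : measurable_fun setT (fun p => chi p * h p).
  apply: measurable_funM => //; exact: (fv_mD (fv_chi mu_atom mk nk k0 n)).
rewrite -(step_orthogonal mu_atom me ie truncated_steps msg sg1).
apply: eq_iint => p; rewrite mulrCA; congr (_ * _).
have mem (b b' : tm * bE -> R) z : (z \in [set p | b p < b' p]) = (b z < b' z).
  by apply/idP/idP => [/set_mem|/mem_set].
rewrite /h /onX /sg !indicE !mem.
set z := (p.1, _); case: (ltgtP (b1 z) (b2 z)) => H /=.
- by rewrite ltr0_norm ?subr_lt0//; ring.
- by rewrite gtr0_norm ?subr_gt0//; ring.
- by rewrite H !subrr normr0 mulr0.
Qed.

End level.

(** The weight tends to 1 along almost every path, so Fatou turns the vanishing of all weighted
    integrals into that of the integral of |b1 - b2|. *)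
Lemma drift_unique : \forall p \ae (mu \x Pr)%E, cyl s tT p -> onX b1 p = onX b2 p.
Proof.
have mchi n : measurable_fun setT (chi mu s k n) := fv_mD (fv_chi mu_atom mk nk k0 n).
have chi0 n : \forall w \ae Pr, forall q, s <= q :> R -> 0 <= chi mu s k n (q, w).
  by apply: filterS kfin => w Kw q sq; case/andP: (chi01 mu_atom mk k0 n sq Kw).
have H0 : (\int[mu \x Pr]_(p in cyl s tT) (`|h p|)%:E <= 0%:E)%E.
  apply: (@fatou_bound _ _ _ _ _ (measurable_cyl s tT) (fun n p => `|chi mu s k n p| * `|h p|)).
  - by move=> n; apply: measurable_funTS; apply: measurable_funM; exact: measurableT_comp.
  - by apply: measurable_funTS; exact: measurableT_comp.
  - by move=> n p; exact: mulr_ge0.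
  - apply: ae_cyl_from.
    apply: filterS kfin => w Kw q /= sq; apply: cvg_near_cst.
    have hc := chi_cvg mu_atom mk k0 sq Kw.
    by apply: filterS hc => n ->; rewrite normr1 mul1r.
  move=> n; have ia : ig s tT (fun p => `|chi mu s k n p| * `|h p|).
    by apply: eq_ig (ig_norm (drift_ige (drift_truncated n))) => p; rewrite normrM.
  have -> : (\int[mu \x Pr]_(p in cyl s tT) (`|chi mu s k n p| * `|h p|)%:E =
      \int[mu \x Pr]_(p in cyl s tT) (chi mu s k n p * `|h p|)%:E)%E.
    apply: ae_eq_integral => //; [exact: measurable_cyl|exact: (measurable_int _ ia)| |].
      apply/measurable_EFinP/measurable_funTS/measurable_funM => //.
      exact: measurableT_comp.
    by apply: ae_cyl_from; apply: filterS (chi0 n) => w c0 q sq; rewrite ger0_norm ?c0.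
  have := truncated_abs n; rewrite /iint /Rintegral.
  set I := (\int[_]_(p in _) _)%E => I0; rewrite -I0 fineK//.
  rewrite /I; apply: (integrable_fin_num (measurable_cyl s tT)).
  apply: (ae_integrable_R (measurable_cyl s tT) _ ia).
    by apply: measurable_funTS; apply: measurable_funM => //; exact: measurableT_comp.
  by apply: ae_cyl_from; apply: filterS (chi0 n) => w c0 q sq; rewrite ger0_norm ?c0.
have mhe : measurable_fun (cyl s tT) (fun p => (`|h p|)%:E).
  by apply/measurable_EFinP/measurable_funTS/measurableT_comp.
have : (\int[mu \x Pr]_(p in cyl s tT) (`|h p|)%:E = 0)%E.
  by apply/eqP; rewrite eq_le H0 integral_ge0.
have := ae_eq_integral_abs (mu \x Pr)%E (measurable_cyl s tT) mhe.
under eq_integral do rewrite /= normr_id.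
move=> -> ; apply: filterS => p /[apply] -[] /eqP.
by rewrite normr_eq0 subr_eq0 => /eqP.
Qed.

End drift_uniqueness.

Section conditioning.
Context {R : realType} {T : {nonneg R}} {E : completePseudoMetricType R}.
Local Notation tm := (time T).
Local Notation Om := (Omega T E).
Variable Pr : probability Om R.
Implicit Types (s q r t : tm) (X Y : Om -> R).
Local Notation igP := (igP Pr).

(** Equality of conditional expectations at t, stated on the events unchanged by stopping;
    adaptedness of X is checked apart, where it is used. *)
Definition cexp t X Y := [/\ igP X, igP Y & forall A, measurable A -> na t A ->
  (\int[Pr]_(w in A) (X w)%:E = \int[Pr]_(w in A) (Y w)%:E)%E].

Lemma cexpB t X Y X' Y' : cexp t X Y -> cexp t X' Y' ->
  cexp t (fun w => X w - X' w) (fun w => Y w - Y' w).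
Proof.
move=> [iX iY e] [iX' iY' e']; split; [exact: igPB|exact: igPB|].
move=> A mA nA; have iS Z : igP Z -> Pr.-integrable A (EFin \o Z) by exact: integrableS.
transitivity (\int[Pr]_(w in A) (X w)%:E - \int[Pr]_(w in A) (X' w)%:E)%E.
  by apply: (integralB_EFin mA); exact: iS.
by rewrite e// e'//; apply/esym/(integralB_EFin mA); exact: iS.
Qed.

(** The Markov property is obtained in [0, +oo]. A finite expectation of Y makes both variables
    almost surely finite, so that [fine] changes no integral. *)
Lemma cexp_fine t (U Y : Om -> \bar R) : measurable_fun setT U -> measurable_fun setT Y ->
  (forall w, 0 <= U w)%E -> (forall w, 0 <= Y w)%E -> (\int[Pr]_w Y w < +oo)%E ->
  (forall A, measurable A -> na t A -> (\int[Pr]_(w in A) U w = \int[Pr]_(w in A) Y w)%E) ->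
  cexp t (fun w => fine (U w)) (fun w => fine (Y w)).
Proof.
move=> mU mY U0 Y0 fY e; have fU : (\int[Pr]_w U w < +oo)%E by rewrite e.
have key (Z : Om -> \bar R) : measurable_fun setT Z -> (forall w, 0 <= Z w)%E ->
    (\int[Pr]_w Z w < +oo)%E ->
    igP (fun w => fine (Z w)) /\
    forall A, measurable A -> (\int[Pr]_(w in A) (fine (Z w))%:E = \int[Pr]_(w in A) Z w)%E.
  move=> mZ Z0 fZ.
  have iZ : Pr.-integrable setT Z.
    apply/integrableP; split => //; apply: le_lt_trans fZ; rewrite le_eqVlt; apply/orP; left.
    by apply/eqP; apply: eq_integral => w _; rewrite gee0_abs.
  have mf : measurable_fun setT (fun w => (fine (Z w))%:E).
    by apply/measurable_EFinP; exact: measurableT_comp.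
  have ae : \forall w \ae Pr, (fine (Z w))%:E = Z w.
    by apply: filterS (integrable_ae measurableT iZ) => w /(_ I) ?; rewrite fineK.
  have eqA A : measurable A -> (\int[Pr]_(w in A) (fine (Z w))%:E = \int[Pr]_(w in A) Z w)%E.
    move=> mA; apply: ae_eq_integral => //; [exact: measurable_funTS|exact: measurable_funTS|].
    by apply: filterS ae => w -> _.
  split => //; apply/integrableP; split => //; apply: le_lt_trans fZ; rewrite -eqA// le_eqVlt;
      apply/orP; left.
  by apply/eqP; apply: eq_integral => w _; rewrite /= ger0_norm// fine_ge0.
have [iU eU] := key U mU U0 fU; have [iY eY] := key Y mY Y0 fY.
by split => // A mA nA; rewrite eU// eY// e.
Qed.

End conditioning.

Lemma integral_pos d (X : measurableType d) (R : realType) (nu : {measure set X -> \bar R})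
    (A : set X) (f : X -> R) :
  (\int[nu]_(x in A) (f x)%:E =
   \int[nu]_(x in A) (pos (f x))%:E - \int[nu]_(x in A) (pos (- f x))%:E)%E.
Proof.
by rewrite integralE; congr (_ - _)%E; apply: eq_integral => x _;
   rewrite ?funeposE ?funenegE /pos EFin_max.
Qed.

Section mild_martingale.
Context {R : realType} {T : {nonneg R}} {E : completePseudoMetricType R}.
Local Notation tm := (time T).
Local Notation Om := (Omega T E).
Local Notation bE := (borel E).
Variable (PP : tm -> E -> probability Om R).
Variable V : clock T.
Variable P : tm -> tm -> R.-pker bE ~> bE.
Hypothesis hPP : canonical_Markov_class P PP.
Implicit Types (s q r t : tm) (x : E) (phi F : tm * bE -> R).
Local Notation mu := (muV V).

Definition kend phi t (y : bE) : \bar R := (\int[P t tT y]_z (phi (tT, z))%:E)%E.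
Definition krun F t (y : bE) : \bar R :=
  (\int[dV V]_(r in oc t tT) \int[P t r y]_z (F (r, z))%:E)%E.

Lemma cexp_end phi s x t : measurable_fun setT phi -> (forall p, 0 <= phi p) ->
  igP (PP s x) (fun w => onX phi (tT, w)) -> s <= t :> R ->
  cexp (PP s x) t (fun w => fine (kend phi t (w t))) (fun w => onX phi (tT, w)).
Proof.
move=> mphi phi0 iphi st.
have mphie : measurable_fun setT (fun z : tm * bE => (phi z)%:E) by exact/measurable_EFinP.
have mT : measurable_fun setT (fun y : bE => (phi (tT, y))%:E).
  exact: (measurableT_comp mphie (measurable_pair1 tT)).
apply: (@cexp_fine _ _ _ _ _ (fun w => kend phi t (w t)) (fun w => (onX phi (tT, w))%:E)).
- exact: (measurableT_comp (measurable_pker_path_integral hPP t mphie (fun p => phi0 p))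
    (measurable_pair1 tT)).
- by have /integrableP[] := iphi.
- by move=> w; apply: integral_ge0 => z _; rewrite lee_fin.
- by move=> w; rewrite lee_fin phi0.
- have /integrableP[_] := iphi; apply: le_lt_trans; rewrite le_eqVlt; apply/orP; left.
  by apply/eqP; apply: eq_integral => w _; rewrite /= ger0_norm// phi0.
- move=> A mA nA; exact: (markov_cond hPP x st (le_tT t) mA nA mT (fun y => phi0 (tT, y))).
Qed.

Lemma cexp_run F s x t : measurable_fun setT F -> (forall p, 0 <= F p) ->
  ig (PP s x) mu s tT (onX F) -> s <= t :> R ->
  cexp (PP s x) t (fun w => fine (krun F t (w t)))
    (fun w => \int[mu]_(q in oc t tT) onX F (q, w)).
Proof.
move=> mF F0 iF st; have sub := igS st (le_tT tT) iF.
have mFe : measurable_fun setT (fun z : tm * bE => (F z)%:E) by exact/measurable_EFinP.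
have mX : measurable_fun setT (fun p : tm * Om => (onX F p)%:E).
  by apply/measurable_EFinP; exact: measurable_onX.
apply: (@cexp_fine _ _ _ _ _ (fun w => krun F t (w t))
  (fun w => \int[mu]_(q in oc t tT) (onX F (q, w))%:E)%E).
- apply: (measurableT_comp (@measurable_int_e _ _ _ mu t _
    (measurable_pker_path_integral hPP t mFe (fun p => F0 p)) _) (measurable_pair1 tT)).
  by move=> p; apply: integral_ge0 => z _; rewrite lee_fin.
- exact: (measurableT_comp (@measurable_int_e _ _ _ mu t _ mX (fun p => F0 _)) (measurable_pair1 tT)).
- by move=> w; apply: integral_ge0 => r _; apply: integral_ge0 => z _; rewrite lee_fin.
- by move=> w; apply: integral_ge0 => r _; rewrite lee_fin F0.
- rewrite -(@tonelli_cyl2 _ _ _ (PP s x) mu t tT _ mX (fun p => F0 _)).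
  have /integrableP[_] := sub; apply: le_lt_trans; rewrite le_eqVlt; apply/orP; left.
  by apply/eqP; apply: eq_integral => p _; rewrite /= ger0_norm// F0.
- move=> A mA nA; exact: (markov_cond_int hPP mu x st mA nA mFe (fun p => F0 p)).
Qed.

Lemma kernel_iint F s x : measurable_fun setT F -> ig (PP s x) mu s tT (onX F) ->
  krun F s x = (iint (PP s x) mu s tT (onX F))%:E.
Proof.
move=> mF iF; rewrite fineK; last exact: (integrable_fin_num (measurable_cyl _ _) iF).
rewrite [RHS]integral_mkcond restrict_EFin -(integral12_prod_meas1 (restr_ig iF)).
rewrite [LHS]integral_mkcond; apply: eq_integral => r _; rewrite patchE.
under [RHS]eq_integral do rewrite /= patch_cyl patchE.
case: ifPn => rs; last by rewrite integral0.
rewrite (law_integral hPP)//; apply/measurable_EFinP; exact: (measurableT_comp mF (measurable_pair1 r)).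
Qed.

(** By the Markov property, phi(t, X_t) is the conditional expectation at t of phi(T, X_T) minus the
    integral of F from t to T. Subtracting the integral from s to t makes the process closed by its
    terminal value. *)
Lemma mild_mart phi F s x : measurable_fun setT phi -> measurable_fun setT F ->
  (forall t y, igP (PP t y) (fun w => onX phi (tT, w))) ->
  (forall t y, ig (PP t y) mu t tT (onX F)) ->
  (forall t y, (phi (t, y))%:E = (kend phi t y - krun F t y)%E) ->
  amart (PP s x) s (fun p => onX phi p - \int[mu]_(q in oc s p.1) onX F (q, p.2)).
Proof.
move=> mphi mF iphi iF e.
have mpp (f : tm * bE -> R) : measurable_fun setT f -> measurable_fun setT (fun p : tm * bE => pos
    (f p)).
  by move=> mf; exact: (measurableT_comp (@measurable_pos R) mf).
have mpn (f : tm * bE -> R) : measurable_fun setT f -> measurable_fun setT (fun p : tm * bE => pos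
    (- f p)).
  by move=> mf; apply: mpp; exact: measurableT_comp.
have le_pos (z : R) : `|pos z| <= `|z| by rewrite ger0_norm ?pos_ge0// pos_le.
have le_posN (z : R) : `|pos (- z)| <= `|z| by rewrite -[leRHS]normrN.
pose p1 p := pos (phi p); pose p2 p := pos (- phi p); pose f1 p := pos (F p); pose f2 p := pos (- F p).
have [mp1 mp2] := (mpp _ mphi, mpn _ mphi); have [mf1 mf2] := (mpp _ mF, mpn _ mF).
have mTx (f : tm * bE -> R) : measurable_fun setT f -> measurable_fun setT (fun w : Om => onX f (tT, w)).
  by move=> mf; apply: measurable_sec; exact: measurable_onX.
have ip1 t y : igP (PP t y) (fun w => onX p1 (tT, w)).
  apply: (integrable_dom measurableT _ (iphi t y)) => [|w _]; [exact: mTx|exact: le_pos].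
have ip2 t y : igP (PP t y) (fun w => onX p2 (tT, w)).
  apply: (integrable_dom measurableT _ (iphi t y)) => [|w _]; [exact: mTx|exact: le_posN].
have if1 t y : ig (PP t y) mu t tT (onX f1).
  apply: (integrable_dom (measurable_cyl _ _) _ (iF t y)) => [|w _]; last exact: le_pos.
  by apply: measurable_funTS; exact: measurable_onX.
have if2 t y : ig (PP t y) mu t tT (onX f2).
  apply: (integrable_dom (measurable_cyl _ _) _ (iF t y)) => [|w _]; last exact: le_posN.
  by apply: measurable_funTS; exact: measurable_onX.
have finend (f : tm * bE -> R) t (y : E) : measurable_fun setT f -> igP (PP t y) (fun w => onX f
    (tT, w)) ->
    kend f t y \is a fin_num.
  move=> mf jf; rewrite /kend (law_integral hPP).
    exact: (integrable_fin_num measurableT jf).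
  by apply/measurable_EFinP; exact: (measurableT_comp mf (measurable_pair1 tT)).
(* The Markov property is available for nonnegative functions, so both terms are split into positive
   and negative parts, all four of them finite. *)
have dec t y : phi (t, y) = (fine (kend p1 t y) - fine (kend p2 t y)) -
    (fine (krun f1 t y) - fine (krun f2 t y)).
  have := e t y; rewrite (kernel_iint mF (iF t y)) {1}/kend integral_pos -/(kend p1 t y) -/(kend p2 t y).
  rewrite -(fineK (finend _ t y mp1 (ip1 t y))) -(fineK (finend _ t y mp2 (ip2 t y))).
  rewrite (kernel_iint mf1 (if1 t y)) (kernel_iint mf2 (if2 t y)) -!EFinB => -[->] /=.
  congr (_ - _); rewrite -(iintB (if1 t y) (if2 t y)); apply: eq_iint => p.
  by rewrite /onX /f1 /f2 posN.
have ipF := ig_path (iF s x).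
have cx t : s <= t :> R -> cexp (PP s x) t (fun w => onX phi (t, w))
    (fun w => (onX p1 (tT, w) - onX p2 (tT, w)) -
      (\int[mu]_(q in oc t tT) onX f1 (q, w) - \int[mu]_(q in oc t tT) onX f2 (q, w))).
  move=> st; have := cexpB
    (cexpB (cexp_end mp1 (fun p => pos_ge0 _) (ip1 s x) st) (cexp_end mp2 (fun p => pos_ge0 _) (ip2
        s x) st))
    (cexpB (cexp_run mf1 (fun p => pos_ge0 _) (if1 s x) st) (cexp_run mf2 (fun p => pos_ge0 _) (if2
        s x) st)).
  by congr cexp; apply/funext => w; rewrite /onX dec.
pose J t w := \int[mu]_(q in oc s t) onX F (q, w).
(* The candidate martingale; [closed] shows that W t is the conditional expectation of its value at
   T. *)
pose W t w := onX phi (t, w) - J t w.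
have iJ t : igP (PP s x) (J t) by apply: igP_int; exact: (igS (lexx _) (le_tT t) (iF s x)).
have mphiX := measurable_onX mphi; have mFX := measurable_onX mF.
have closed t : s <= t :> R -> igP (PP s x) (W t) /\ forall A, measurable A -> na t A ->
    (\int[PP s x]_(w in A) (W t w)%:E = \int[PP s x]_(w in A) (W tT w)%:E)%E.
  move=> st; have iS Z A : igP (PP s x) Z -> measurable A -> (PP s x).-integrable A (EFin \o Z).
    by move=> iZ mA; exact: integrableS iZ.
  have [i1 i2 eA] := cexpB (cx t st) (And3 (iJ t) (iJ t) (fun A _ _ => erefl)).
  split; first exact: i1.
  move=> A mA nA; apply: (etrans (eA A mA nA)).
  apply: ae_eq_integral => //.
  - exact: (measurable_int _ (iS _ _ i2 mA)).
  - exact: (measurable_int _ (iS _ _ (igPB (iphi s x) (iJ tT)) mA)).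
  apply: filterS ipF => w iw _; congr EFin; rewrite /W /J.
  have iw' r t' : s <= r :> R -> mu.-integrable (oc r t') (EFin \o (fun q => onX F (q, w))).
    move=> sr; apply: (integrableS (measurable_oc s tT)) iw; first exact: measurable_oc.
    by apply: sub_oc => //; exact: le_tT.
  have mw : measurable_fun setT (fun q => onX F (q, w)) by exact: measurable_time_sec.
  rewrite -(RintegralB (measurable_oc t tT)); first last.
  - apply: (integrable_dom (measurable_oc _ _) _ (iw' t tT st)) => [|q _]; last exact: le_posN.
    by apply: measurable_funTS; apply: (measurableT_comp (@measurable_pos R)); exact: measurableT_comp.
  - apply: (integrable_dom (measurable_oc _ _) _ (iw' t tT st)) => [|q _]; last exact: le_pos.
    by apply: measurable_funTS; exact: (measurableT_comp (@measurable_pos R)).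
  rewrite (_ : onX p1 _ - onX p2 _ = onX phi (tT, w)); last exact: posN.
  under eq_Rintegral do rewrite /onX /f1 /f2 posN -/(onX F _).
  rewrite (ocU st (le_tT t)) Rintegral_setU//; first by ring.
  - exact: measurable_oc.
  - exact: measurable_oc.
  - by rewrite -(ocU st (le_tT t)); exact: iw'.
  - exact: oc_disj.
split.
- by apply: measurable_funB => //; exact: measurable_int_r.
- move=> q sq w /=; congr (_ - _); first exact: na_onX.
  exact: (@na_int _ _ _ mu s q (onX F) (fun q _ => @na_onX _ _ _ F q) w).
- by move=> t st; have [] := closed t st.
- move=> q t A sq qt mA nA; have [_ e1] := closed q sq; have [_ e2] := closed t (le_trans sq qt).
  exact: (etrans (e2 A mA (na_le qt nA)) (esym (e1 A mA nA))).
Qed.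

End mild_martingale.

(** * Classical and mild solutions *)

Section setting.
Context {R : realType} {T : {nonneg R}} {E : completePseudoMetricType R}.
Local Notation tm := (time T).
Local Notation Om := (Omega T E).
Local Notation bE := (borel E).
Variable (PP : tm -> E -> probability Om R).
Variables (D : set (tm * bE -> R)) (a : (tm * bE -> R) -> tm * bE -> R).
Variable V : clock T.
Hypothesis ha : linear_operator D a.
Hypothesis hmp : solves_martingale_problem PP D a V.
Implicit Types (s q r t : tm) (x : E) (phi : tm * bE -> R).
Local Notation mu := (muV V).

Definition mpF phi s (p : tm * Om) : R :=
  onX phi p - \int[mu]_(q in oc s p.1) onX (a phi) (q, p.2).

Lemma measurable_D phi : D phi -> measurable_fun setT phi /\ measurable_fun setT (a phi).
Proof. by move=> Dphi; case: ha => h _ _; exact: h. Qed.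

Lemma measurable_mpF phi s : D phi -> measurable_fun setT (mpF phi s).
Proof.
move=> /measurable_D[m1 m2]; apply: measurable_funB; first exact: measurable_onX.
by apply: measurable_int_r; exact: measurable_onX.
Qed.

Lemma na_mpF phi s t : na t (fun w => mpF phi s (t, w)).
Proof.
move=> w; rewrite /mpF/=; congr (_ - _); first exact: na_onX.
exact: (@na_int _ _ _ mu s t (onX (a phi)) (fun q _ => @na_onX _ _ _ (a phi) q) w).
Qed.

Lemma mp_mart phi s x : D phi -> amart (PP s x) s (mpF phi s).
Proof.
move=> Dphi; have [_ /(_ _ Dphi)[_ [hM _ _]]] := hmp s x.
apply: (mart_of_martingale (lexx _) hM); first exact: measurable_mpF.
- by move=> q _; exact: na_mpF.
- by move=> t _; exact: aeW.
Qed.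

Lemma mp_sqint phi s x : D phi -> sqint (PP s x) s (mpF phi s).
Proof.
move=> Dphi t st; have [_ /(_ _ Dphi)[_ [_ /(_ t st) h _]]] := hmp s x.
have m1 : measurable_fun setT (fun w => (mpF phi s (t, w) ^+ 2)%:E).
  apply/measurable_EFinP; apply: measurable_funX.
  by apply: measurable_sec; exact: measurable_mpF.
apply/integrableP; split => //.
rewrite (_ : (\int[_]_w _)%E = (\int[PP s x]_w (mpF phi s (t, w) ^+ 2)%:E)%E).
  by rewrite completion_integral.
by apply: eq_integral => w _; rewrite /= ger0_norm// sqr_ge0.
Qed.

Lemma mp_path phi s x : D phi ->
  \forall w \ae PP s x, mu.-integrable (oc s tT) (fun q => (onX (a phi) (q, w))%:E).
Proof. by move=> Dphi; have [_ /(_ _ Dphi)[h _]] := hmp s x. Qed.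

Lemma LX2P phi : LX PP V 2 phi <-> measurable_fun setT phi /\ forall s x,
  (\int[mu \x PP s x]_(p in cyl s tT) (onX phi p ^+ 2)%:E < +oo)%E.
Proof.
have e s x : measurable_fun setT phi ->
    (\int[mu \x PP s x]_(p in cyl s tT) (onX phi p ^+ 2)%:E =
    \int[PP s x]_w \int[dV V]_(r in oc s tT) (`|phi (r, w r)| `^ 2)%:E)%E.
  move=> mphi; have m1 : measurable_fun setT (fun p : tm * Om => (onX phi p ^+ 2)%:E).
    by apply/measurable_EFinP; apply: measurable_funX; exact: measurable_onX.
  rewrite (@tonelli_cyl2 _ _ _ (PP s x) mu s tT _ m1); last by move=> p; rewrite lee_fin sqr_ge0.
  apply: eq_integral => w _; apply: eq_integral => r _; congr EFin.
  by rewrite powR_mulrn// real_normK// num_real.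
by split => -[mphi h]; split => // s x; [rewrite e|rewrite -e].
Qed.

Lemma ig_L2 phi s x : LX PP V 2 phi -> ig (PP s x) mu s tT (fun p => onX phi p ^+ 2).
Proof.
move=> /LX2P[mphi h]; apply/integrableP; split.
  by apply/measurable_EFinP/measurable_funTS; apply: measurable_funX; exact: measurable_onX.
apply: le_lt_trans (h s x); rewrite le_eqVlt; apply/orP; left; apply/eqP.
by apply: eq_integral => p _; rewrite /= ger0_norm// sqr_ge0.
Qed.

Lemma L2_ig phi : measurable_fun setT phi ->
  (forall s x, ig (PP s x) mu s tT (fun p => onX phi p ^+ 2)) -> LX PP V 2 phi.
Proof.
move=> mphi h; apply/LX2P; split => // s x; have /integrableP[_] := h s x.
apply: le_lt_trans; rewrite le_eqVlt; apply/orP; left; apply/eqP.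
by apply: eq_integral => p _; rewrite /= ger0_norm// sqr_ge0.
Qed.

Lemma ig_L2M phi chi s x : LX PP V 2 phi -> LX PP V 2 chi ->
  ig (PP s x) mu s tT (fun p => onX phi p * onX chi p).
Proof.
move=> h1 h2; apply: (integrable_domD (measurable_cyl _ _) _ (ig_L2 s x h1) (ig_L2 s x h2)).
  apply: measurable_funTS; apply: measurable_funM; apply: measurable_onX.
    by case: h1.
  by case: h2.
move=> p _; rewrite normrM ![`|_ ^+ 2|]ger0_norm ?sqr_ge0//.
rewrite -[onX phi p ^+ 2]real_normK ?num_real// -[onX chi p ^+ 2]real_normK ?num_real//.
by have := normr_ge0 (onX phi p); have := normr_ge0 (onX chi p); nra.
Qed.

Lemma L2_cst1 : LX PP V 2 (fun=> 1).
Proof.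
apply: L2_ig; first exact: measurable_cst.
move=> s x; apply: (eq_ig (F := fun p => cst 1 p.2)); first by move=> p; rewrite /onX expr1n.
by apply: ig_snd; exact: finite_measure_integrable_cst.
Qed.

Lemma ig_L1 phi s x : LX PP V 2 phi -> ig (PP s x) mu s tT (onX phi).
Proof.
by move=> h; apply: eq_ig (ig_L2M s x h L2_cst1) => p; rewrite /onX mulr1.
Qed.

Variables (d : nat) (psi : 'I_d -> tm * bE -> R).
Hypotheses (hpsi : forall i, D (psi i)) (hac : forall i, bracket_abs_continuous PP a V (psi i))
  (hapsi : forall i, LX PP V 2 (a (psi i))).
Variable G : 'I_d -> tm * bE -> R.
Hypotheses (hG : forall i, is_bracket_density PP a V (psi i) (G i))
  (hGb : forall i, bounded_function (G i)).

Lemma tnth_Gamma u i p : tnth (Gamma a psi u p) i =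
  a (fun z => u z * psi i z) p - u p * a (psi i) p - psi i p * a u p.
Proof. by rewrite tnth_mktuple. Qed.

Lemma measurable_Gamma u i : dom_Gamma D psi u ->
  measurable_fun setT (fun p => tnth (Gamma a psi u p) i).
Proof.
move=> [Du Dup]; under eq_fun do rewrite tnth_Gamma.
have [mu1 mu2] := measurable_D Du; have [mp1 mp2] := measurable_D (hpsi i).
have [_ m3] := measurable_D (Dup i).
by apply: measurable_funB; [apply: measurable_funB => //|]; exact: measurable_funM.
Qed.

(** The bracket is a process of the completed basis; the integral of its density is a version of it
    which is jointly measurable and determined by the stopped path. The given martingale starts at
    time 0, and only the times from s on are kept. *)
Lemma bracket_mart i s x : amart (PP s x) s
  (fun p => (mpF (psi i) s p - psi i (s, x)) ^+ 2 - \int[mu]_(q in oc s p.1) onX (G i) (q, p.2)).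
Proof.
have [A hA _] := hac i s x; have [_ _ hM] := hA; have [mG hGA] := hG i.
apply: (mart_of_martingale (r := t0) (t0_le s) hM).
- apply: measurable_funB.
    by apply: measurable_funX; apply: measurable_funB => //; exact: measurable_mpF.
  by apply: measurable_int_r; exact: measurable_onX.
- move=> q sq w /=; congr (_ ^+ 2 - _); first by congr (_ - _); exact: na_mpF.
  exact: (@na_int _ _ _ mu s q (onX (G i)) (fun q _ => @na_onX _ _ _ (G i) q) w).
- move=> t st; apply: filterS (hGA s x A hA) => w /(_ t) h.
  rewrite /Defs.mart st /=; congr (_ - _).
  by rewrite /Rintegral -[X in fine X]h.
Qed.

(** [energy_finite] with the martingales of u, psi_i and u psi_i. The sum of the absolute values of
    their three drifts drives the localizing clock; it is almost surely finite by the martingale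
    problem. *)
Lemma Gamma_L2 u i : dom_Gamma D psi u -> LX PP V 2 (fun p => tnth (Gamma a psi u p) i).
Proof.
move=> dG; have [Du Dup] := dG; have mg := measurable_Gamma i dG.
apply/LX2P; split => // s x; have [C hC] := hGb i; have [mG _] := hG i.
pose N p := mpF (psi i) s p - psi i (s, x).
have mNN := mp_mart s x (hpsi i); have sNN : sqint (PP s x) s (mpF (psi i) s) := mp_sqint x (hpsi i).
have [mN1 sN1] : amart (PP s x) s N /\ sqint (PP s x) s N.
  have sC : sqint (PP s x) s (fun=> psi i (s, x)).
    by move=> t _; exact: (finite_measure_integrable_cst (PP s x) _ measurableT).
  (* The bracket concerns the centred martingale of psi_i, so psi_i(s, x) is subtracted here and put
     back as z0. The martingale of u is left uncentred, whence y0 = 0. *)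
  have := mart_lin mNN (mart_cst (PP s x) s (psi i (s, x))) sNN sC (lexx (s : R))
    (measurable_cst (1 : R)) (fun w => erefl) (fun w => lexx `|1|).
  by rewrite (_ : (fun p => _) = N)//; apply/funext => p; rewrite mul1r.
pose b := onX (a u); pose c := onX (a (psi i)); pose sg := onX (a (fun z => u z * psi i z)).
pose k (p : tm * Om) := `|b p| + `|c p| + `|sg p|.
have mb : measurable_fun setT b by apply: measurable_onX; case: (measurable_D Du).
have mc : measurable_fun setT c by apply: measurable_onX; case: (measurable_D (hpsi i)).
have msg : measurable_fun setT sg by apply: measurable_onX; case: (measurable_D (Dup i)).
have mk : measurable_fun setT k.
  by apply: measurable_funD; [apply: measurable_funD|]; exact: measurableT_comp.
have nX phi (q : tm) : (s : R) <= (q : R) -> na q (fun w => onX phi (q, w)) by move=> _; exact: na_onX.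
have k0 p : 0 <= k p by rewrite !addr_ge0.
apply: (@energy_finite _ _ _ (PP s x) mu (muV_atom V) s (mpF u s) N (mpF (fun z => u z * psi i z) s)
  (fun p => N p ^+ 2 - \int[mu]_(q in oc s p.1) onX (G i) (q,
      p.2)) b c sg (onX (G i)) k 0 (psi i (s, x)) C
  (mp_mart s x Du) mN1 (mp_mart s x (Dup i)) (bracket_mart i s x) (mp_sqint x Du) sN1
  mb mc msg (measurable_onX mG) mk (nX _) (nX _) (nX _) (nX _) _ k0) => //.
- by move=> q sq w; rewrite /k /b /c /sg (nX (a u) q sq w) (nX (a (psi i)) q sq w) (nX (a _) q sq w).
- by move=> p; rewrite /k -addrA lerDl addr_ge0.
- by move=> p; rewrite /k addrAC lerDr addr_ge0.
- by move=> p; rewrite /k lerDr addr_ge0.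
- by move=> p; exact: hC.
- apply: filterS (filterI (mp_path s x Du) (filterI (mp_path s x (hpsi i)) (mp_path s x (Dup i))))
    => w [h1 [h2 h3]].
  have i1 := integrableD_R (measurable_oc s tT) (integrableD_R (measurable_oc s tT)
    (integrable_norm h1) (integrable_norm h2)) (integrable_norm h3).
  have /integrableP[_] := i1; apply: le_lt_trans; rewrite /clockp /clockint/= le_eqVlt; apply/orP;
      left; apply/eqP.
  by apply: eq_integral => q _; rewrite /= ger0_norm// !addr_ge0.
- by apply: aeW => w t st; rewrite /proc_of /N /mpF /b /c /sg /onX/=; ring.
- by apply: aeW => w t st; rewrite /= subrK.
- apply: aeW => w t st; rewrite /Gam /proc_of /N /mpF /b /c /sg /onX/= tnth_Gamma; ring.
Qed.

Variables (zeta eta : bE -> R) (f : tm * bE * R * d.-tuple R -> R) (g : bE -> R).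
Hypotheses (meta : measurable_fun setT eta) (eta0 : forall x, 0 <= eta x)
  (hmom : H_mom PP V zeta eta) (hfg : H_growth zeta eta f g).

Definition eta_t (p : tm * bE) : R := eta p.2.

Lemma measurable_eta_t : measurable_fun setT eta_t.
Proof. exact: (measurableT_comp meta measurable_snd). Qed.

Lemma eta_L2 : LX PP V 2 eta_t.
Proof.
apply/LX2P; split => [|s x]; first exact: measurable_eta_t.
have [_] := hmom s x; apply: le_lt_trans.
have m1 : measurable_fun setT (fun p : tm * Om => (onX eta_t p ^+ 2)%:E).
  by apply/measurable_EFinP; apply: measurable_funX; apply: measurable_onX; exact: measurable_eta_t.
have m2 (t : tm) : measurable_fun setT (fun w => \int[mu]_(q in oc t tT) (onX eta_t (q, w) ^+ 2)%:E)%E.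
  have := @measurable_int_e _ _ _ mu t _ m1 (fun p => _) => H.
  by apply: (measurableT_comp (H _) (measurable_pair1 tT)) => p; rewrite lee_fin sqr_ge0.
rewrite (@tonelli_cyl2 _ _ _ (PP s x) mu s tT _ m1); last by move=> p; rewrite lee_fin sqr_ge0.
apply: ge0_le_integral => //.
- by move=> w _; apply: integral_ge0 => q _; rewrite lee_fin sqr_ge0.
- move=> w _; apply: ge0_subset_integral.
  + exact: measurable_oc.
  + exact: measurable_oc.
  + by apply: measurable_funTS; exact: (measurableT_comp m1 (measurable_pair2 w)).
  + by move=> q _; rewrite lee_fin sqr_ge0.
  + by apply: sub_oc => //; exact: t0_le.
Qed.

Lemma L2_dom phi chi : measurable_fun setT phi -> (forall p, `|phi p| <= `|chi p|) ->
  LX PP V 2 chi -> LX PP V 2 phi.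
Proof.
move=> mphi le h; apply: L2_ig => // s x.
apply: (integrable_dom (measurable_cyl _ _) _ (ig_L2 s x h)).
  by apply: measurable_funTS; apply: measurable_funX; exact: measurable_onX.
by move=> p _; rewrite !normrX ler_pXn2r ?nnegrE//; exact: le.
Qed.

Lemma L2D phi chi : LX PP V 2 phi -> LX PP V 2 chi -> LX PP V 2 (fun p => phi p + chi p).
Proof.
move=> h1 h2; have m1 : measurable_fun setT phi by case: h1.
have m2 : measurable_fun setT chi by case: h2.
apply: L2_ig => [|s x]; first exact: measurable_funD.
apply: (integrable_domD (measurable_cyl _ _) _ (igZ 2 (ig_L2 s x h1)) (igZ 2 (ig_L2 s x h2))).
  by apply: measurable_funTS; apply: measurable_funX; apply: measurable_onX; exact: measurable_funD.
move=> p _; rewrite /onX; set y := phi _; set z := chi _.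
have h (r : R) : 0 <= 2 * r ^+ 2 by rewrite mulr_ge0// sqr_ge0.
rewrite [`|(y + z) ^+ 2|]ger0_norm ?sqr_ge0// !(ger0_norm (h _)).
by have := sqr_ge0 (y - z); lra.
Qed.

Lemma L2Z (c : R) phi : LX PP V 2 phi -> LX PP V 2 (fun p => c * phi p).
Proof.
move=> h1; have m1 : measurable_fun setT phi by case: h1.
apply: L2_ig => [|s x]; first exact: measurable_funM.
by apply: eq_ig (igZ (c ^+ 2) (ig_L2 s x h1)) => p; rewrite /onX exprMn.
Qed.

Lemma L2_norm phi : LX PP V 2 phi -> LX PP V 2 (fun p => `|phi p|).
Proof.
move=> h; apply: (L2_dom _ _ h); last by move=> p; rewrite normr_id.
by apply: measurableT_comp => //; case: h.
Qed.

Lemma measurable_comp_f (u : tm * bE -> R) (v : tm * bE -> d.-tuple R) :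
  measurable_fun setT u -> measurable_fun setT v ->
  measurable_fun setT (fun p => f (p, u p, v p)).
Proof.
move=> mu1 mv; have [mf _ _ _] := hfg.
apply: (measurableT_comp mf); apply: measurable_fun_pair => //.
exact: measurable_fun_pair.
Qed.

Lemma measurable_enorm (v : tm * bE -> d.-tuple R) : measurable_fun setT v ->
  measurable_fun setT (fun p => enorm (v p)).
Proof.
move=> mv; apply: (measurableT_comp (continuous_measurable_fun (@sqrt_continuous R))).
apply: measurable_sum => i; apply: measurable_funX.
exact: (measurableT_comp (measurable_tnth i) mv).
Qed.

Lemma L2_enorm (v : tm * bE -> d.-tuple R) : measurable_fun setT v ->
  (forall i, LX PP V 2 (fun p => tnth (v p) i)) -> LX PP V 2 (fun p => enorm (v p)).
Proof.
move=> mv hv; apply: L2_ig => [|s x]; first exact: measurable_enorm.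
apply: (eq_ig (F := fun p => \sum_(i < d) onX (fun p => tnth (v p) i) p ^+ 2)).
  by move=> p; rewrite /onX /enorm sqr_sqrtr// sumr_ge0// => i _; exact: sqr_ge0.
elim: (index_enum _) => [|i r IH].
  by apply: (eq_ig _ (igZ 0 (ig_L2 s x L2_cst1))) => p; rewrite big_nil mul0r.
by apply: (eq_ig _ (igD (ig_L2 s x (hv i)) IH)) => p; rewrite big_cons.
Qed.

Lemma L2_f (u : tm * bE -> R) (v : tm * bE -> d.-tuple R) : LX PP V 2 u -> measurable_fun setT v ->
  (forall i, LX PP V 2 (fun p => tnth (v p) i)) -> LX PP V 2 (fun p => f (p, u p, v p)).
Proof.
move=> hu mv hv; have [_ _ _ [C C0 hf]] := hfg.
have B := L2Z C (L2D (L2D (L2D L2_cst1 eta_L2) (L2_norm hu)) (L2_enorm mv hv)).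
apply: (L2_dom _ _ B); first by apply: measurable_comp_f => //; case: hu.
by move=> [t y]; apply: le_trans (hf t y _ _) _; exact: ler_norm.
Qed.

Lemma measurable_Gamma_tuple u : dom_Gamma D psi u -> measurable_fun setT (Gamma a psi u).
Proof. by move=> h; apply/measurable_fun_tnthP => i; exact: measurable_Gamma. Qed.

(** Along a path, u^2 <= 2 M^2 + 2 (int |a(u)|)^2, and a(u) = -f is bounded through the growth
    condition by u itself and by square integrable terms. Gronwall's lemma on each path then leaves
    a bound whose expectation is finite. *)
Lemma classical_L2 u : classical_solution D a psi f g u -> LX PP V 2 u.
Proof.
move=> [dG eqn _]; have [Du Dup] := dG; have [mu1 mau] := measurable_D Du.
have hv i := Gamma_L2 i dG; have mv := measurable_Gamma_tuple dG.
have [_ _ _ [C C0 hf]] := hfg.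
apply/LX2P; split => // s x.
pose v := fine (mu setT); have v0 : 0 <= v by exact: fine_ge0.
(* The factor 2 comes from the square of a sum, v + 1 from Cauchy-Schwarz in time, 4 C^2 from the
   square of the four-term growth bound. *)
pose c0 : R := 2 * (v + 1) * (4 * C ^+ 2).
have c00 : 0 <= c0 by apply: mulr_ge0; apply: mulr_ge0 => //; [exact: addr_ge0|exact: sqr_ge0].
have [K K0 gr] := gronwall (muV_atom V) s c00.
pose G1 p := 1 + eta_t p ^+ 2 + enorm (Gamma a psi u p) ^+ 2.
have G10 p : 0 <= G1 p by rewrite !addr_ge0// sqr_ge0.
have iG1 : ig (PP s x) mu s tT (onX G1).
  have := igD (igD (ig_L2 s x L2_cst1) (ig_L2 s x eta_L2)) (ig_L2 s x (L2_enorm mv hv)).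
  by apply: eq_ig => p; rewrite /onX expr1n.
have mM := mp_mart s x Du; have sM : sqint (PP s x) s (mpF u s) := mp_sqint x Du.
have iM2 := ig_mart_sq mu mM sM.
pose S w := \int[mu]_(q in oc s tT) onX G1 (q, w).
have iS : igP (PP s x) S := igP_int iG1.
pose al (p : tm * Om) := 2 * mpF u s p ^+ 2 + c0 * S p.2.
have ial : ig (PP s x) mu s tT al by apply: igD; [exact: igZ|apply: igZ; exact: ig_snd].
have S0 w : 0 <= S w by apply: Rintegral_ge0 => q _; exact: G10.
have al0 p : 0 <= al p by rewrite addr_ge0// mulr_ge0// sqr_ge0.
have mal : measurable_fun setT al.
  apply: measurable_funD; apply: measurable_funM => //.
    by apply: measurable_funX; exact: (mart_meas mM).
  have mS : measurable_fun setT S by apply/measurable_EFinP; exact: (measurable_int _ iS).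
  exact: (measurableT_comp mS measurable_snd).
have m2 : measurable_fun setT (fun p : tm * Om => onX u p ^+ 2).
  by apply: measurable_funX; exact: measurable_onX.
have path : \forall w \ae PP s x,
    (\int[mu]_(q in oc s tT) (onX u (q, w) ^+ 2)%:E <= K%:E * \int[mu]_(q in oc s tT) (al (q, w))%:E)%E.
  apply: filterS (filterI (mp_path s x Du) (filterI (ig_path iG1) (ig_path iM2))) => w [ib [iG iM]].
  have Yb t : s <= t :> R -> onX u (t, w) ^+ 2 <=
      2 * mpF u s (t, w) ^+ 2 + 2 * (\int[mu]_(q in oc s t) `|onX (a u) (q, w)|) ^+ 2.
    move=> st; have ibt : mu.-integrable (oc s t) (fun q => (onX (a u) (q, w))%:E).
      apply: (integrableS (measurable_oc s tT)) => //; first exact: measurable_oc.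
      by apply: sub_oc => //; exact: le_tT.
    have := le_normr_Rintegral (measurable_oc s t) ibt.
    rewrite /mpF/=; set I := \int[mu]_(q in oc s t) onX (a u) (q, w).
    set J := \int[mu]_(q in oc s t) `|onX (a u) (q, w)|; set y := onX u (t, w) => IJ.
    have I2 : I ^+ 2 <= J ^+ 2.
      by rewrite -[I ^+ 2]real_normK ?num_real// ler_pXn2r ?nnegrE//; exact: le_trans IJ.
    by have := sqr_ge0 (y - 2 * I); lra.
  apply: gr.
  - exact: (measurable_time_sec w m2).
  - exact: (measurable_time_sec w mal).
  - by move=> q; exact: sqr_ge0.
  - by move=> q; exact: al0.
  (* Finiteness along the path, required by Gronwall: a(u) is integrable along it, so u^2 is at most
     2 M^2 plus a constant. *)
  - set J := \int[mu]_(q in oc s tT) `|onX (a u) (q, w)|.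
    have iB : mu.-integrable (oc s tT) (EFin \o (fun q => 2 * mpF u s (q, w) ^+ 2 + 2 * J ^+ 2)).
      apply: integrableD_R; first exact: measurable_oc.
        by apply: (@integrable_bnd _ _ _ _ _ (cst 2) _ `|2| (measurable_oc _ _) _ iM).
      by apply: finite_measure_integrable_cst; exact: measurable_oc.
    have /integrableP[_] := iB; apply: le_lt_trans; apply: ge0_le_integral.
    + exact: measurable_oc.
    + by move=> q _; rewrite lee_fin sqr_ge0.
    + by apply/measurable_EFinP/measurable_funTS; exact: (measurable_time_sec w m2).
    + by apply: measurableT_comp => //; exact: (measurable_int _ iB).
    move=> q [/= sq qT]; rewrite lee_fin; apply: le_trans (ler_norm _).
    apply: le_trans (Yb q (ltW sq)) _; rewrite lerD2l ler_wpM2l// ler_pXn2r ?nnegrE ?Rintegral_ge0//.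
    have iq t : mu.-integrable (oc s tT `&` oc s t) (fun q => (`|onX (a u) (q, w)|)%:E).
      apply: (integrableS (measurable_oc s tT)) => //; last exact: integrable_norm ib.
      by apply: measurableI; exact: measurable_oc.
    have oq : oc s q = oc s tT `&` oc s q.
      by rewrite setIidr//; apply: sub_oc => //; exact: le_tT.
    have oT : oc s tT = oc s tT `&` oc s tT by rewrite setIid.
    rewrite -lee_fin {1}oq [in leRHS]/J [in leRHS]oT !fineK; first last.
    + by apply: integrable_fin_num => //; apply: measurableI; exact: measurable_oc.
    + by apply: integrable_fin_num => //; apply: measurableI; exact: measurable_oc.
    rewrite -oq -oT; apply: ge0_subset_integral => //; [exact: measurable_oc|exact: measurable_oc| |].
    + exact: (measurable_int _ (integrable_norm ib)).
    + by apply: sub_oc => //; exact: le_tT.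
  - move=> t [/= st tT'].
    have st' := ltW st.
    have ibt : mu.-integrable (oc s t) (EFin \o (fun q => onX (a u) (q, w))).
      apply: (integrableS (measurable_oc s tT)) => //; first exact: measurable_oc.
      by apply: sub_oc => //; exact: le_tT.
    have CS := cauchy_schwarz_cst (measurable_oc s t) ibt.
    have mG1 : measurable_fun (oc s tT) (fun q => (onX G1 (q, w))%:E) by exact: (measurable_int _ iG).
    have mo t' (F : tm * Om -> R) : measurable_fun setT F -> measurable_fun (oc s t') (fun q => (F
        (q, w))%:E).
      by move=> mF; apply/measurable_EFinP/measurable_funTS; exact: (measurable_time_sec w mF).
    have GS : (\int[mu]_(q in oc s t) (onX G1 (q, w))%:E <= (S w)%:E)%E.
      rewrite fineK; last exact: (integrable_fin_num (measurable_oc _ _) iG).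
      apply: ge0_subset_integral => //; [exact: measurable_oc|exact: measurable_oc| |].
        by move=> q _; rewrite lee_fin; exact: G10.
      by apply: sub_oc => //; exact: le_tT.
    have mG1t : measurable_fun (oc s t) (fun q => (onX G1 (q, w))%:E).
      apply: (measurable_funS (measurable_oc s tT)) => //.
      by apply: sub_oc => //; exact: le_tT.
    have B2 : (\int[mu]_(q in oc s t) (onX (a u) (q, w) ^+ 2)%:E <=
       (4 * C ^+ 2)%:E * ((S w)%:E + \int[mu]_(q in oc s t) (onX u (q, w) ^+ 2)%:E))%E.
      apply: (@le_trans _ _ (\int[mu]_(q in oc s t) ((4 * C ^+ 2)%:E * ((onX G1 (q,
          w))%:E + (onX u (q, w) ^+ 2)%:E)))%E).
        apply: ge0_le_integral.
        + exact: measurable_oc.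
        + by move=> q _; rewrite lee_fin sqr_ge0.
        + apply: (mo t (fun p => onX (a u) p ^+ 2)); apply: measurable_funX; exact: measurable_onX.
        + apply: emeasurable_funM => //; apply: emeasurable_funD => //; exact: (mo t _ m2).
        move=> q _; rewrite -EFinD -EFinM lee_fin.
        set p := (q, w q : bE).
        have -> : onX (a u) (q, w) = - f (p, u p, Gamma a psi u p).
          by apply/eqP; rewrite -subr_eq0 opprK; apply/eqP; exact: eqn.
        rewrite sqrrN -real_normK ?num_real//.
        have := hf q (w q) (u p) (Gamma a psi u p); rewrite /onX -/p /G1 /eta_t /=.
        set e := eta _; set z := enorm _; set y := u p; have e0' : 0 <= e by exact: eta0.
        have z0 : 0 <= z by exact: sqrtr_ge0.
        move: (`|f _|) (normr_ge0 (f (p, y, Gamma a psi u p))) => F F0 FB.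
        rewrite -[y ^+ 2]real_normK ?num_real//; move: (`|y|) (normr_ge0 y) FB => y' y'0 FB.
        apply: (@le_trans _ _ ((C * (1 + e + y' + z)) ^+ 2)).
          by rewrite ler_pXn2r ?nnegrE//; exact: le_trans FB.
        have sq : (1 + e + y' + z) ^+ 2 <= 4 * (1 + e ^+ 2 + z ^+ 2 + y' ^+ 2).
          have q1 := sqr_ge0 (1 - e); have q2 := sqr_ge0 (1 - y'); have q3 := sqr_ge0 (1 - z).
          have q4 := sqr_ge0 (e - y'); have q5 := sqr_ge0 (e - z); have q6 := sqr_ge0 (y' - z).
          lra.
        rewrite exprMn; apply: le_trans (ler_wpM2l (sqr_ge0 C) sq) _.
        by rewrite le_eqVlt; apply/orP; left; apply/eqP; ring.
      rewrite ge0_integralZl_EFin; first last.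
      + by rewrite mulr_ge0// sqr_ge0.
      + by apply: emeasurable_funD => //; exact: (mo t _ m2).
      + by move=> q _; rewrite -EFinD lee_fin addr_ge0 ?sqr_ge0//; exact: G10.
      + exact: measurable_oc.
      apply: lee_wpmul2l; first by rewrite lee_fin mulr_ge0// sqr_ge0.
      rewrite ge0_integralD; [|exact: measurable_oc| |exact: mG1t| |exact: (mo t _ m2)]; first last.
      + by move=> q _; rewrite lee_fin sqr_ge0.
      + by move=> q _; rewrite lee_fin; exact: G10.
      exact: leeD.
    apply: (@le_trans _ _ ((2 * mpF u s (t,
        w) ^+ 2)%:E + 2%:E * ((v + 1)%:E * ((4 * C ^+ 2)%:E * ((S w)%:E + \int[mu]_(q in oc s t)
        (onX u (q, w) ^+ 2)%:E))))%E).
      apply: (@le_trans _ _ (2 * mpF u s (t, w) ^+ 2 + 2 * (\int[mu]_(q in oc s t) `|onX (a u) (q,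
          w)|) ^+ 2)%:E).
        by rewrite lee_fin; exact: Yb.
      rewrite EFinD leeD2l// EFinM lee_wpmul2l ?lee_fin//.
      apply: le_trans CS _; rewrite lee_wpmul2l ?lee_fin ?addr_ge0//.
    rewrite !muleA -!EFinM -/c0 ge0_muleDr ?lee_fin//; last by apply: integral_ge0 => q _;
        rewrite lee_fin sqr_ge0.
    by rewrite addeA -EFinM -EFinD.
rewrite (@tonelli_cyl2 _ _ _ (PP s x) mu s tT (fun p => (onX u p ^+ 2)%:E)); first last.
- by move=> p; rewrite lee_fin sqr_ge0.
- exact/measurable_EFinP.
have mint (F : tm * Om -> R) : measurable_fun setT F -> (forall p, 0 <= F p) ->
    measurable_fun setT (fun w => \int[mu]_(q in oc s tT) (F (q, w))%:E)%E.
  move=> mF F0; have mFe : measurable_fun setT (EFin \o F) by exact/measurable_EFinP.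
  exact: (measurableT_comp (@measurable_int_e _ _ _ mu s _ mFe (fun p => F0 p)) (measurable_pair1 tT)).
apply: (@le_lt_trans _ _ (\int[PP s x]_w (K%:E * \int[mu]_(q in oc s tT) (al (q, w))%:E))%E).
  apply: ae_ge0_le_integral => //.
  - by move=> w _; apply: integral_ge0 => q _; rewrite lee_fin sqr_ge0.
  - by apply: (mint (fun p => onX u p ^+ 2)) => // p; exact: sqr_ge0.
  - by move=> w _; rewrite mule_ge0 ?lee_fin//; apply: integral_ge0 => q _; rewrite lee_fin.
  - by apply: emeasurable_funM => //; exact: mint.
  - by apply: filterS path.
rewrite ge0_integralZl_EFin//; first last.
- exact: mint.
- by move=> w _; apply: integral_ge0 => q _; rewrite lee_fin.
rewrite -(@tonelli_cyl2 _ _ _ (PP s x) mu s tT (fun p => (al p)%:E)); first last.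
- by move=> p; rewrite lee_fin.
- exact/measurable_EFinP.
rewrite lte_mul_pinfty ?lee_fin//.
have /integrableP[_] := ial; apply: le_lt_trans; rewrite le_eqVlt; apply/orP; left; apply/eqP.
by apply: eq_integral => p _; rewrite /= ger0_norm.
Qed.

Let vol := fine (mu setT) + 1.

(** The last term does not depend on t, so the bound is usable both under the time integral and at
    T. *)
Lemma path_sq_le phi s x : D phi -> LX PP V 2 (a phi) ->
  \forall w \ae PP s x, forall t, s <= t :> R -> onX phi (t, w) ^+ 2 <=
    2 * mpF phi s (t, w) ^+ 2 + 2 * vol * \int[mu]_(q in oc s tT) (onX (a phi) (q, w) ^+ 2).
Proof.
move=> Dphi h; have ia2 := ig_L2 s x h; have v0 : 0 <= vol by rewrite addr_ge0// fine_ge0.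
apply: filterS (filterI (mp_path s x Dphi) (ig_path ia2)) => w [ib ib2] t st.
have ibt : mu.-integrable (oc s t) (EFin \o (fun q => onX (a phi) (q, w))).
  apply: (integrableS (measurable_oc s tT)) => //; first exact: measurable_oc.
  by apply: sub_oc => //; exact: le_tT.
have IJ := le_normr_Rintegral (measurable_oc s t) ibt.
set S := \int[mu]_(q in oc s tT) (onX (a phi) (q, w) ^+ 2).
have J2 : (\int[mu]_(q in oc s t) `|onX (a phi) (q, w)|) ^+ 2 <= vol * S.
  rewrite -lee_fin; apply: le_trans (cauchy_schwarz_cst (measurable_oc s t) ibt) _.
  rewrite EFinM; apply: lee_wpmul2l; first by rewrite lee_fin.
  rewrite fineK; last exact: (integrable_fin_num (measurable_oc _ _) ib2).
  apply: ge0_subset_integral => //; [exact: measurable_oc|exact: measurable_oc| | |].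
  - exact: (measurable_int _ ib2).
  - by move=> q _; rewrite lee_fin sqr_ge0.
  - by apply: sub_oc => //; exact: le_tT.
move: IJ J2; rewrite /mpF/=; set I := \int[mu]_(q in oc s t) onX (a phi) (q, w).
set J := \int[mu]_(q in oc s t) `|onX (a phi) (q, w)|; set y := onX phi (t, w) => IJ J2.
have I2 : I ^+ 2 <= J ^+ 2.
  by rewrite -[I ^+ 2]real_normK ?num_real// ler_pXn2r ?nnegrE//; exact: le_trans IJ.
by have := sqr_ge0 (y - 2 * I); rewrite -[2 * vol * _]mulrA; lra.
Qed.

Lemma LX_of_a phi : D phi -> LX PP V 2 (a phi) -> LX PP V 2 phi.
Proof.
move=> Dphi h; have [m1 m2] := measurable_D Dphi; apply: L2_ig => // s x.
have mM := mp_mart s x Dphi; have sM : sqint (PP s x) s (mpF phi s) := mp_sqint x Dphi.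
have iB := igD (igZ 2 (ig_mart_sq mu mM sM)) (igZ (2 * vol) (ig_snd mu s tT (igP_int (ig_L2 s x h)))).
apply: (integrable_ae_le (measurable_cyl s tT) _ iB).
  by apply: measurable_funTS; apply: measurable_funX; exact: measurable_onX.
apply: ae_cyl_from; apply: filterS (path_sq_le s x Dphi h) => w le t st.
by rewrite ger0_norm ?sqr_ge0//; apply: le_trans (ler_norm _); exact: le.
Qed.

Lemma igP_sq_T phi s x : D phi -> LX PP V 2 (a phi) ->
  igP (PP s x) (fun w => onX phi (tT, w) ^+ 2).
Proof.
move=> Dphi h; have [m1 m2] := measurable_D Dphi.
have sM : sqint (PP s x) s (mpF phi s) := mp_sqint x Dphi.
have igPZ (c : R) X : igP (PP s x) X -> igP (PP s x) (fun w => c * X w).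
  by move=> iX; apply: (igPM (k := `|c|)) iX => //; exact: measurable_cst.
have iB := igPD (igPZ 2 _ (sM tT (le_tT s))) (igPZ (2 * vol) _ (igP_int (ig_L2 s x h))).
apply: (integrable_ae_le measurableT _ iB).
  by apply: measurable_funX; apply: measurable_sec; exact: measurable_onX.
apply: filterS (path_sq_le s x Dphi h) => w le _.
by rewrite ger0_norm ?sqr_ge0//; apply: le_trans (ler_norm _); exact: (le tT (le_tT s)).
Qed.

Variable P : tm -> tm -> R.-pker bE ~> bE.
Hypotheses (hP : transition_kernel P) (hPP : canonical_Markov_class P PP).

(** The transition kernel over an empty lapse of time is a Dirac mass. *)
Lemma start_integral s x (F : bE -> \bar R) : measurable_fun setT F ->
  (\int[P s s x]_y F y = F x)%E.
Proof.
move=> mF; rewrite (@eq_measure_integral _ _ _ setT (\d_(x : bE))).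
  by rewrite integral_dirac// diracT mul1e.
by move=> A mA _; case: hP => h _; rewrite h.
Qed.

(** Equality of the expectations of the martingale at s and at T; at s its law is concentrated at
    the value phi(s, x). *)
Lemma mp_expect phi s x : D phi -> ig (PP s x) mu s tT (onX (a phi)) ->
  igP (PP s x) (fun w => onX phi (tT, w)) /\
  (phi (s, x))%:E = (\int[P s tT x]_y (phi (tT, y))%:E -
    (iint (PP s x) mu s tT (onX (a phi)))%:E)%E.
Proof.
move=> Dphi ia; have [m1 m2] := measurable_D Dphi.
have mM := mp_mart s x Dphi; have iT := mart_ig mM (le_tT s).
have ii := igP_int ia.
have iphi : igP (PP s x) (fun w => onX phi (tT, w)).
  by apply: eq_igP (igPD iT ii) => w; rewrite /mpF/= subrK.
have mt t : measurable_fun setT (fun y : bE => (phi (t, y))%:E).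
  by apply/measurable_EFinP; exact: (measurableT_comp m1 (measurable_pair1 t)).
split => //; rewrite (law_integral hPP)//.
have := mart_eq mM (lexx (s : R)) (le_tT s) measurableT (fun w => erefl).
have -> : (\int[PP s x]_w (mpF phi s (s, w))%:E = (phi (s, x))%:E)%E.
  rewrite -(start_integral s x (mt s)) (law_integral hPP)//; apply: eq_integral => w _.
  by rewrite /mpF/= oc0 Rintegral_set0 subr0.
move=> <-; rewrite iint_EE// /EE fineK; last exact: (integrable_fin_num measurableT ii).
by rewrite -integralB_EFin//; apply: eq_integral => w _.
Qed.

Lemma psi_L2 i : LX PP V 2 (psi i).
Proof. exact: LX_of_a. Qed.

(** The auxiliary function v is Gamma(u). Since a(u) = -f is square integrable, [mp_expect] applies
    to u and to the u psi_i. *)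
Lemma classical_mild u : classical_solution D a psi f g u ->
  decoupled_mild_solution P PP a V psi f g u.
Proof.
move=> cu; have hu := classical_L2 cu; have [dG eqn eT] := cu; have [Du Dup] := dG.
have [mu1 mau] := measurable_D Du.
have hv i := Gamma_L2 i dG; have mv := measurable_Gamma_tuple dG.
split => //; exists (Gamma a psi u); split => // s x.
have hF := L2_f hu mv hv.
have Fa p : f (p, u p, Gamma a psi u p) = - a u p.
  by apply/eqP; rewrite -addr_eq0 addrC; apply/eqP; exact: eqn.
have hau : LX PP V 2 (a u).
  have h1 := L2Z (-1) hF; rewrite (_ : a u = fun p => -1 * f (p, u p, Gamma a psi u p))//.
  by apply/funext => p; rewrite Fa; ring.
have mF : measurable_fun setT (fun p => f (p, u p, Gamma a psi u p)) by case: hF.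
split.
  have [_ ->] := mp_expect Du (ig_L1 s x hau); congr (_ + _)%E.
    by apply: eq_integral => y _; rewrite eT.
  apply: (etrans _ (esym (kernel_iint hPP mF (ig_L1 s x hF)))); rewrite -EFinN -mulN1r -iintZ;
      last exact: ig_L1.
  by congr EFin; apply: eq_iint => p; rewrite /onX Fa; ring.
move=> i; have Dpi := Dup i.
(* By definition of Gamma and by the equation, the second mild integrand is a(u psi_i). *)
pose F2 p := tnth (Gamma a psi u p) i + u p * a (psi i) p - psi i p * f (p, u p, Gamma a psi u p).
have F2a p : F2 p = a (fun z => u z * psi i z) p by rewrite /F2 tnth_Gamma Fa; ring.
have mF2 : measurable_fun setT F2.
  rewrite (_ : F2 = a (fun z => u z * psi i z)); first by case: (measurable_D Dpi).
  by apply/funext.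
have iF2 : ig (PP s x) mu s tT (onX F2).
  have := igB (igD (ig_L1 s x (hv i)) (ig_L2M s x hu (hapsi i))) (ig_L2M s x (psi_L2 i) hF).
  exact: eq_ig.
have ia2 : ig (PP s x) mu s tT (onX (a (fun z => u z * psi i z))).
  by apply: eq_ig iF2 => p; rewrite /onX F2a.
have [_ e] := mp_expect Dpi ia2.
rewrite [LHS]e.
congr (_ - _)%E.
  by apply: eq_integral => y _; rewrite eT.
apply: (etrans _ (esym (kernel_iint hPP mF2 iF2))).
by congr EFin; apply: eq_iint => p; rewrite /onX F2a.
Qed.

Hypotheses (mzeta : measurable_fun setT zeta) (zeta0 : forall x, 0 <= zeta x).

Lemma igP_g_sq s x : igP (PP s x) (fun w => g (w tT) ^+ 2).
Proof.
have [_ mg [C C0 hg] _] := hfg; have [hz _] := hmom s x.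
have mz : measurable_fun setT (fun w : Om => zeta (w tT)).
  exact: (measurableT_comp mzeta (measurable_eval tT)).
have iz : igP (PP s x) (fun w => zeta (w tT) ^+ 2).
  apply/integrableP; split; first by apply/measurable_EFinP; exact: measurable_funX.
  apply: le_lt_trans hz; rewrite le_eqVlt; apply/orP; left; apply/eqP.
  by apply: eq_integral => w _; rewrite /= ger0_norm// sqr_ge0.
have i1 : igP (PP s x) (fun w => 1) by exact: finite_measure_integrable_cst.
have iB : igP (PP s x) (fun w => 2 * C ^+ 2 * (1 + zeta (w tT) ^+ 2)).
  by apply: (igPM (k := `|2 * C ^+ 2|)) (igPD i1 iz) => //; exact: measurable_cst.
apply: (integrable_dom measurableT _ iB).
  by apply: measurable_funX; exact: (measurableT_comp mg (measurable_eval tT)).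
move=> w _; rewrite ger0_norm ?sqr_ge0//; apply: le_trans (ler_norm _).
have := hg (w tT); have := zeta0 (w tT); have := normr_ge0 (g (w tT)).
rewrite -[g _ ^+ 2]real_normK ?num_real//; move: `|g _| (zeta _) => y z y0 z0 yz.
apply: (@le_trans _ _ ((C * (1 + z)) ^+ 2)).
  by rewrite ler_pXn2r ?nnegrE//; exact: le_trans yz.
rewrite exprMn (_ : 2 * C ^+ 2 * (1 + z ^+ 2) = C ^+ 2 * (2 * (1 + z ^+ 2))); last by ring.
by apply: (ler_wpM2l (sqr_ge0 C)); have := sqr_ge0 (1 - z); lra.
Qed.

(** Each mild equation yields a second martingale for u or for u psi_i; [drift_unique] identifies
    the two drifts under every starting point. *)
Lemma mild_classical u : decoupled_mild_solution P PP a V psi f g u -> dom_Gamma D psi u ->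
  (forall x, u (tT, x) = g x) /\
  exists2 A, zero_potential PP V A &
    forall p, ~ A p -> a u p + f (p, u p, Gamma a psi u p) = 0.
Proof.
move=> [mu1 [v [mv hu hv e]]] dG; have [Du Dup] := dG.
have [_ mau] := measurable_D Du; have mG' := measurable_Gamma_tuple dG.
have hF := L2_f hu mv hv; pose F p := f (p, u p, v p); have mF : measurable_fun setT F by case: hF.
have [_ mg _ _] := hfg.
(* The first mild equation at s = T: the time integral is over the empty set and the kernel is a
   Dirac mass. *)
have uT x : u (tT, x) = g x.
  have [e1 _] := e tT x; move: e1; rewrite oc0 integral_set0 adde0 start_integral => [[]//|].
  exact/measurable_EFinP.
split => //.
have mTx (phi : tm * bE -> R) : measurable_fun setT phi -> measurable_fun setT (fun w : Om => onX
    phi (tT, w)).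
  by move=> m; apply: measurable_sec; exact: measurable_onX.
have iu2 s x : igP (PP s x) (fun w => onX u (tT, w) ^+ 2).
  by apply: eq_igP (igP_g_sq s x) => w; rewrite /onX uT.
have iu s x : igP (PP s x) (fun w => onX u (tT, w)).
  have i1 : igP (PP s x) (fun w => 1 ^+ 2) by exact: finite_measure_integrable_cst.
  have := igP_mul (mTx _ mu1) (@measurable_cst _ _ _ _ setT (1 : R)) (iu2 s x) i1.
  by apply: eq_igP => w; rewrite mulr1.
(* The sign is changed to fit the form of [mild_mart], where the time integral is subtracted. *)
pose NF p := - F p; have mNF : measurable_fun setT NF by exact: measurableT_comp.
have iNF s x : ig (PP s x) mu s tT (onX NF).
  by apply: eq_ig (igZ (-1) (ig_L1 s x hF)) => p; rewrite mulN1r.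
have M1 s x : amart (PP s x) s (fun p => onX u p - \int[mu]_(q in oc s p.1) onX NF (q, p.2)).
  apply: (mild_mart hPP s x mu1 mNF iu iNF) => t y; have [-> _] := e t y; congr (_ + _)%E.
    by apply: eq_integral => z _; rewrite uT.
  rewrite (kernel_iint hPP mNF (iNF t y)) -EFinN -mulN1r -iintZ; last exact: iNF.
  rewrite -/(krun V P F t y) (kernel_iint hPP mF (ig_L1 t y hF)).
  by congr EFin; apply: eq_iint => p; rewrite /onX /NF mulN1r opprK.
have K1 s x : \forall p \ae (mu \x PP s x)%E, cyl s tT p -> onX (a u) p = onX NF p.
  apply: (drift_unique (muV_atom V) mau mNF (mp_mart s x Du) (M1 s x) (mp_path s x Du)).
  exact: ig_path (iNF s x).
pose F2 i p := tnth (v p) i + u p * a (psi i) p - psi i p * F p.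
have mpsi i : measurable_fun setT (psi i) by have [] := measurable_D (hpsi i).
have mapsi i : measurable_fun setT (a (psi i)) by have [] := measurable_D (hpsi i).
have mF2 i : measurable_fun setT (F2 i).
  apply: measurable_funB; last exact: measurable_funM.
  apply: measurable_funD; last exact: measurable_funM.
  by have [] := hv i.
have iF2 i s x : ig (PP s x) mu s tT (onX (F2 i)).
  have := igB (igD (ig_L1 s x (hv i)) (ig_L2M s x hu (hapsi i))) (ig_L2M s x (psi_L2 i) hF).
  exact: eq_ig.
have M2 i s x : amart (PP s x) s
    (fun p => onX (fun z => u z * psi i z) p - \int[mu]_(q in oc s p.1) onX (F2 i) (q, p.2)).
  apply: (mild_mart hPP s x _ (mF2 i) _ (iF2 i)); first exact: measurable_funM.
    move=> t y; apply: (igP_mul (mTx _ mu1) (mTx _ (mpsi i)) (iu2 t y)).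
    exact: (igP_sq_T t y (hpsi i) (hapsi i)).
  move=> t y; have [_ /(_ i) ->] := e t y; congr (_ - _)%E.
  by apply: eq_integral => z _; rewrite uT.
have K2 s x : \forall p \ae (mu \x PP s x)%E, forall i, cyl s tT p ->
    onX (a (fun z => u z * psi i z)) p = onX (F2 i) p.
  apply: filter_forall => i; have Di := Dup i; have [_ mai] := measurable_D Di.
  apply: (drift_unique (muV_atom V) mai (mF2 i) (mp_mart s x Di) (M2 i s x) (mp_path s x Di)).
  exact: ig_path (iF2 i s x).
pose res p := a u p + f (p, u p, Gamma a psi u p).
have mres : measurable_fun setT res.
  by apply: measurable_funD => //; exact: measurable_comp_f.
pose A := [set p | res p <> 0]; have mA : measurable A.
  rewrite (_ : A = ~` (setT `&` res @^-1` [set 0])); last by rewrite setTI.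
  by apply: measurableC; exact: mres.
exists A; last by move=> p /contrapT.
split => // s x.
have m1 : measurable_fun setT (fun p : tm * Om => (\1_A (p.1, p.2 p.1 : bE))%:E : \bar R).
  by apply/measurable_EFinP; apply: (measurable_onX (phi := \1_A)); exact: measurable_indic.
rewrite -(@tonelli_cyl2 _ _ _ (PP s x) mu s tT _ m1); last by move=> p; rewrite lee_fin.
rewrite (ae_eq_integral (cst 0%E)) ?integral0//; first exact: measurable_cyl.
  exact: measurable_funTS.
apply: filterS (filterI (K1 s x) (K2 s x)) => p [k1 k2] cp.
rewrite indicE memNset//= /A/= => /(_ _); apply.
have {}k1 := k1 cp; have {}k2 i := k2 i cp; move: k1 k2; rewrite /onX.
(* At such a point both drifts are known, so the definition of Gamma(u) gives v, and the residual
   becomes -f + f. *)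
set z := (p.1, _) => k1 k2; have Gv : Gamma a psi u z = v z.
  apply: eq_from_tnth => i; rewrite tnth_Gamma k1 k2 /F2 /NF; ring.
by rewrite /res Gv k1 /NF /F addNr.
Qed.

End setting.

Theorem proposition5p17 (R : realType) (T : {nonneg R})
    (E : completePseudoMetricType R) (hE : polish E)
    (P : time T -> time T -> R.-pker (borel E) ~> (borel E))
    (hP : transition_kernel P) (hPt : measurable_in_time P)
    (PP : time T -> E -> probability (Omega T E) R)
    (hPP : canonical_Markov_class P PP)
    (V : clock T)
    (D : set (time T * borel E -> R))
    (a : (time T * borel E -> R) -> time T * borel E -> R)
    (ha : linear_operator D a)
    (hmp : solves_martingale_problem PP D a V)
    (d : nat) (psi : 'I_d -> time T * borel E -> R)
    (hpsi : forall i, D (psi i))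
    (hac : forall i, bracket_abs_continuous PP a V (psi i))
    (hapsi : forall i, LX PP V 2 (a (psi i)))
    (G : 'I_d -> time T * borel E -> R)
    (hG : forall i, is_bracket_density PP a V (psi i) (G i))
    (hGb : forall i, bounded_function (G i))
    (zeta eta : borel E -> R)
    (hzeta : measurable_fun setT zeta) (hzeta0 : forall x, 0 <= zeta x)
    (heta : measurable_fun setT eta) (heta0 : forall x, 0 <= eta x)
    (hmom : H_mom PP V zeta eta)
    (f : time T * borel E * R * d.-tuple R -> R) (g : borel E -> R)
    (hfg : H_growth zeta eta f g) :
  (forall u : time T * borel E -> R,
     classical_solution D a psi f g u ->
     decoupled_mild_solution P PP a V psi f g u) /\
  (forall u : time T * borel E -> R,
     decoupled_mild_solution P PP a V psi f g u -> dom_Gamma D psi u ->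
     (forall x, u (tT, x) = g x) /\
     exists2 A, zero_potential PP V A &
       forall p, ~ A p -> a u p + f (p, u p, Gamma a psi u p) = 0).
Proof.
split => [u|u hu]; first exact: (classical_mild ha hmp hpsi hac hapsi hG hGb heta heta0 hmom hfg hP hPP).
exact: (mild_classical ha hmp hpsi hapsi heta hmom hfg hP hPP hzeta hzeta0 hu).
Qed.
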